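(* Let $r,c$ be positive integers and let $\mathcal{M}_1(r,c)$ be the moduli space of rank $r$, charge $c$ framed instanton bundles on $\mathbb{CP}^3$. Then $\mathcal{M}_1(r,c)$ has no compact complex subvarieties of positive dimension.
   Context: **The space $\mathcal{M}_1(r,c)$.** Let $V,W$ be complex vector spaces with $\dim V=c$, $\dim W=r$. Consider $\tilde A=A_0z_0+A_1z_1$, $\tilde B=B_0z_0+B_1z_1$, $\tilde I=I_0z_0+I_1z_1$, $\tilde J=J_0z_0+J_1z_1$ with $A_k,B_k\in\operatorname{End}(V)$, $I_k\in\operatorname{Hom}(W,V)$, $J_k\in\operatorname{Hom}(V,W)$ and $[z_0:z_1]$ homogeneous coordinates on $\mathbb{CP}^1$. A quadruple $(A,B,I,J)\in\operatorname{End}(V)^2\oplus\operatorname{Hom}(W,V)\oplus\operatorname{Hom}(V,W)$ is *regular* if there is no subspace $S\subsetneq V$ with $A(S),B(S)\subset S$, $I(W)\subset S$, and no nonzero subspace $S\subset V$ with $A(S),B(S)\subset S$, $S\subset\ker J$. The datum $(\tilde A,\tilde B,\tilde I,\tilde J)$ is *globally regular* if its value at every $p\in\mathbb{CP}^1$ is regular. $\mathcal{M}_1(r,c)$ is the set of globally regular solutions of $[\tilde A,\tilde B]+\tilde I\tilde J=0$ modulo the action $g\cdot(\tilde A,\tilde B,\tilde I,\tilde J)=(g\tilde Ag^{-1},g\tilde Bg^{-1},g\tilde I,\tilde Jg^{-1})$ of $GL(V)$, with its natural quotient complex structure. By the ADHM correspondence its points are isomorphism classes of pairs $(E,\phi)$,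 where $E$ is a rank $r$ locally free sheaf on $\mathbb{CP}^3$ with $c_1(E)=0$, $c_2(E)=c$, $H^0(E(-1))=H^3(E(-3))=H^1(E(-2))=H^2(E(-2))=0$, and $\phi:E|_\ell\to\mathcal{O}_\ell^{\oplus r}$ is an isomorphism, $\ell\subset\mathbb{CP}^3$ a fixed line. *)

(* Defs.v *)
From HB Require Import structures.
From mathcomp Require Import all_boot all_order all_algebra.
From mathcomp Require Import complex.
From mathcomp Require Import all_classical all_reals all_analysis.
Set Implicit Arguments.
Unset Strict Implicit.
Unset Printing Implicit Defensive.
Import Order.TTheory GRing.Theory Num.Theory.
Import numFieldNormedType.Exports.
Local Open Scope classical_set_scope.
Local Open Scope ring_scope.
Local Open Scope complex_scope.

(* The standard topology and normed space structure of the field C = R[i]. *)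
HB.instance Definition _ (R : rcfType) :=
  PseudoPointedMetric.copy R[i] R[i]^o.
HB.instance Definition _ (R : rcfType) := GRing.ComAlgebra.copy R[i] R[i]^o.
HB.instance Definition _ (R : rcfType) := Vector.copy R[i] R[i]^o.
HB.instance Definition _ (R : rcfType) := NormedModule.copy R[i] R[i]^o.

(* A (reduced) complex space is presented as a topological space T together
   with a structure sheaf of C-valued functions: [O U f] says that f is
   holomorphic on U.  Functions are total, only their values on U matter. *)
Definition function_sheaf (R : realType) (T : topologicalType) : Type :=
  set T -> (T -> R[i]) -> Prop.

(* Complex Frechet differentiability at every point of an open set. *)
Definition holomorphic_on (R : realType) (E : normedModType R[i])
    (U : set E) (f : E -> R[i]) : Prop :=
  forall x, U x -> differentiable f x.

(* The reduced structure sheaf of a subset X of a complex vector space: local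
   restrictions of holomorphic functions of the ambient space. *)
Definition restricted_sheaf (R : realType) (E : normedModType R[i])
    (X : set E) : function_sheaf R X :=
  fun U f => forall x, U x -> exists (W : set E) (g : E -> R[i]),
    [/\ open W, W (set_val x), holomorphic_on W g &
        forall y, U y -> W (set_val y) -> f y = g (set_val y)].

(* The holomorphic functions on a quotient are those whose pullback is. *)
Definition quotient_sheaf (R : realType) (T : topologicalType)
    (Q : quotType T) (O : function_sheaf R T) :
    function_sheaf R (quotient_topology Q) :=
  fun U f => O (\pi_Q @^-1` U)%qT (f \o \pi_Q)%qT.

Section ComplexSubvarieties.
Variables (R : realType) (T : topologicalType) (O : function_sheaf R T).

(* Since x ranges over all of T and not only over Z, such a Z is closed.  It
   may be reducible. *)
Definition complex_subvariety (Z : set T) : Prop :=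
  forall x : T, exists (U : set T) (n : nat) (f : 'I_n -> T -> R[i]),
    [/\ open U, U x, forall i, O U (f i) &
        forall y, U y -> (Z y <-> forall i, f i y = 0)].

(* Near x, Z is a complex manifold of dimension d: phi and psi are mutually
   inverse biholomorphisms between Z `&` U and an open subset V of C^d. *)
Definition regular_point (Z : set T) (d : nat) (x : T) : Prop :=
  Z x /\
  exists (U : set T) (V : set 'rV[R[i]]_d)
         (phi : T -> 'rV[R[i]]_d) (psi : 'rV[R[i]]_d -> T),
    [/\ open U /\ U x, open V,
        (forall i, O U (fun y => phi y 0 i)) /\
        (forall y, (Z `&` U) y -> V (phi y) /\ psi (phi y) = y),
        (forall v, V v -> (Z `&` U) (psi v) /\ phi (psi v) = v) &
        (forall v, V v -> {for v, continuous psi}) /\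
        (forall (W : set T) (g : T -> R[i]), open W -> O W g ->
           holomorphic_on (V `&` psi @^-1` W) (g \o psi))].

(* The supremum of the dimensions at regular points; it is -oo for Z = set0. *)
Definition subvariety_dim (Z : set T) : \bar R :=
  ereal_sup [set d%:R%:E | d in [set d : nat | exists x, regular_point Z d x]].

End ComplexSubvarieties.

Section ADHM.
Variables (R : realType) (r c : nat).
Local Notation C := (R[i]).

(* Quadruples (A, B, i, j) with V = C^c and W = C^r, matrices acting on column
   vectors from the left. *)
Definition quadruple : normedModType C :=
  ('M[C]_c * 'M[C]_c * 'M[C]_(c, r) * 'M[C]_(r, c))%type.

Definition invariant_subspace (A B : 'M[C]_c) (S : {vspace 'cV[C]_c}) : Prop :=
  forall v, v \in S -> A *m v \in S /\ B *m v \in S.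

Definition regular_quadruple (q : quadruple) : Prop :=
  let: (A, B, i, j) := q in
  (~ exists S : {vspace 'cV[C]_c},
      [/\ S <> fullv, invariant_subspace A B S &
          forall w : 'cV[C]_r, i *m w \in S]) /\
  (~ exists S : {vspace 'cV[C]_c},
      [/\ S <> 0%VS, invariant_subspace A B S &
          forall v, v \in S -> j *m v = 0]).

Definition adhm_map (q : quadruple) : 'M[C]_c :=
  let: (A, B, i, j) := q in A *m B - B *m A + i *m j.

Definition act (g : 'M[C]_c) (q : quadruple) : quadruple :=
  let: (A, B, i, j) := q in
  (g *m A *m invmx g, g *m B *m invmx g, g *m i, j *m invmx g).

(* The pair of coefficients of z_0 and z_1 of the linear forms
   (A~, B~, I~, J~). *)
Definition datum : normedModType C := (quadruple * quadruple)%type.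

Definition datum_at (D : datum) (z0 z1 : C) : quadruple :=
  z0 *: D.1 + z1 *: D.2.

(* Regularity is invariant under rescaling (z0, z1), hence a condition on
   [z0 : z1] in CP^1. *)
Definition globally_regular (D : datum) : Prop :=
  forall z0 z1 : C, (z0, z1) <> (0, 0) -> regular_quadruple (datum_at D z0 z1).

Definition adhm_solutions : set datum :=
  [set D | (forall z0 z1, adhm_map (datum_at D z0 z1) = 0) /\
           globally_regular D].

Definition solution_space : topologicalType := set_type adhm_solutions.

Definition same_orbit (D D' : solution_space) : bool :=
  `[< exists2 g : 'M[C]_c, g \in unitmx &
      set_val D' = (act g (set_val D).1, act g (set_val D).2) >].

Lemma act1 q : act 1%:M q = q.
Proof. by case: q => [[[A B] i] j] /=; rewrite invmx1 !mul1mx !mulmx1. Qed.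

Lemma actM g h q : g \in unitmx -> h \in unitmx ->
  act g (act h q) = act (g *m h) q.
Proof.
case: q => [[[A B] i] j] /= gU hU.
have -> : invmx (g *m h) = invmx h *m invmx g.
  have ghU : g *m h \in unitmx by rewrite unitmx_mul gU.
  apply: (can_inj (mulKmx ghU)); rewrite mulmxV //.
  by rewrite -!mulmxA (mulmxA h) mulmxV // mul1mx mulmxV.
by rewrite !mulmxA.
Qed.

Lemma same_orbit_refl : reflexive same_orbit.
Proof.
move=> D; apply/asboolP; exists 1%:M; first exact: unitmx1.
by rewrite !act1 -surjective_pairing.
Qed.

Lemma same_orbit_imp D D' : same_orbit D D' -> same_orbit D' D.
Proof.
move=> /asboolP[g gU e]; apply/asboolP; exists (invmx g).
  by rewrite unitmx_inv.
by rewrite e /= !actM ?unitmx_inv // mulVmx // !act1 -surjective_pairing.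
Qed.

Lemma same_orbit_sym : symmetric same_orbit.
Proof. by move=> D D'; apply/idP/idP; exact: same_orbit_imp. Qed.

Lemma same_orbit_trans : transitive same_orbit.
Proof.
move=> D2 D1 D3 /asboolP[g gU e] /asboolP[h hU e'].
apply/asboolP; exists (h *m g); first by rewrite unitmx_mul hU.
by rewrite e' e /= !actM.
Qed.

Canonical same_orbit_equiv :=
  EquivRel same_orbit same_orbit_refl same_orbit_sym same_orbit_trans.

Definition orbit_space : quotType solution_space :=
  {eq_quot same_orbit_equiv}%qT.

(* The moduli space, with the quotient topology and the quotient sheaf. *)
Definition M1 : topologicalType := quotient_topology orbit_space.

Definition M1_sheaf : function_sheaf R M1 :=
  @quotient_sheaf R solution_space orbit_space
    (restricted_sheaf (X := adhm_solutions)).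

End ADHM.

(* Main.v *)
From HB Require Import structures.
Require Import Defs.
From mathcomp Require Import all_boot all_order all_algebra.
From mathcomp Require Import complex.
From mathcomp Require Import all_classical all_reals all_analysis.
From mathcomp Require Import ring lra.

(** Sending a globally regular solution of the ADHM equations to its moments
    [J_k W I_l], where [W] runs over the words of bounded length in the matrices
    [A_0, A_1, B_0, B_1], gives functions on the moduli space, because they are
    invariant under conjugation.  They are continuous, holomorphic, and separate
    points: by regularity, some words give an invertible block [L] of rows
    [j W] and an invertible block [K] of columns [W i] (lemma [regularP]), the
    Hankel matrices [L K], [L A_k K], [L B_k K], [L I_k], [J_k K] consist of
    moments, and they determine the solution in the basis [K] by
    [(L K)^-1 (L A_k K) = K^-1 A_k K] (lemma [realization_moment]).  The moduli
    space thus embeds in an affine space, and a compact subvariety should be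
    finite, as holomorphic functions are constant on compact connected varieties.

    To avoid the structure theory of complex spaces, the argument is carried out
    for the image in affine space.  The formula above is a rational map [sect]
    from moments to data.  Near the image of a point of [Z], a point [h]
    lies in the image of [Z] exactly if [sect h] solves the ADHM equations, its
    moments are [h], and its orbit satisfies the local equations of [Z]; global
    regularity of [sect h] is an open condition by compactness of the projective
    line ([globally_regular_near]).  Hence the image is locally the common zero
    set of holomorphic functions ([moment_image_analytic]), and the theorem
    follows from the statement that compact subsets of affine space with this
    property are finite ([compact_analytic_finite]): a regular point of positive
    dimension would make [Z] infinite.

    Finiteness is proved by induction on the dimension.  In the plane, the
    accumulation points of such a set form an open set by the identity
    principle, and a compact one, so it is empty: a point of maximal real part
    would not be interior ([compact_analytic_plane]).  In general, the fibres of a linear projection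
    are finite by the case of the plane, and the image of the projection is again
    locally analytic ([projection_loc_analytic]).  For this, let [f] vanish on
    the set but not identically on the fibre over [y0].  For [y] near [y0] the
    number [n] of zeros of [f (y, _)] in a small disc is constant
    ([weierstrass_factorization]), and the means over its boundary of
    [h (y, s) / f (y, s) * s ^ (i + j + 1)] for [i, j < n] form a matrix that is
    singular exactly if [h (y, _)] and [f (y, _)] have a common zero in the disc
    ([hankel_common_zero]).  Its determinant is holomorphic in [y] and serves as
    a resultant.

    Complex derivatives are not assumed to be continuous, so the underlying
    function theory of one variable starts from the lemma of Goursat for
    rectangles ([goursat]), applied in logarithmic coordinates to compare
    circles of different radii ([circ_annulus]).  Integrals are only taken over
    circles; on the unit circle conjugation is inversion, which replaces the
    computation of residues ([circ_conj_mean]). *)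

Set Implicit Arguments.
Unset Strict Implicit.
Unset Printing Implicit Defensive.
Import Order.TTheory GRing.Theory Num.Theory.
Import numFieldNormedType.Exports.
Local Open Scope classical_set_scope.
Local Open Scope ring_scope.
Local Open Scope complex_scope.
Local Notation Re := complex.Re.
Local Notation Im := complex.Im.

(** * The modulus of a complex number and integrals over segments *)

Section ComplexModulus.
Variable R : realType.
Local Notation C := (R[i]).

(** The norm of [C] takes its values in [C] itself; as an element of the totally
    ordered field [R], the modulus is accessible to linear arithmetic. *)
Definition nm (z : C) : R := Re `|z|.

Lemma nmE (z : C) : `|z| = (nm z)%:C.
Proof. by rewrite /nm normc_def. Qed.

Lemma nm_ge0 z : 0 <= nm z.
Proof. by rewrite -lecR -nmE normr_ge0. Qed.

Lemma nmM z w : nm (z * w) = nm z * nm w.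
Proof. by apply: (@complexI R); rewrite rmorphM -!nmE normrM. Qed.

Lemma nmX z n : nm (z ^+ n) = nm z ^+ n.
Proof. by apply: (@complexI R); rewrite rmorphXn -!nmE normrX. Qed.

Lemma nmV z : nm z^-1 = (nm z)^-1.
Proof. by apply: (@complexI R); rewrite fmorphV -!nmE normfV. Qed.

Lemma nmD z w : nm (z + w) <= nm z + nm w.
Proof. by rewrite -lecR rmorphD -!nmE ler_normD. Qed.

Lemma nmB z w : nm (z - w) <= nm z + nm w.
Proof. by rewrite -lecR rmorphD -!nmE ler_normB. Qed.

Lemma nmN z : nm (- z) = nm z.
Proof. by rewrite /nm normrN. Qed.

Lemma nm_sub z w : nm (z - w) = nm (w - z).
Proof. by rewrite -nmN opprB. Qed.

Lemma nm_lerB z w : nm z - nm w <= nm (z - w).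
Proof. by rewrite lerBlDr (le_trans _ (nmD _ _)) // subrK. Qed.

Lemma nm0 : nm 0 = 0.
Proof. by rewrite /nm normr0. Qed.

Lemma nm1 : nm 1 = 1.
Proof. by rewrite /nm normr1. Qed.

Lemma nm_eq0 z : (nm z == 0) = (z == 0).
Proof. by rewrite -[RHS]normr_eq0 nmE -(inj_eq (@complexI R)). Qed.

Lemma nm_gt0 z : (0 < nm z) = (z != 0).
Proof. by rewrite lt_def nm_eq0 nm_ge0 andbT. Qed.

Lemma nm_real (x : R) : nm x%:C = `|x|.
Proof. by rewrite /nm normc_def /= expr0n addr0 sqrtr_sqr. Qed.

Lemma nm_i : nm 'i = 1.
Proof. by rewrite /nm normc_def /= expr0n add0r expr1n sqrtr1. Qed.

Lemma nm_conj z : nm z^* = nm z.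
Proof. by rewrite /nm normcJ. Qed.

Lemma nm_Re z : `|Re z| <= nm z.
Proof. by rewrite -lecR -nmE normc_ge_Re. Qed.

Lemma nm_Im z : `|Im z| <= nm z.
Proof.
rewrite -[Im z]opprK -ReiNIm normrN (le_trans (nm_Re _)) //.
by rewrite nmM nm_i mulr1.
Qed.

Lemma nm_le_ReIm z : nm z <= `|Re z| + `|Im z|.
Proof.
rewrite [X in nm X](complexE z) (le_trans (nmD _ _)) //.
by rewrite nmM nm_i mul1r !nm_real.
Qed.

Section Limits.
Variables (T : Type) (F : set_system T) (FF : Filter F).

Lemma cvgC_ltP (f : T -> C) (l : C) :
  f @ F --> l <-> forall e : R, 0 < e -> \forall x \near F, nm (l - f x) < e.
Proof.
split=> [/cvgrPdist_lt h e e0|h].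
  have := h e%:C; rewrite ltcR => /(_ e0); apply: filterS => x.
  by rewrite nmE ltcR.
apply/cvgrPdist_lt => e; rewrite ltcE /= => /andP[/eqP ie re].
have -> : e = (Re e)%:C by apply/eqP; rewrite eq_complex /= ie !eqxx.
by apply: filterS (h _ re) => x; rewrite nmE ltcR.
Qed.

Lemma cvg_ReC (f : T -> C) (l : C) : f @ F --> l -> (fun x => Re (f x)) @ F --> Re l.
Proof.
move=> /cvgC_ltP h; apply/cvgrPdist_lt => e /h; apply: filterS => x /=.
by apply: le_lt_trans; rewrite (le_trans _ (nm_Re _)) // raddfB.
Qed.

Lemma cvg_ImC (f : T -> C) (l : C) : f @ F --> l -> (fun x => Im (f x)) @ F --> Im l.
Proof.
move=> /cvgC_ltP h; apply/cvgrPdist_lt => e /h; apply: filterS => x /=.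
by apply: le_lt_trans; rewrite (le_trans _ (nm_Im _)) // raddfB.
Qed.

Lemma cvg_realC (f : T -> R) (l : R) :
  f @ F --> l -> (fun x => (f x)%:C) @ F --> l%:C.
Proof.
move=> /cvgrPdist_lt h; apply/cvgC_ltP => e /h; apply: filterS => x /=.
by rewrite -rmorphB nm_real.
Qed.

Lemma cvg_nm (f : T -> C) (l : C) : f @ F --> l -> (nm \o f) @ F --> nm l.
Proof.
move=> /cvgC_ltP h; apply/cvgrPdist_lt => e /h; apply: filterS => x /=.
apply: le_lt_trans; rewrite ler_norml nm_lerB andbT lerNl opprB.
by rewrite nm_sub nm_lerB.
Qed.

End Limits.

Lemma nbhsC_P (z : C) (A : set C) :
  nbhs z A <-> exists2 e : R, 0 < e & forall w, nm (w - z) < e -> A w.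
Proof.
split=> [/nbhs_ballP[e /= e0 h]|[e e0 h]].
  move: e0; rewrite ltcE /= => /andP[/eqP ie re].
  exists (Re e) => // w hw; apply: h; rewrite /ball /=.
  have -> : e = (Re e)%:C by apply/eqP; rewrite eq_complex /= ie !eqxx.
  by rewrite nmE ltcR nm_sub.
apply/nbhs_ballP; exists e%:C => /=; first by rewrite ltcR.
by move=> w; rewrite /ball /= nmE ltcR nm_sub => /h.
Qed.

Lemma derivableC_P (f : C -> C) (z : C) : derivable f z 1 <->
  exists d : C, forall e : R, 0 < e -> exists2 r : R, 0 < r &
    forall h, nm h < r -> nm (f (z + h) - f z - d * h) <= e * nm h.
Proof.
split=> [/cvg_ex[d] |[d hd]].
  move=> /cvgC_ltP hd; exists d => e /hd.
  move=> /nbhsC_P[r r0 h]; exists r => // k kr.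
  have [->|k0] := eqVneq k 0.
    by rewrite addr0 subrr mulr0 subr0 nm0 mulr0.
  have := h k; rewrite subr0 => /(_ kr k0) /ltW.
  rewrite /= [k *: 1]mulr1 [k + z]addrC => hk.
  have -> : f (z + k) - f z - d * k = - (d - k^-1 *: (f (z + k) - f z)) * k.
    rewrite opprB mulrBl [_ *: _]mulrC.
    by rewrite mulfVK.
  by rewrite nmM nmN ler_wpM2r ?nm_ge0.
apply/cvg_ex; exists d; apply/cvgC_ltP => e e0.
have [r r0 h] := hd _ (divr_gt0 e0 (ltr0Sn _ 1)).
apply/nbhsC_P; exists r => // k; rewrite subr0 => kr k0.
rewrite /= [k *: 1]mulr1 [k + z]addrC.
have -> : d - k^-1 *: (f (z + k) - f z) = - (f (z + k) - f z - d * k) / k.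
  rewrite opprB mulrBl mulfK //; congr (_ - _).
  by rewrite [LHS]mulrC.
rewrite nmM nmN nmV ltr_pdivrMr ?nm_gt0 //.
apply: le_lt_trans (h _ kr) _.
by rewrite ltr_pM2r ?nm_gt0 //; lra.
Qed.

Lemma derivable_continuousC (f : C -> C) (z : C) :
  derivable f z 1 -> {for z, continuous f}.
Proof. by move=> /derivable1_diffP/differentiable_continuous. Qed.

Section ContinuousAt.
Variables (T : topologicalType) (x : T).
Implicit Types f g : T -> C.

Lemma cont_cst (k : C) : {for x, continuous (fun=> k : C)}.
Proof. exact: cst_continuous. Qed.

Lemma contD f g : {for x, continuous f} -> {for x, continuous g} ->
  {for x, continuous (fun y => f y + g y)}.
Proof. exact: continuousD. Qed.

Lemma contB f g : {for x, continuous f} -> {for x, continuous g} ->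
  {for x, continuous (fun y => f y - g y)}.
Proof. exact: continuousB. Qed.

Lemma contM f g : {for x, continuous f} -> {for x, continuous g} ->
  {for x, continuous (fun y => f y * g y)}.
Proof. exact: continuousM. Qed.

Lemma contV f : f x != 0 -> {for x, continuous f} ->
  {for x, continuous (fun y => (f y)^-1)}.
Proof. by move=> fx fc; exact: cvgV. Qed.

Lemma contX f n : {for x, continuous f} ->
  {for x, continuous (fun y => f y ^+ n)}.
Proof.
move=> fc; elim: n => [|[|n] IHn]; first exact: cont_cst.
  exact: fc.
exact: contM fc IHn.
Qed.

End ContinuousAt.

Lemma plane_split (x y : R) : x +i* y = x%:C + 'i * y%:C.
Proof. by simpc. Qed.

Lemma cont_plane (T : topologicalType) (f g : T -> R) (x : T) :
  {for x, continuous f} -> {for x, continuous g} ->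
  {for x, continuous (fun y => f y +i* g y : C)}.
Proof.
move=> fc gc; apply/cvgC_ltP => e e0.
have e2 : 0 < e / 2 by rewrite divr_gt0.
have /cvgrPdist_lt /(_ _ e2) h1 := fc; have /cvgrPdist_lt /(_ _ e2) h2 := gc.
near=> y; apply: le_lt_trans (nm_le_ReIm _) _ => /=.
have h3 : `|f x - f y| < e / 2 by near: y.
have h4 : `|g x - g y| < e / 2 by near: y.
by simpc; rewrite (lt_le_trans (ltrD h3 h4)) // -splitr.
Unshelve. all: by end_near. Qed.

Lemma cont_id (z : C) : {for z, continuous (fun w : C => w)}.
Proof. exact: cvg_id. Qed.

End ComplexModulus.

Arguments cont_cst {R T x} k.
Arguments cont_id {R z}.

Section SegmentIntegral.
Variable R : realType.
Local Notation C := (R[i]).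
Local Notation mu := (@lebesgue_measure R).

Definition continuous_at_itv (a b : R) (g : R -> C) :=
  forall x, a <= x <= b -> {for x, continuous g}.

(** Componentwise, since the Lebesgue integral is that of real functions. *)
Definition cint (a b : R) (g : R -> C) : C :=
  (\int[mu]_(x in `[a, b]) Re (g x)) +i* (\int[mu]_(x in `[a, b]) Im (g x)).

Lemma integrable_Re a b g : continuous_at_itv a b g ->
  mu.-integrable `[a, b] (EFin \o (fun x => Re (g x))).
Proof.
move=> gc; apply: continuous_compact_integrable.
  exact: segment_compact.
apply: continuous_in_subspaceT => x; rewrite inE /= in_itv /= => xab.
by apply: cvg_ReC; apply: gc.
Qed.

Lemma integrable_Im a b g : continuous_at_itv a b g ->
  mu.-integrable `[a, b] (EFin \o (fun x => Im (g x))).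
Proof.
move=> gc; apply: continuous_compact_integrable.
  exact: segment_compact.
apply: continuous_in_subspaceT => x; rewrite inE /= in_itv /= => xab.
by apply: cvg_ImC; apply: gc.
Qed.

Lemma eq_cint a b f g : (forall x, a <= x <= b -> f x = g x) ->
  cint a b f = cint a b g.
Proof.
move=> fg; congr (_ +i* _); apply: eq_Rintegral => x; rewrite inE /= in_itv /=;
  by move=> /fg ->.
Qed.

Lemma cintD a b f g : continuous_at_itv a b f -> continuous_at_itv a b g ->
  cint a b (fun x => f x + g x) = cint a b f + cint a b g.
Proof.
move=> fc gc; apply/eqP; rewrite eq_complex /=; apply/andP; split; apply/eqP.
  rewrite -RintegralD //; [|exact: integrable_Re|exact: integrable_Re].
  by apply: eq_Rintegral => x _; rewrite raddfD.
rewrite -RintegralD //; [|exact: integrable_Im|exact: integrable_Im].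
by apply: eq_Rintegral => x _; rewrite raddfD.
Qed.

Lemma cintZ a b c f : continuous_at_itv a b f ->
  cint a b (fun x => c * f x) = c * cint a b f.
Proof.
move=> fc; have ir := integrable_Re fc; have ii := integrable_Im fc.
have irZ k : mu.-integrable `[a, b] (EFin \o (fun x => k * Re (f x))).
  by apply: eq_integrable (integrableZl _ k ir).
have iiZ k : mu.-integrable `[a, b] (EFin \o (fun x => k * Im (f x))).
  by apply: eq_integrable (integrableZl _ k ii).
case: c => u v; apply/eqP; rewrite eq_complex /=; apply/andP; split; apply/eqP.
  rewrite -!RintegralZl // -RintegralB //.
  by apply: eq_Rintegral => x _; case: (f x).
rewrite -!RintegralZl // -RintegralD //.
by apply: eq_Rintegral => x _; case: (f x).
Qed.

Lemma cint_cst a b c : a <= b -> cint a b (fun=> c) = c * (b - a)%:C.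
Proof.
move=> ab; rewrite /cint !Rintegral_cst //= lebesgue_measure_itv /= lte_fin.
have -> : fine (if a < b then (b%:E - a%:E)%E else 0%E) = b - a.
  by case: ltP => // ba; rewrite (le_anti (introT andP (conj ab ba))) /= subrr.
by case: c => u v; simpc.
Qed.

Lemma cint_split a b m f : a <= m <= b -> continuous_at_itv a b f ->
  cint a b f = cint a m f + cint m b f.
Proof.
move=> /andP[am mb] fc.
have key (h : R -> R) : mu.-integrable `[a, b] (EFin \o h) ->
  \int[mu]_(x in `[a, b]) h x =
  \int[mu]_(x in `[a, m]) h x + \int[mu]_(x in `[m, b]) h x.
  move=> hi.
  have sub (A : set R) : measurable A -> A `<=` `[a, b]%classic ->
      mu.-integrable A (EFin \o h).
    by move=> mA sA; apply: integrableS hi.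
  have := @Rintegral_itvB R h (BLeft a) (BRight b) m hi.
  rewrite !bnd_simp => /(_ am mb) /eqP; rewrite subr_eq => /eqP ->.
  rewrite addrC; congr (_ + _); apply: Rintegral_itv_obnd_cbnd.
  apply: sub => // x; rewrite /= !in_itv /= => /andP[/ltW mx ->].
  by rewrite (le_trans am).
apply/eqP; rewrite eq_complex /=; apply/andP; split; apply/eqP.
  by apply: key; apply: integrable_Re.
by apply: key; apply: integrable_Im.
Qed.

(** The factor 2 comes from bounding the real and imaginary parts separately. *)
Lemma cint_le a b f (M : R) : a <= b -> continuous_at_itv a b f ->
  (forall x, a <= x <= b -> nm (f x) <= M) ->
  nm (cint a b f) <= 2 * (M * (b - a)).
Proof.
move=> ab fc fM.
have key (h : R -> R) : mu.-integrable `[a, b] (EFin \o h) ->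
    (forall x, a <= x <= b -> `|h x| <= M) ->
    `|\int[mu]_(x in `[a, b]) h x| <= M * (b - a).
  move=> hi hM; apply: le_trans (le_normr_Rintegral _ hi) _ => //.
  have <- : \int[mu]_(x in `[a, b]) (fun=> M) x = M * (b - a).
    by have := cint_cst M%:C ab; simpc => -[].
  apply: le_Rintegral.
  - by [].
  - by apply: eq_integrable (integrable_norm hi).
  - by apply: (@integrable_Re _ _ (fun=> M%:C)) => x _; apply: cst_continuous.
  - by move=> x /=; rewrite in_itv /= => /hM.
apply: le_trans (nm_le_ReIm _) _; rewrite /= mulr_natl mulr2n lerD //.
  apply: key (integrable_Re fc) _ => x /fM; apply: le_trans.
  exact: nm_Re.
apply: key (integrable_Im fc) _ => x /fM; apply: le_trans.
exact: nm_Im.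
Qed.

End SegmentIntegral.

(** * Integrals over the boundary of a rectangle *)

Section Goursat.
Variable R : realType.
Local Notation C := (R[i]).
Implicit Types f g : C -> C.

Definition continuous_at_rect (a b c d : R) f :=
  forall x y, a <= x <= b -> c <= y <= d -> {for x +i* y, continuous f}.

Lemma continuous_hline (y : R) : continuous (fun x : R => x +i* y : C).
Proof. by move=> x; apply: cont_plane; [exact: cvg_id|exact: cvg_cst]. Qed.

Lemma continuous_vline (x : R) : continuous (fun y : R => x +i* y : C).
Proof. by move=> y; apply: cont_plane; [exact: cvg_cst|exact: cvg_id]. Qed.

Lemma continuous_at_hside a b c d f y : continuous_at_rect a b c d f ->
  c <= y <= d -> continuous_at_itv a b (fun x => f (x +i* y)).
Proof.
move=> fc ycd x xab; apply: (@continuous_comp _ _ _ (fun x : R => x +i* y) f).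
  exact: continuous_hline.
exact: fc.
Qed.

Lemma continuous_at_vside a b c d f x : continuous_at_rect a b c d f ->
  a <= x <= b -> continuous_at_itv c d (fun y => f (x +i* y)).
Proof.
move=> fc xab y ycd; apply: (@continuous_comp _ _ _ (fun y : R => x +i* y) f).
  exact: continuous_vline.
exact: fc.
Qed.

Definition rect_integral (a b c d : R) f : C :=
  cint a b (fun x => f (x +i* c)) + 'i * cint c d (fun y => f (b +i* y))
  - cint a b (fun x => f (x +i* d)) - 'i * cint c d (fun y => f (a +i* y)).

Lemma rect_integral_quarters a b c d m n f : a <= m <= b -> c <= n <= d ->
  continuous_at_rect a b c d f ->
  rect_integral a b c d f =
  rect_integral a m c n f + rect_integral m b c n f +
  (rect_integral a m n d f + rect_integral m b n d f).
Proof.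
move=> /andP[am mb] /andP[cn nd] fc.
have ab := le_trans am mb; have cd := le_trans cn nd.
rewrite /rect_integral.
rewrite (@cint_split _ a b m (fun x => f (x +i* c))) ?am //; last first.
  by apply: continuous_at_hside fc _; rewrite lexx.
rewrite (@cint_split _ a b m (fun x => f (x +i* d))) ?am //; last first.
  by apply: continuous_at_hside fc _; rewrite lexx andbT.
rewrite (@cint_split _ c d n (fun y => f (a +i* y))) ?cn //; last first.
  by apply: continuous_at_vside fc _; rewrite lexx.
rewrite (@cint_split _ c d n (fun y => f (b +i* y))) ?cn //; last first.
  by apply: continuous_at_vside fc _; rewrite lexx andbT.
ring.
Qed.

Lemma rect_integral_le a b c d f (M : R) : a <= b -> c <= d ->
  continuous_at_rect a b c d f ->
  (forall x y, a <= x <= b -> c <= y <= d -> nm (f (x +i* y)) <= M) ->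
  nm (rect_integral a b c d f) <= 4 * (M * ((b - a) + (d - c))).
Proof.
move=> ab cd fc fM.
have hside y : c <= y <= d ->
    nm (cint a b (fun x => f (x +i* y))) <= 2 * (M * (b - a)).
  move=> ycd; apply: cint_le => // [|x xab]; last exact: fM.
  exact: continuous_at_hside fc _.
have vside x : a <= x <= b ->
    nm (cint c d (fun y => f (x +i* y))) <= 2 * (M * (d - c)).
  move=> xab; apply: cint_le => // [|y ycd]; last exact: fM.
  exact: continuous_at_vside fc _.
have h1 := hside c; have h2 := hside d; have h3 := vside a; have h4 := vside b.
move: h1 h2 h3 h4; rewrite !lexx ab cd.
move=> /(_ isT) h1 /(_ isT) h2 /(_ isT) h3 /(_ isT) h4.
apply: le_trans (nmB _ _) _; rewrite nmM nm_i mul1r.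
apply: le_trans (lerD (nmB _ _) (lexx _)) _.
apply: le_trans (lerD (lerD (nmD _ _) (lexx _)) (lexx _)) _.
rewrite nmM nm_i mul1r.
apply: le_trans (lerD (lerD (lerD h1 h4) h2) h3) _; lra.
Qed.

(** The boundary integral of an affine function is 0, so only the error term of a
    first-order expansion counts. *)
Lemma rect_integral_sub_affine a b c d f (al be p : C) : a <= b -> c <= d ->
  continuous_at_rect a b c d f ->
  rect_integral a b c d (fun z => f z - al - be * (z - p)) =
  rect_integral a b c d f.
Proof.
move=> ab cd fc.
have hside y : c <= y <= d ->
    cint a b (fun x => f (x +i* y) - al - be * (x +i* y - p)) =
    cint a b (fun x => f (x +i* y)) + (cint a b (fun x => - be * x%:C)
     + (be * (p - 'i * y%:C) - al) * (b - a)%:C).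
  move=> ycd; rewrite -(@cint_cst _ a b _ ab).
  have cl : continuous_at_itv a b (fun x => - be * x%:C).
    move=> x _; apply: cvgM; first exact: cvg_cst.
    by apply: cvg_realC; exact: cvg_id.
  have cc k : continuous_at_itv a b (fun=> k) by move=> x _; exact: cst_continuous.
  rewrite -(cintD cl (cc _)) -cintD.
  - by apply: eq_cint => x _; rewrite plane_split; ring.
  - exact: continuous_at_hside fc _.
  - by move=> x xab; apply: cvgD; [exact: cl|exact: cst_continuous].
have vside x : a <= x <= b ->
    cint c d (fun y => f (x +i* y) - al - be * (x +i* y - p)) =
    cint c d (fun y => f (x +i* y)) + (cint c d (fun y => - be * 'i * y%:C)
     + (be * (p - x%:C) - al) * (d - c)%:C).
  move=> xab; rewrite -(@cint_cst _ c d _ cd).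
  have cl : continuous_at_itv c d (fun y => - be * 'i * y%:C).
    move=> y _; apply: cvgM; first exact: cvg_cst.
    by apply: cvg_realC; exact: cvg_id.
  have cc k : continuous_at_itv c d (fun=> k) by move=> y _; exact: cst_continuous.
  rewrite -(cintD cl (cc _)) -cintD.
  - by apply: eq_cint => y _; rewrite plane_split; ring.
  - exact: continuous_at_vside fc _.
  - by move=> y ycd; apply: cvgD; [exact: cl|exact: cst_continuous].
rewrite /rect_integral hside ?lexx // hside ?lexx ?andbT //.
rewrite vside ?lexx ?andbT // vside ?lexx //.
rewrite !rmorphB; ring.
Qed.

Lemma nested_intervals_point (u l : nat -> R) :
  (forall n, u n <= u n.+1) -> (forall n, u n.+1 + l n.+1 <= u n + l n) ->
  (forall n, 0 <= l n) ->
  exists p, forall n, u n <= p <= u n + l n.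
Proof.
move=> u_incr ul_decr l_ge0.
have uh : {homo u : m n / (m <= n)%N >-> m <= n}.
  exact: (homo_leq (@lexx _ _) (@le_trans _ _)).
have ulh : {homo (fun n => - (u n + l n)) : m n / (m <= n)%N >-> m <= n}.
  by apply: (homo_leq (@lexx _ _) (@le_trans _ _)) => n; rewrite lerN2.
have ub m n : u m <= u n + l n.
  case: (leqP m n) => [mn|/ltnW nm].
    by rewrite (le_trans (uh _ _ mn)) // lerDl.
  by have := ulh _ _ nm; rewrite lerN2; apply: le_trans; rewrite lerDl.
have hs : has_sup (range u).
  by split; [exists (u 0); exists 0|exists (u 0 + l 0) => _ [n _ <-]].
exists (sup (range u)) => n; apply/andP; split.
  by apply: sup_upper_bound => //; exists n.
by apply: sup_le_ub => [|_ [m _ <-]]; [exists (u 0); exists 0|].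
Qed.

Lemma rect_integral_big_quarter x y l h f (m : R) : 0 <= l -> 0 <= h ->
  continuous_at_rect x (x + (l + l)) y (y + (h + h)) f ->
  4 * m <= nm (rect_integral x (x + (l + l)) y (y + (h + h)) f) ->
  exists x' y', [/\ x' = x \/ x' = x + l, y' = y \/ y' = y + h &
    m <= nm (rect_integral x' (x' + l) y' (y' + h) f)].
Proof.
move=> l0 h0 fc.
rewrite (@rect_integral_quarters _ _ _ _ (x + l) (y + h)) //; last first.
- by apply/andP; split; lra.
- by apply/andP; split; lra.
set I1 := rect_integral x (x + l) y _ f.
set I2 := rect_integral _ _ y _ f.
set I3 := rect_integral x (x + l) _ _ f.
set I4 := rect_integral _ _ _ _ f => bigI.
have n4 : nm (I1 + I2 + (I3 + I4)) <= nm I1 + nm I2 + (nm I3 + nm I4).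
  by apply: le_trans (nmD _ _) (lerD _ _); exact: nmD.
case: (lerP m (nm I1)) => [k1|k1]; first by exists x, y; split; [left|left|].
case: (lerP m (nm I2)) => [k2|k2].
  by exists (x + l), y; split; [right|left|rewrite -addrA].
case: (lerP m (nm I3)) => [k3|k3].
  by exists x, (y + h); split; [left|right|rewrite -addrA].
case: (lerP m (nm I4)) => [k4|k4].
  by exists (x + l), (y + h); split; [right|right|rewrite -!addrA].
exfalso; move: {I1 I2 I3 I4} (nm I1) (nm I2) (nm I3) (nm I4) (nm _)
  bigI n4 k1 k2 k3 k4 => *; lra.
Qed.

(** Bisection: if the boundary integral were nonzero, some sequence of nested
    quarters would keep a fixed proportion of integral to area, and this
    contradicts the first-order expansion of [f] at their common point. *)
Lemma goursat a b c d f : a <= b -> c <= d ->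
  (forall x y, a <= x <= b -> c <= y <= d -> derivable f (x +i* y) 1) ->
  rect_integral a b c d f = 0.
Proof.
move=> ab cd fd; apply/eqP; rewrite -nm_eq0; apply/eqP.
set M := nm _.
have fc : continuous_at_rect a b c d f.
  by move=> x y xab ycd; apply/derivable_continuousC/fd.
pose l n : R := (b - a) / 2 ^+ n; pose h n : R := (d - c) / 2 ^+ n.
have l_ge0 n : 0 <= l n by rewrite divr_ge0 ?exprn_ge0 ?subr_ge0.
have h_ge0 n : 0 <= h n by rewrite divr_ge0 ?exprn_ge0 ?subr_ge0.
have lS n : l n = l n.+1 + l n.+1.
  by rewrite /l exprS; field; rewrite expf_neq0 // pnatr_eq0.
have hS n : h n = h n.+1 + h n.+1.
  by rewrite /h exprS; field; rewrite expf_neq0 // pnatr_eq0.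
have MS n : M / 4 ^+ n = 4 * (M / 4 ^+ n.+1).
  by rewrite exprS; field; rewrite expf_neq0 // pnatr_eq0.
pose big n (p : R * R) := [/\ (a <= p.1 /\ p.1 + l n <= b),
  (c <= p.2 /\ p.2 + h n <= d) &
  M / 4 ^+ n <= nm (rect_integral p.1 (p.1 + l n) p.2 (p.2 + h n) f)].
have step (np : nat * (R * R)) : exists q : R * R, big np.1 np.2 ->
    [/\ big np.1.+1 q,
     (np.2.1 <= q.1 /\ q.1 + l np.1.+1 <= np.2.1 + l np.1) &
     (np.2.2 <= q.2 /\ q.2 + h np.1.+1 <= np.2.2 + h np.1)].
  case: np => n [x y] /=.
  have [[/= [ax xb] [cy yd]]|] := pselect (big n (x, y)); last first.
    by exists (x, y).
  rewrite MS lS hS => bigM; rewrite lS in xb; rewrite hS in yd.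
  have [] := rect_integral_big_quarter (l_ge0 n.+1) (h_ge0 n.+1) _ bigM.
    move=> x' y' /andP[x1 x2] /andP[y1 y2].
    by apply: fc; rewrite ?(le_trans ax) ?(le_trans cy) ?(le_trans x2)
      ?(le_trans y2).
  move=> x' [y' [xx' yy' bigM']]; exists (x', y') => _ /=.
  have [hx1 hx2] : x <= x' /\ x' + l n.+1 <= x + (l n.+1 + l n.+1).
    by have := l_ge0 n.+1; case: xx' => -> ?; split; lra.
  have [hy1 hy2] : y <= y' /\ y' + h n.+1 <= y + (h n.+1 + h n.+1).
    by have := h_ge0 n.+1; case: yy' => -> ?; split; lra.
  split=> //; split=> //=.
    by rewrite (le_trans ax) // (le_trans hx2).
  by rewrite (le_trans cy) // (le_trans hy2).
have [s hs] := choice step.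
pose u := fix u n := if n is k.+1 then s (k, u k) else (a, c).
have big_u n : big n (u n).
  elim: n => [|n IHn]; last by have [] := hs (n, u n) IHn.
  by split; rewrite /= /l /h ?expr0 ?divr1 ?subrKC.
have [x hx] : exists x, forall n, (u n).1 <= x <= (u n).1 + l n.
  by apply: nested_intervals_point => // n;
    have [_ []] := hs (n, u n) (big_u n).
have [y hy] : exists y, forall n, (u n).2 <= y <= (u n).2 + h n.
  by apply: nested_intervals_point => // n;
    have [_ _ []] := hs (n, u n) (big_u n).
have xab : a <= x <= b.
  have [[/= h1 h2] _ _] := big_u 0; have /andP[h3 h4] := hx 0.
  by rewrite h3 (le_trans h4).
have ycd : c <= y <= d.
  have [_ [/= h1 h2] _] := big_u 0; have /andP[h3 h4] := hy 0.
  by rewrite h3 (le_trans h4).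
have [D hD] := (derivableC_P _ _).1 (fd _ _ xab ycd).
set K : R := (b - a) + (d - c).
have K0 : 0 <= K by rewrite addr_ge0 // subr_ge0.
have MK e : 0 < e -> M <= 4 * e * K ^+ 2.
  move=> e0; have [r r0 hr] := hD _ e0.
  have [n hn] : exists n, K / 2 ^+ n < r.
    have : (fun n => K * (2^-1) ^+ n) @ \oo --> (0 : R).
      by apply: cvg_geometric; rewrite ger0_norm // invf_lt1 // ltr1n.
    move=> /cvgrPdist_lt /(_ r r0)[n _ /(_ n (leqnn n))] h1; exists n.
    by move: h1; rewrite sub0r normrN exprVn; apply: le_lt_trans; exact: ler_norm.
  have [[ax xb] [cy yd] bigM] := big_u n.
  have /andP[x1 x2] := hx n; have /andP[y1 y2] := hy n.
  move: (u n) ax xb cy yd bigM x1 x2 y1 y2 => [x0 y0] /=.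
  move=> ax xb cy yd bigM x1 x2 y1 y2.
  have lhK : l n + h n = K / 2 ^+ n by rewrite -mulrDl.
  have l0 := l_ge0 n; have h0 := h_ge0 n.
  have fcn : continuous_at_rect x0 (x0 + l n) y0 (y0 + h n) f.
    move=> x' y' /andP[z1 z2] /andP[z3 z4].
    by apply: fc; rewrite ?(le_trans ax) ?(le_trans cy) ?(le_trans z2)
      ?(le_trans z4).
  move: bigM; rewrite -(@rect_integral_sub_affine _ _ _ _ f (f (x +i* y)) D
    (x +i* y)) ?lerDl // => bigM.
  have : nm (rect_integral x0 (x0 + l n) y0 (y0 + h n)
      (fun z => f z - f (x +i* y) - D * (z - x +i* y))) <=
      4 * ((e * (l n + h n)) * ((x0 + l n - x0) + (y0 + h n - y0))).
    apply: rect_integral_le; [by rewrite lerDl|by rewrite lerDl| |].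
      move=> x' y' z1 z2; apply: contB.
        exact: contB (fcn _ _ z1 z2) (cont_cst (f (x +i* y))).
      exact: contM (cont_cst D) (contB cont_id (cont_cst (x +i* y))).
    move=> x' y' /andP[z1 z2] /andP[z3 z4].
    have dz : nm (x' +i* y' - x +i* y) <= l n + h n.
      apply: le_trans (nm_le_ReIm _) _; simpc => /=; apply: lerD.
        by rewrite ler_distl; apply/andP; split; lra.
      by rewrite ler_distl; apply/andP; split; lra.
    have := hr (x' +i* y' - x +i* y).
    rewrite subrKC => /(_ (le_lt_trans dz _)); rewrite lhK => /(_ hn).
    move=> /le_trans; apply; rewrite -lhK.
    by apply: ler_wpM2l dz; exact: ltW.
  move=> /(le_trans bigM).
  have -> : (x0 + l n - x0) + (y0 + h n - y0) = l n + h n by ring.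
  rewrite lhK -mulrA ler_pdivrMr ?exprn_gt0 // => /le_trans; apply.
  rewrite le_eqVlt; apply/orP; left; apply/eqP.
  have -> : 4 ^+ n = 2 ^+ n * 2 ^+ n :> R by rewrite -exprMn; congr (_ ^+ _); ring.
  by field; rewrite expf_neq0 // pnatr_eq0.
apply/eqP; rewrite eq_le nm_ge0 andbT; apply/ler_addgt0Pr => e e0.
have K1 : 0 < 4 * K ^+ 2 + 1 by rewrite ltr_wpDl // mulr_ge0 // exprn_ge0.
rewrite add0r; apply: le_trans (MK _ (divr_gt0 e0 K1)) _.
have -> : 4 * (e / (4 * K ^+ 2 + 1)) * K ^+ 2 = e * (4 * K ^+ 2) / (4 * K ^+ 2 + 1).
  by field; rewrite gt_eqF.
by rewrite ler_pdivrMr // ler_pM2l // lerDl.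
Qed.

End Goursat.

(** * Means over the unit circle *)

Section CompactPlane.
Variable R : realType.
Local Notation C := (R[i]).

Lemma continuous_nm (T : topologicalType) (f : T -> C) x :
  {for x, continuous f} -> {for x, continuous (fun y => nm (f y))}.
Proof. exact: cvg_nm. Qed.

Lemma closed_nm_le (r : R) : closed [set z : C | nm z <= r].
Proof.
have -> : [set z : C | nm z <= r] = (fun z : C => nm z) @^-1` [set x | x <= r].
  by [].
apply: closed_comp; last exact: closed_le.
by move=> z _; apply: continuous_nm; exact: cont_id.
Qed.

Lemma compact_disc (r : R) : compact [set z : C | nm z <= r].
Proof.
pose K : set (R * R) := `[-r, r]%classic `*` `[-r, r]%classic.
pose plane (p : R * R) : C := p.1 +i* p.2.
have cK : compact (plane @` K).
  apply: continuous_compact; last first.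
    by apply: compact_setX; exact: segment_compact.
  apply: continuous_subspaceT => p.
  by apply: cont_plane; [exact: cvg_fst|exact: cvg_snd].
apply: (subclosed_compact _ cK); first exact: closed_nm_le.
move=> [x y] /= hz; exists (x, y) => //; rewrite /K /= !in_itv /=.
by rewrite -!ler_norml (le_trans (nm_Re _) hz) (le_trans (nm_Im _) hz).
Qed.

Lemma compact_circle : compact [set z : C | nm z = 1].
Proof.
apply: (subclosed_compact _ (@compact_disc 1)); last by move=> z /= ->.
have -> : [set z : C | nm z = 1] = (fun z : C => nm z) @^-1` [set 1] by [].
apply: closed_comp; last exact: closed_eq.
by move=> z _; apply: continuous_nm; exact: cont_id.
Qed.

(** The tube lemma. *)
Lemma near_compact (T : topologicalType) (X : topologicalType) (K : set X)
    (t0 : T) (P : T -> X -> Prop) : compact K ->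
  (forall s, K s -> \forall p \near (t0, s), P p.1 p.2) ->
  \forall t \near t0, forall s, K s -> P t s.
Proof.
move=> /compact_near_coveringP cK hP.
apply: (cK T (nbhs t0) P) => s /hP [[U V] /= [Ut Vs] UV].
by exists (V, U) => // -[x t] [/= Vx Ut']; apply: (UV (t, x)).
Qed.

Lemma near_uniform (T X : topologicalType) (K : set X) (F : T -> X -> C) (t0 : T) :
  compact K -> (forall s, K s -> {for (t0, s), continuous (fun p => F p.1 p.2)}) ->
  forall e : R, 0 < e ->
  \forall t \near t0, forall s, K s -> nm (F t0 s - F t s) < e.
Proof.
move=> cK Fc e e0; have e2 : 0 < e / 2 by rewrite divr_gt0.
apply: (near_compact (P := fun t s => nm (F t0 s - F t s) < e) cK) => s Ks.
have /cvgC_ltP /(_ _ e2) h := Fc s Ks.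
have h' : \forall p \near (t0, s), nm (F t0 s - F t0 p.2) < e / 2.
  case: h => -[A B] /= [At Bs] AB; exists (setT, B).
    by split=> //; exact: filterT.
  by move=> [t x] [_ /= Bx]; apply: (AB (t0, x)); split=> //; exact: nbhs_singleton.
near=> p; have -> : F t0 p.2 - F p.1 p.2 =
  (F t0 s - F p.1 p.2) - (F t0 s - F t0 p.2) by ring.
rewrite [e]splitr; apply: le_lt_trans (nmB _ _) (ltrD _ _); first by near: p.
by near: p.
Unshelve. all: by end_near. Qed.

End CompactPlane.

Section CircleMean.
Variable R : realType.
Local Notation C := (R[i]).
Implicit Types (f g : C -> C).

Definition cis t : C := cos t +i* sin t.

Lemma nm_cis t : nm (cis t) = 1.
Proof. by rewrite /nm normc_def /= cos2Dsin2 sqrtr1. Qed.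

Lemma continuous_cis : continuous cis.
Proof.
by move=> t; apply: cont_plane; [exact: continuous_cos|exact: continuous_sin].
Qed.

Lemma cis_period t : cis (t + pi *+ 2) = cis t.
Proof. by rewrite /cis cosD2pi sinD2pi. Qed.

Definition continuous_at_circle f := forall s : C, nm s = 1 -> {for s, continuous f}.

(** The contour integral of [f z dz / z] over the unit circle, divided by
    [2 pi i]. *)
Definition circ f : C := ((pi *+ 2)^-1)%:C * cint 0 (pi *+ 2) (fun t => f (cis t)).

Let pi2_gt0 : 0 < pi *+ 2 :> R. Proof. by rewrite mulrn_wgt0 // pi_gt0. Qed.

Lemma continuous_cis_comp f : continuous_at_circle f ->
  continuous_at_itv 0 (pi *+ 2) (fun t => f (cis t)).
Proof.
move=> fc t _; apply: (@continuous_comp _ _ _ cis f).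
  exact: continuous_cis.
by apply: fc; exact: nm_cis.
Qed.

Lemma eq_circ f g : (forall s, nm s = 1 -> f s = g s) -> circ f = circ g.
Proof.
by move=> fg; congr (_ * _); apply: eq_cint => t _; apply/fg/nm_cis.
Qed.

Lemma circD f g : continuous_at_circle f -> continuous_at_circle g ->
  circ (fun s => f s + g s) = circ f + circ g.
Proof.
move=> /continuous_cis_comp fc /continuous_cis_comp gc.
by rewrite /circ -mulrDr; congr (_ * _); rewrite -(cintD fc gc).
Qed.

Lemma circZ c f : continuous_at_circle f ->
  circ (fun s => c * f s) = c * circ f.
Proof.
move=> /continuous_cis_comp fc.
by rewrite /circ mulrCA; congr (_ * _); rewrite -(cintZ _ fc).
Qed.

Lemma circ_cst c : circ (fun=> c) = c.
Proof.
rewrite /circ cint_cst ?(ltW pi2_gt0) // subr0 mulrCA -rmorphM /=.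
by rewrite mulVf ?gt_eqF // mulr1.
Qed.

Lemma circ_le f M : continuous_at_circle f ->
  (forall s, nm s = 1 -> nm (f s) <= M) -> nm (circ f) <= 2 * M.
Proof.
move=> /continuous_cis_comp fc fM; rewrite /circ nmM nm_real.
rewrite ger0_norm ?invr_ge0 ?(ltW pi2_gt0) // mulrC ler_pdivrMr //.
have := cint_le (ltW pi2_gt0) fc (M := M); rewrite subr0 mulrA; apply.
by move=> t _; apply: fM; exact: nm_cis.
Qed.

Lemma circ_conj f : continuous_at_circle f ->
  circ (fun s => conjc (f s)) = conjc (circ f).
Proof.
move=> /continuous_cis_comp/integrable_Im fi; rewrite /circ rmorphM /= oppr0.
congr (_ * _); apply/eqP; rewrite eq_complex /=; apply/andP; split; apply/eqP.
  by apply: eq_Rintegral => t _; case: (f _).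
rewrite -mulN1r -RintegralZl //; apply: eq_Rintegral => t _.
by rewrite mulN1r; case: (f _).
Qed.

Lemma circB f g : continuous_at_circle f -> continuous_at_circle g ->
  circ (fun s => f s - g s) = circ f - circ g.
Proof.
move=> fc gc; rewrite -[- circ g]mulN1r -(circZ _ gc) -(circD fc).
  by apply: eq_circ => s _; rewrite mulN1r.
by move=> s s1; exact: contM (cont_cst _) (gc _ s1).
Qed.

Lemma near_circ (T : topologicalType) (F : T -> C -> C) (t0 : T) :
  (forall s, nm s = 1 -> {for (t0, s), continuous (fun p => F p.1 p.2)}) ->
  continuous_at_circle (F t0) -> forall e : R, 0 < e ->
  \forall t \near t0, continuous_at_circle (F t) ->
    nm (circ (F t0) - circ (F t)) < e.
Proof.
move=> Fc F0 e e0; have e4 : 0 < e / 4 by rewrite divr_gt0.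
apply: filterS (near_uniform (@compact_circle R) Fc e4) => t ht Ftc.
rewrite -circB //; apply: (@le_lt_trans _ _ (2 * (e / 4))); last by lra.
apply: circ_le => [s s1|s s1]; last exact/ltW/ht.
exact: contB (F0 _ s1) (Ftc _ s1).
Qed.

Lemma continuous_circ (T : topologicalType) (F : T -> C -> C) (t0 : T) :
  (forall s, nm s = 1 -> {for (t0, s), continuous (fun p => F p.1 p.2)}) ->
  (\forall t \near t0, continuous_at_circle (F t)) ->
  {for t0, continuous (fun t : T => circ (F t))}.
Proof.
move=> Fc Ft; have F0 := nbhs_singleton Ft.
by apply/cvgC_ltP => e /(near_circ Fc F0); apply: filterS2 Ft => t Ftc; exact.
Qed.

(** The complex exponential. *)
Definition cexp (z : C) : C := (expR (Re z))%:C * cis (Im z).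

Lemma cexpD z w : cexp (z + w) = cexp z * cexp w.
Proof.
case: z w => [x y] [u v]; rewrite /cexp /cis /= expRD cosD sinD; simpc.
by congr (_ +i* _); ring.
Qed.

Lemma nm_cexp z : nm (cexp z) = expR (Re z).
Proof. by rewrite nmM nm_cis mulr1 nm_real ger0_norm // expR_ge0. Qed.

Lemma is_derive_ler (f : R -> R) (x df : R) : is_derive x 1 f df ->
  forall e : R, 0 < e -> exists2 r : R, 0 < r &
    forall h : R, `|h| < r -> `|f (x + h) - f x - df * h| <= e * `|h|.
Proof.
move=> [fx dfx] e e0; move: fx; rewrite /derivable.
rewrite -[lim _]/('D_1 f x) dfx => /cvgrPdist_lt /(_ e e0).
move=> /nbhs_ballP[r /= r0 h]; exists r => // k kr.
have [->|k0] := eqVneq k 0.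
  by rewrite addr0 subrr mulr0 subr0 normr0 mulr0.
have := h k; rewrite /ball /= sub0r normrN => /(_ kr k0) /ltW.
rewrite [k *: 1]mulr1 [k + x]addrC => hk.
have -> : f (x + k) - f x - df * k = - (df - k^-1 *: (f (x + k) - f x)) * k.
  rewrite opprB mulrBl [_ *: _]mulrC.
  by rewrite mulfVK.
by rewrite normrM normrN ler_wpM2r.
Qed.

Lemma derivable_cexp z : derivable cexp z 1.
Proof.
apply/derivableC_P; exists (cexp z) => e e0.
have z0 : 0 < nm (cexp z) by rewrite nm_cexp expR_gt0.
pose e1 : R := Num.min (e / nm (cexp z) / 16) 1.
have e1_gt0 : 0 < e1 by rewrite lt_min ltr01 andbT !divr_gt0.
have e1_le1 : e1 <= 1 by rewrite ge_min lexx orbT.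
have e1_le : e1 <= e / nm (cexp z) / 16 by rewrite ge_min lexx.
clearbody e1.
have [r1 r10 h1] := is_derive_ler (is_derive_expR 0) e1_gt0.
have [r2 r20 h2] := is_derive_ler (is_derive_cos 0) e1_gt0.
have [r3 r30 h3] := is_derive_ler (is_derive_sin 0) e1_gt0.
exists (Num.min (Num.min r1 r2) (Num.min r3 e1)) => [|h].
  by rewrite !lt_min r10 r20 r30 e1_gt0.
rewrite !lt_min => /andP[/andP[hr1 hr2] /andP[hr3 he1]].
have -> : cexp (z + h) - cexp z - cexp z * h = cexp z * (cexp h - 1 - h).
  by rewrite cexpD; ring.
rewrite nmM -ler_pdivlMl // mulrA.
suff : nm (cexp h - 1 - h) <= 16 * e1 * nm h.
  move=> /le_trans; apply; rewrite ler_wpM2r ?nm_ge0 // mulrC -ler_pdivlMr //.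
  by rewrite [_^-1 * _]mulrC.
have /= := nm_Re h; have /= := nm_Im h; have := nm_ge0 h.
move: (nm h) hr1 hr2 hr3 he1 => N hr1 hr2 hr3 he1 N0.
case: h => u v /= vN uN.
have := h1 u (le_lt_trans uN hr1); have := h2 v (le_lt_trans vN hr2).
have := h3 v (le_lt_trans vN hr3).
rewrite !add0r expR0 cos0 sin0 oppr0 mul0r ?subr0 ?addr0 !mul1r.
move=> hs hc he.
apply: le_trans (nm_le_ReIm _) _; rewrite /cexp /cis /=; simpc => /=.
have hs' : `|sin v - v| <= e1 * N by rewrite (le_trans hs) // ler_wpM2l // ltW.
have hc' : `|cos v - 1| <= e1 * N by rewrite (le_trans hc) // ler_wpM2l // ltW.
have he' : `|expR u - 1 - u| <= e1 * N.
  by rewrite (le_trans he) // ler_wpM2l // ltW.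
have eN0 : 0 <= e1 * N by rewrite mulr_ge0 // ltW.
have eN : e1 * N <= N by rewrite ler_piMl.
have hE : `|expR u - 1| <= 2 * N.
  have -> : expR u - 1 = (expR u - 1 - u) + u by ring.
  by apply: le_trans (ler_normD _ _) _; lra.
have N1 : N <= 1 by rewrite (le_trans (ltW he1)).
have NN : N * N <= e1 * N by rewrite ler_wpM2r // ltW.
have -> : 16 * e1 * N = 8 * (e1 * N) + 8 * (e1 * N) by ring.
apply: lerD.
  have -> : expR u * cos v - 1 - u =
    (expR u - 1) * (cos v - 1) + ((expR u - 1 - u) + (cos v - 1)) by ring.
  apply: le_trans (ler_normD _ _) _; rewrite normrM.
  have : `|expR u - 1| * `|cos v - 1| <= 2 * N * (e1 * N).
    by apply: ler_pM.
  have : 2 * N * (e1 * N) <= 2 * (e1 * N).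
    by rewrite ler_wpM2r ?mulr_ge0 ?(ltW e1_gt0) //; lra.
  have := ler_normD (expR u - 1 - u) (cos v - 1); lra.
have -> : expR u * sin v - v =
  (expR u - 1) * (sin v - v) + ((expR u - 1) * v + (sin v - v)) by ring.
apply: le_trans (ler_normD _ _) _; rewrite normrM.
have : `|expR u - 1| * `|sin v - v| <= 2 * N * (e1 * N).
  by apply: ler_pM.
have : 2 * N * (e1 * N) <= 2 * (e1 * N).
  by rewrite ler_wpM2r ?mulr_ge0 ?(ltW e1_gt0) //; lra.
have : `|expR u - 1| * `|v| <= 2 * N * N by apply: ler_pM.
have := ler_normD ((expR u - 1) * v) (sin v - v); rewrite normrM; lra.
Qed.

(** In logarithmic coordinates an annulus becomes a rectangle whose horizontal
    sides are exchanged by the period, so only the vertical ones contribute. *)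
Lemma circ_annulus f (r1 r2 : R) : 0 < r1 -> r1 <= r2 ->
  (forall z, r1 <= nm z <= r2 -> derivable f z 1) ->
  circ (fun s => f (r1%:C * s)) = circ (fun s => f (r2%:C * s)).
Proof.
move=> r10 r12 fd; have r20 := lt_le_trans r10 r12.
have hd (x y : R) : ln r1 <= x <= ln r2 -> 0 <= y <= pi *+ 2 ->
    derivable (f \o cexp) (x +i* y) 1.
  move=> /andP[x1 x2] _; apply/derivable1_diffP; apply: differentiable_comp.
    exact/derivable1_diffP/derivable_cexp.
  apply/derivable1_diffP/fd; rewrite nm_cexp /=.
  move: x1 x2; rewrite -[ln r1 <= x]ler_expR -[x <= ln r2]ler_expR.
  by rewrite !lnK ?posrE // => -> ->.
have := goursat _ (ltW pi2_gt0) hd; rewrite ler_ln // => /(_ r12).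
rewrite /rect_integral.
have -> : cint (ln r1) (ln r2) (fun x => (f \o cexp) (x +i* (pi *+ 2))) =
          cint (ln r1) (ln r2) (fun x => (f \o cexp) (x +i* 0)).
  apply: eq_cint => x _ /=; rewrite /cexp /=.
  by rewrite -[pi *+ 2]add0r cis_period.
rewrite [X in X - _]addrAC subrr add0r -mulrBr => /eqP.
rewrite mulf_eq0 (negbTE (neq0Ci _)) /= subr_eq0 => /eqP h.
have ln_cexp (r t : R) : 0 < r -> cexp (ln r +i* t) = r%:C * cis t.
  by move=> r0; rewrite /cexp /= lnK.
rewrite /circ; congr (_ * _).
transitivity (cint 0 (pi *+ 2) (fun y => (f \o cexp) (ln r1 +i* y))).
  by apply: eq_cint => t _ /=; rewrite ln_cexp.
by rewrite -h; apply: eq_cint => t _ /=; rewrite ln_cexp.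
Qed.

End CircleMean.

(** * Divided differences and the mean value property *)

Section Derivable.
Variable R : realType.
Local Notation C := (R[i]).
Variables (E : normedModType C) (x v : E).
Implicit Types f g : E -> C.

Lemma der_cst (k : C) : derivable (fun=> k : C) x v.
Proof. exact: derivable_cst. Qed.

Lemma derD f g : derivable f x v -> derivable g x v ->
  derivable (fun y => f y + g y) x v.
Proof. exact: derivableD. Qed.

Lemma derB f g : derivable f x v -> derivable g x v ->
  derivable (fun y => f y - g y) x v.
Proof. exact: derivableB. Qed.

Lemma derM f g : derivable f x v -> derivable g x v ->
  derivable (fun y => f y * g y) x v.
Proof. exact: derivableM. Qed.

Lemma derV f : f x != 0 -> derivable f x v -> derivable (fun y => (f y)^-1) x v.
Proof. exact: derivableV. Qed.

Lemma derX f n : derivable f x v -> derivable (fun y => f y ^+ n) x v.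
Proof.
move=> fd; elim: n => [|[|n] IHn]; first exact: der_cst.
  exact: fd.
exact: derM fd IHn.
Qed.

Lemma der_sum (I : Type) (r : seq I) (P : pred I) (F : I -> E -> C) :
  (forall i, P i -> derivable (F i) x v) ->
  derivable (fun y => \sum_(i <- r | P i) F i y) x v.
Proof.
move=> Fd; elim: r => [|i r IHr].
  rewrite (_ : (fun y => _) = fun=> 0); first exact: der_cst.
  by apply/funext => y; rewrite big_nil.
have [Pi|nPi] := boolP (P i).
  rewrite (_ : (fun y => _) = fun y => F i y + \sum_(j <- r | P j) F j y).
    exact: derD (Fd _ Pi) IHr.
  by apply/funext => y; rewrite big_cons Pi.
rewrite (_ : (fun y => _) = fun y => \sum_(j <- r | P j) F j y); first exact: IHr.
by apply/funext => y; rewrite big_cons (negbTE nPi).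
Qed.

Lemma der_prod (I : Type) (r : seq I) (P : pred I) (F : I -> E -> C) :
  (forall i, P i -> derivable (F i) x v) ->
  derivable (fun y => \prod_(i <- r | P i) F i y) x v.
Proof.
move=> Fd; elim: r => [|i r IHr].
  rewrite (_ : (fun y => _) = fun=> 1); first exact: der_cst.
  by apply/funext => y; rewrite big_nil.
have [Pi|nPi] := boolP (P i).
  rewrite (_ : (fun y => _) = fun y => F i y * \prod_(j <- r | P j) F j y).
    exact: derM (Fd _ Pi) IHr.
  by apply/funext => y; rewrite big_cons Pi.
rewrite (_ : (fun y => _) = fun y => \prod_(j <- r | P j) F j y); first exact: IHr.
by apply/funext => y; rewrite big_cons (negbTE nPi).
Qed.

End Derivable.
Arguments der_cst {R E x v} k.

Section DividedDifference.
Variable R : realType.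
Local Notation C := (R[i]).
Implicit Types (f : C -> C) (z w d : C).

Lemma der_id z : derivable (fun w : C => w) z 1.
Proof. exact: derivable_id. Qed.

Arguments der_id {z}.

Lemma near_neq z w : z != w -> \forall y \near z, y != w.
Proof.
move=> zw; apply/nbhsC_P; exists (nm (z - w)); first by rewrite nm_gt0 subr_eq0.
by move=> y; apply: contraTneq => ->; rewrite nm_sub ltxx.
Qed.

Lemma cont_ltP (T : topologicalType) (f : T -> C) (x : T) :
  {for x, continuous f} <->
  forall e : R, 0 < e -> \forall y \near x, nm (f x - f y) < e.
Proof. exact: cvgC_ltP. Qed.

Lemma cont_near_eq (T : topologicalType) (f g : T -> C) (z : T) :
  (\forall y \near z, f y = g y) -> {for z, continuous f} ->
  {for z, continuous g}.
Proof.
move=> fg /cvgC_ltP fc; apply/cvgC_ltP => e e0.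
rewrite -(nbhs_singleton fg); have fe := fc _ e0.
by apply: filterS2 fg fe => y ->.
Qed.

(** Divided differences; [d] is meant to be the derivative of [f] at [w]. *)
Definition slope f d w z : C := if z == w then d else (f z - f w) / (z - w).

Lemma slopeE f d w z : f z = f w + (z - w) * slope f d w z.
Proof.
rewrite /slope; case: eqP => [->|/eqP zw]; first by rewrite subrr mul0r addr0.
by rewrite mulrC divfK ?subr_eq0 // subrKC.
Qed.

Lemma slope_near f d w z : z != w ->
  \forall y \near z, (f y - f w) / (y - w) = slope f d w y.
Proof. by move=> /near_neq; apply: filterS => y /negbTE yw; rewrite /slope yw. Qed.

Lemma slope_continuous_off f d w z : z != w -> {for z, continuous f} ->
  {for z, continuous (slope f d w)}.
Proof.
move=> zw fc; apply: cont_near_eq (slope_near f d zw) _.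
apply: contM; first exact: contB fc (cont_cst (f w)).
by apply: contV; [rewrite subr_eq0|exact: contB cont_id (cont_cst w)].
Qed.

Lemma slope_derivable_off f d w z : z != w -> derivable f z 1 ->
  derivable (slope f d w) z 1.
Proof.
move=> zw fc; apply: near_eq_derivable (slope_near f d zw) _.
apply: derM; first exact: derB fc (der_cst (f w)).
by apply: derV; [rewrite subr_eq0|exact: derB der_id (der_cst w)].
Qed.

Lemma slope_continuous_at f w : derivable f w 1 ->
  exists d, {for w, continuous (slope f d w)}.
Proof.
move=> /derivableC_P[d hd]; exists d; apply/cont_ltP => e e0.
have [r r0 hr] := hd _ (divr_gt0 e0 (ltr0Sn _ 1)).
apply/nbhsC_P; exists r => // y yr; rewrite {1}/slope eqxx /slope.
case: eqP => [_|/eqP yw]; first by rewrite subrr nm0.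
have := hr _ yr; rewrite subrKC.
have yw0 : y - w != 0 by rewrite subr_eq0.
have -> : f y - f w - d * (y - w) = - (d - (f y - f w) / (y - w)) * (y - w).
  by rewrite opprB mulrBl divfK.
rewrite nmM nmN ler_pM2r ?nm_gt0 // => /le_lt_trans; apply.
by rewrite ltr_pdivrMr // ltr_pMr //; lra.
Qed.

End DividedDifference.
Arguments der_id {R z}.

Section UnitDisc.
Variable R : realType.
Local Notation C := (R[i]).
Implicit Types (f g : C -> C) (z w : C).

Definition continuous_on_disc f := forall z, nm z <= 1 -> {for z, continuous f}.
Definition derivable_on_disc f := forall z, nm z <= 1 -> derivable f z 1.

Lemma derivable_continuous_on_disc f :
  derivable_on_disc f -> continuous_on_disc f.
Proof. by move=> fd z z1; apply/derivable_continuousC/fd. Qed.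

Lemma continuous_disc_circle f : continuous_on_disc f -> continuous_at_circle f.
Proof. by move=> fc s s1; apply: fc; rewrite s1. Qed.

Lemma continuous_scale f (r : R) : continuous_on_disc f -> 0 <= r <= 1 ->
  continuous_at_circle (fun s => f (r%:C * s)).
Proof.
move=> fc /andP[r0 r1] s s1.
apply: (@continuous_comp _ _ _ (fun s => r%:C * s) f).
  exact: contM (cont_cst _) cont_id.
by apply: fc; rewrite nmM s1 mulr1 nm_real ger0_norm.
Qed.

Lemma near_circ_scale f (r : R) : continuous_on_disc f -> 0 <= r <= 1 ->
  forall e : R, 0 < e -> exists2 dl : R, 0 < dl & forall r', 0 <= r' <= 1 ->
    `|r - r'| < dl ->
    nm (circ (fun s => f (r%:C * s)) - circ (fun s => f (r'%:C * s))) < e.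
Proof.
move=> fc r01 e e0.
have h : \forall r' \near r, continuous_at_circle (fun s => f (r'%:C * s)) ->
    nm (circ (fun s => f (r%:C * s)) - circ (fun s => f (r'%:C * s))) < e.
  apply: (@near_circ _ _ (fun (r : R) s => f (r%:C * s))) => //; last first.
    exact: continuous_scale.
  move=> s s1; apply: (@continuous_comp _ _ _ (fun p : R * C => p.1%:C * p.2) f).
    apply: contM; last exact: cvg_snd.
    by apply: (@cvg_realC _ _ _ _ fst); exact: cvg_fst.
  have /andP[r0 r1] := r01.
  by apply: fc; rewrite nmM s1 mulr1 nm_real ger0_norm.
move: h => /nbhs_ballP[dl /= dl0 hdl]; exists dl => // r' r'01 rr'.
by apply: hdl => //; exact: continuous_scale.
Qed.

(** Finitely many exceptional points do not matter: the mean over circles of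
    radius [r] is continuous in [r] and locally constant away from finitely
    many radii. *)
Lemma circ_mean f (S : seq C) : continuous_on_disc f ->
  (forall z, nm z <= 1 -> z \notin S -> derivable f z 1) -> circ f = f 0.
Proof.
move=> fc fd; pose M (r : R) := circ (fun s => f (r%:C * s)).
have annulus (r1 r2 : R) : 0 <= r1 -> r1 <= r2 -> r2 <= 1 ->
    (forall p, p \in S -> r1 < nm p < r2 -> False) -> M r1 = M r2.
  move=> r10 r12 r21 noS; have [->//|r1r2] := eqVneq r1 r2.
  have {r1r2}r12 : r1 < r2 by rewrite lt_neqAle r1r2.
  apply/eqP; rewrite -subr_eq0 -nm_eq0 eq_le nm_ge0 andbT.
  apply/ler_addgt0Pr => e e0; rewrite add0r; have e2 : 0 < e / 2 by rewrite divr_gt0.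
  have [|dl1 dl10 h1] := @near_circ_scale f r1 fc _ _ e2.
    by rewrite r10 (le_trans (ltW r12)).
  have [|dl2 dl20 h2] := @near_circ_scale f r2 fc _ _ e2.
    by rewrite r21 andbT (le_trans r10 (ltW r12)).
  pose k := Num.min (Num.min (dl1 / 2) (dl2 / 2)) ((r2 - r1) / 3).
  have k0 : 0 < k by rewrite !lt_min !divr_gt0 // subr_gt0.
  have kd1 : k <= dl1 / 2 by rewrite !ge_min lexx.
  have kd2 : k <= dl2 / 2 by rewrite !ge_min lexx !orbT.
  have kr : k <= (r2 - r1) / 3 by rewrite !ge_min lexx !orbT.
  clearbody k.
  have Meq : M (r1 + k) = M (r2 - k).
    apply: circ_annulus; [lra|lra|move=> z /andP[z1 z2]].
    apply: fd; first lra.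
    by apply/negP => /noS; apply; apply/andP; split; lra.
  have -> : M r1 - M r2 = (M r1 - M (r1 + k)) - (M r2 - M (r2 - k)).
    by rewrite Meq; ring.
  apply: le_trans (nmB _ _) _; rewrite [e]splitr; apply: lerD; apply: ltW.
    apply: h1; first by apply/andP; split; lra.
    by rewrite opprD addNKr normrN gtr0_norm //; lra.
  apply: h2; first by apply/andP; split; lra.
  by rewrite opprB addrC subrK gtr0_norm //; lra.
have all_radii (B : seq C) : forall r1 r2 : R, 0 <= r1 -> r1 <= r2 -> r2 <= 1 ->
    (forall p, p \in S -> r1 < nm p < r2 -> p \in B) -> M r1 = M r2.
  elim: B => [|b B IHB] r1 r2 r10 r12 r21 SB.
    by apply: annulus => // p pS pr; have := SB p pS pr.
  have [/andP[b1 b2]|bout] := boolP (r1 < nm b < r2).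
    rewrite (IHB r1 (nm b)) ?(ltW b1) ?(le_trans (ltW b2)) //.
      rewrite (IHB (nm b) r2) ?nm_ge0 ?(ltW b2) // => p pS /andP[p1 p2].
      have := SB p pS; rewrite (lt_trans b1 p1) p2 inE => /(_ isT)/orP[/eqP pb|//].
      by rewrite pb ltxx in p1.
    move=> p pS /andP[p1 p2].
    have := SB p pS; rewrite p1 (lt_trans p2 b2) inE => /(_ isT)/orP[/eqP pb|//].
    by rewrite pb ltxx in p2.
  apply: IHB => // p pS pr; have := SB p pS pr; rewrite inE => /orP[/eqP pb|//].
  by rewrite -pb pr in bout.
transitivity (M 1); first by apply: eq_circ => s _; rewrite mul1r.
rewrite -(all_radii S 0 1) // -[RHS]circ_cst.
by apply: eq_circ => s _; rewrite mul0r.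
Qed.

End UnitDisc.

(** * Cauchy integrals, removable singularities and zeros *)

Section Cauchy.
Variable R : realType.
Local Notation C := (R[i]).
Implicit Types (f g : C -> C) (z w s : C).

Lemma neq_of_nm z w : nm w < nm z -> z != w.
Proof. by apply: contraTneq => ->; rewrite ltxx. Qed.

Lemma circle_neq s w : nm s = 1 -> nm w < 1 -> s - w != 0.
Proof. by move=> s1 w1; rewrite subr_eq0 neq_of_nm // s1. Qed.

Lemma slope_continuous_on_disc f d w : continuous_on_disc f ->
  {for w, continuous (slope f d w)} -> continuous_on_disc (slope f d w).
Proof.
move=> fc dc z z1; have [->|zw] := eqVneq z w; first exact: dc.
exact: slope_continuous_off zw (fc _ z1).
Qed.

Lemma continuous_circle_id : continuous_at_circle (fun s : C => s).
Proof. by move=> s _; exact: cont_id. Qed.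
Arguments continuous_circle_id : clear implicits.

Lemma continuous_circleM f g : continuous_at_circle f ->
  continuous_at_circle g -> continuous_at_circle (fun s => f s * g s).
Proof. by move=> fc gc s s1; exact: contM (fc _ s1) (gc _ s1). Qed.

Lemma continuous_circleB f g : continuous_at_circle f ->
  continuous_at_circle g -> continuous_at_circle (fun s => f s - g s).
Proof. by move=> fc gc s s1; exact: contB (fc _ s1) (gc _ s1). Qed.

Lemma continuous_circleV f : continuous_at_circle f ->
  (forall s, nm s = 1 -> f s != 0) -> continuous_at_circle (fun s => (f s)^-1).
Proof. by move=> fc f0 s s1; exact: contV (f0 _ s1) (fc _ s1). Qed.

Lemma continuous_circle_cst (k : C) : continuous_at_circle (fun=> k).
Proof. by move=> s _; exact: cont_cst. Qed.
Arguments continuous_circle_cst : clear implicits.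

Lemma continuous_circle_div f (w : C) : continuous_at_circle f -> nm w < 1 ->
  continuous_at_circle (fun s => f s / (s - w)).
Proof.
move=> fc w1; apply: continuous_circleM fc _.
apply: (@continuous_circleV (fun s => s - w)) => [|s s1]; last exact: circle_neq.
exact: (@continuous_circleB (fun s => s) (fun=> w)) continuous_circle_id
  (continuous_circle_cst w).
Qed.

(** On the circle conjugation is inversion, so a function of [s^-1] is handled
    by conjugating a holomorphic function of [s]. *)
Lemma circ_conj_mean f : derivable_on_disc f ->
  circ (fun s => conjc (f s)) = conjc (f 0).
Proof.
move=> fd; have fc := derivable_continuous_on_disc fd.
rewrite circ_conj; last exact: continuous_disc_circle.
by rewrite (circ_mean (S := [::]) fc) // => z z1 _; exact: fd.
Qed.

Lemma conj_circle s : nm s = 1 -> conjc s = s^-1.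
Proof. by move=> s1; rewrite invc_norm nmE s1 expr1n invr1 mul1r. Qed.

Lemma conj_inv_sub s w : nm s = 1 ->
  conjc (1 - conjc w * s)^-1 = s / (s - w).
Proof.
move=> s1; have s0 : s != 0 by rewrite -nm_gt0 s1.
rewrite conjc_inv rmorphB rmorph1 rmorphM /= conjcK conj_circle //.
by rewrite -[X in X - _](mulfV s0) -mulrBl invfM invrK mulrC.
Qed.

Lemma derivable_inv_sub w : nm w < 1 ->
  derivable_on_disc (fun s => (1 - conjc w * s)^-1).
Proof.
move=> w1 z z1; apply: derV; last first.
  exact: derB (der_cst 1) (derM (der_cst _) der_id).
rewrite subr_eq0 eq_sym; apply/eqP => /(congr1 (@nm R)).
rewrite nmM nm_conj nm1 => e.
have : nm w * nm z <= nm w by rewrite ler_piMr ?nm_ge0.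
by rewrite e leNgt w1.
Qed.

Lemma circ_kernel w : nm w < 1 -> circ (fun s => s / (s - w)) = 1.
Proof.
move=> w1; rewrite -(@eq_circ _ (fun s => conjc (1 - conjc w * s)^-1)).
  by rewrite circ_conj_mean ?mulr0 ?subr0 ?invr1 ?rmorph1 //; exact: derivable_inv_sub.
by move=> s; exact: conj_inv_sub.
Qed.

(** By [conj_inv_sub] the integrand is the conjugate on the circle of the
    holomorphic function [f] below, whose value at 0 is the right-hand side. *)
Lemma circ_monic (a : seq C) (m : nat) : all (fun w => nm w < 1) a ->
  circ (fun s => s ^+ size a / (\prod_(w <- a) (s - w)) / s ^+ m) =
  (m == 0%N)%:R.
Proof.
move=> /allP a1.
pose f (s : C) := s ^+ m * \prod_(w <- a) (1 - conjc w * s)^-1.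
have fd : derivable_on_disc f.
  move=> z z1; apply: derM; first exact: derX der_id.
  rewrite (_ : (fun y => _) =
      fun y => \prod_(w <- a | w \in a) (1 - conjc w * y)^-1).
    by apply: der_prod => w /a1 w1; exact: derivable_inv_sub w1 _ z1.
  by apply/funext => y; rewrite big_seq.
rewrite -(@eq_circ _ (fun s => conjc (f s))).
  rewrite circ_conj_mean // /f expr0n big1; last by move=> w _; rewrite mulr0 subr0 invr1.
  by rewrite mulr1 rmorph_nat.
move=> s s1; rewrite /f rmorphM rmorphXn /= conj_circle // rmorph_prod /=.
rewrite exprVn mulrC; congr (_ / _).
rewrite (eq_bigr (fun w => s / (s - w))); last by move=> w _; rewrite conj_inv_sub.
by rewrite big_split /= big_const_seq count_predT iter_mulr_1 prodfV.
Qed.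

(** The function [s * slope f d w s] vanishes at 0, hence so does its mean; the
    mean of the kernel [s / (s - w)] itself is 1. *)
Lemma cauchy_formula f (S : seq C) w : continuous_on_disc f ->
  (forall z, nm z <= 1 -> z \notin S -> derivable f z 1) ->
  nm w < 1 -> w \notin S -> circ (fun s => f s * s / (s - w)) = f w.
Proof.
move=> fc fd w1 wS; have [d dc] := slope_continuous_at (fd _ (ltW w1) wS).
have gc := slope_continuous_on_disc fc dc.
have mean0 : circ (fun s => s * slope f d w s) = 0.
  have gd z : nm z <= 1 -> z \notin w :: S ->
      derivable (fun s => s * slope f d w s) z 1.
    move=> z1; rewrite inE negb_or => /andP[zw zS].
    apply: derM; first exact: der_id.
    exact: slope_derivable_off zw (fd _ z1 zS).
  have sgc : continuous_on_disc (fun s => s * slope f d w s).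
    by move=> z z1; exact: contM cont_id (gc _ z1).
  by rewrite (circ_mean sgc gd) mul0r.
have kc := continuous_circle_div continuous_circle_id w1.
have fkc := continuous_circleM (continuous_disc_circle fc) kc.
have fwc := continuous_circleM (continuous_circle_cst (f w)) kc.
have eqm : circ (fun s => s * slope f d w s) =
    circ (fun s => f s * (s / (s - w)) - f w * (s / (s - w))).
  apply: eq_circ => s s1; have sw := circle_neq s1 w1.
  by rewrite /slope -subr_eq0 (negbTE sw); field.
rewrite (eq_circ (g := fun s => f s * (s / (s - w)))); last first.
  by move=> s _; rewrite mulrA.
move: mean0; rewrite eqm (circB fkc fwc) (circZ _ kc) circ_kernel // mulr1.
by move/eqP; rewrite subr_eq0 => /eqP.
Qed.

Lemma bounded_on_compact (X : topologicalType) (K : set X) (F : X -> C) :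
  compact K -> (forall x, K x -> {for x, continuous F}) ->
  exists M : R, forall x, K x -> nm (F x) <= M.
Proof.
move=> /compact_near_coveringP cK Fc.
have [M [_ hM]] : \forall M \near +oo, forall x, K x -> nm (F x) <= M.
  apply: (cK R +oo (fun M x => nm (F x) <= M)) => x Kx.
  have /cont_ltP /(_ 1 ltr01) h := Fc _ Kx.
  exists ([set y | nm (F x - F y) < 1], [set M | nm (F x) + 1 <= M]).
    by split=> //=; apply: nbhs_pinfty_ge; exact: num_real.
  move=> [y M] [/= h1]; apply: le_trans.
  by rewrite -lerBlDl (le_trans (nm_lerB _ _)) // nm_sub ltW.
by exists (M + 1) => x; apply: hM; rewrite ltrDl.
Qed.

Lemma bounded_on_circle f : continuous_at_circle f ->
  exists M : R, forall s, nm s = 1 -> nm (f s) <= M.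
Proof. by move=> fc; exact: (bounded_on_compact (@compact_circle R) fc). Qed.

(** The second-order remainder of the Cauchy kernel is uniform on the circle. *)
Lemma derivable_cauchy_integral f w : continuous_at_circle f -> nm w < 1 ->
  derivable (fun z => circ (fun s => f s / (s - z))) w 1.
Proof.
move=> fc w1; have [M hM] := bounded_on_circle fc.
have M0 : 0 <= M by rewrite (le_trans (nm_ge0 _) (hM 1 (nm1 R))).
pose dl := 1 - nm w; have dl0 : 0 < dl by rewrite subr_gt0.
have fw := continuous_circle_div fc w1.
have fww := continuous_circle_div fw w1.
apply/derivableC_P; exists (circ (fun s => f s / (s - w) / (s - w))) => e e0.
pose B := 4 * M / dl ^+ 3 + 1.
have B0 : 0 < B.
  by rewrite ltr_wpDl // divr_ge0 ?mulr_ge0 // ?exprn_ge0 // ltW.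
exists (Num.min (dl / 2) (e / B)).
  by rewrite lt_min !divr_gt0.
move=> h; rewrite lt_min => /andP[hdl heB].
have wh1 : nm (w + h) < 1.
  apply: le_lt_trans (nmD _ _) _; rewrite -ltrBrDl (lt_le_trans hdl) //.
  by rewrite -/dl ler_pdivrMr //; lra.
have fwh := continuous_circle_div fc wh1.
have fwwh := continuous_circle_div fww wh1.
have kwwh := continuous_circleM (continuous_circle_cst (h * h)) fwwh.
have khww := continuous_circleM (continuous_circle_cst h) fww.
have -> : circ (fun s => f s / (s - (w + h))) - circ (fun s => f s / (s - w)) -
    circ (fun s => f s / (s - w) / (s - w)) * h =
    h * h * circ (fun s => f s / (s - w) / (s - w) / (s - (w + h))).
  rewrite [_ * h]mulrC -(circZ _ fww) -(circZ _ fwwh) -(circB fwh fw).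
  rewrite -(circB (continuous_circleB fwh fw) khww).
  apply: eq_circ => s s1; have sw := circle_neq s1 w1.
  have swh := circle_neq s1 wh1.
  by field; rewrite swh sw.
rewrite (nmM (h * h)) (nmM h h).
have bd : nm (circ (fun s => f s / (s - w) / (s - w) / (s - (w + h)))) <=
    2 * (M / dl / dl / (dl / 2)).
  apply: circ_le fwwh _ => s s1; rewrite !nmM !nmV.
  have d1 : dl <= nm (s - w) by rewrite /dl -s1 nm_lerB.
  have d2 : dl / 2 <= nm (s - (w + h)).
    have -> : s - (w + h) = (s - w) - h by ring.
    apply: le_trans (nm_lerB _ _); lra.
  have i1 : (nm (s - w))^-1 <= dl^-1.
    by rewrite lef_pV2 ?posrE // (lt_le_trans dl0).
  have i2 : (nm (s - (w + h)))^-1 <= (dl / 2)^-1.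
    by rewrite lef_pV2 ?posrE ?divr_gt0 // (lt_le_trans _ d2) // divr_gt0.
  by repeat apply: ler_pM;
     rewrite ?mulr_ge0 ?invr_ge0 ?nm_ge0 //; exact: hM.
rewrite -mulrA [leRHS]mulrC ler_wpM2l ?nm_ge0 //.
apply: le_trans (_ : nm h * B <= e); last by rewrite -ler_pdivlMr // ltW.
rewrite ler_wpM2l ?nm_ge0 //; apply: le_trans bd _; rewrite /B.
apply: le_trans (_ : 4 * M / dl ^+ 3 <= _); last by rewrite lerDl.
rewrite le_eqVlt; apply/orP; left; apply/eqP.
by field; rewrite gt_eqF.
Qed.

Lemma nbhs_notin (S : seq C) w (P : C -> Prop) :
  (\forall z \near w, P z) -> exists2 z, z \notin S & P z.
Proof.
move=> /nbhsC_P[r r0 hr]; pose p (n : nat) : C := w + (r / n.+2%:R)%:C.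
have pinj : injective p.
  move=> m n /addrI /complexI /(mulfI (lt0r_neq0 r0)) /invr_inj /eqP.
  by rewrite eqr_nat => /eqP[].
have /hasP[z zp zS] : has [pred z | z \notin S] [seq p i | i <- iota 0 (size S).+1].
  rewrite has_predC; apply/negP => /allP sub.
  have := @uniq_leq_size _ [seq p i | i <- iota 0 (size S).+1] S.
  by rewrite map_inj_uniq ?iota_uniq // size_map size_iota ltnn => /(_ isT sub).
exists z; first exact: zS.
have /mapP[n _ ->] := zp; apply: hr; rewrite /p addrC addKr nm_real.
rewrite ger0_norm ?divr_ge0 ?(ltW r0) // ltr_pdivrMr // ltr_pMr //.
by rewrite ltr1n.
Qed.

Lemma near_disc w : nm w < 1 -> \forall z \near w, nm z < 1.
Proof.
move=> w1; apply/nbhsC_P; exists (1 - nm w); first by rewrite subr_gt0.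
move=> z hz; have := nmD (z - w) w; rewrite subrK => /le_lt_trans; apply.
by rewrite -ltrBrDr.
Qed.

(** Off the exceptional points [f] is its own Cauchy integral, hence everywhere
    in the open disc by continuity. *)
Lemma removable_singularity f (S : seq C) w : continuous_on_disc f ->
  (forall z, nm z <= 1 -> z \notin S -> derivable f z 1) ->
  nm w < 1 -> derivable f w 1.
Proof.
move=> fc fd w1; pose K z := circ (fun s => f s * s / (s - z)).
have fsc := continuous_circleM (continuous_disc_circle fc) continuous_circle_id.
have Kd z : nm z < 1 -> derivable K z 1 by exact: derivable_cauchy_integral.
have KE z : nm z < 1 -> z \notin S -> K z = f z.
  by move=> z1 zS; exact: cauchy_formula fc fd z1 zS.
have KEall z : nm z < 1 -> K z = f z.
  move=> z1; apply/eqP; rewrite -subr_eq0 -nm_eq0 eq_le nm_ge0 andbT.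
  apply/ler_addgt0Pr => e e0; rewrite add0r.
  have e2 : 0 < e / 2 by rewrite divr_gt0.
  have /cont_ltP /(_ _ e2) h1 := derivable_continuousC (Kd _ z1).
  have /cont_ltP /(_ _ e2) h2 := fc _ (ltW z1).
  have h3 := near_disc z1.
  have [y yS [hy1 [hy2 y1]]] := nbhs_notin S (filterI h1 (filterI h2 h3)).
  have -> : K z - f z = (K z - K y) - (f z - f y) by rewrite (KE y y1 yS); ring.
  by apply: le_trans (nmB _ _) _; rewrite [e]splitr lerD // ltW.
by apply: near_eq_derivable (Kd _ w1); apply: filterS (near_disc w1).
Qed.

(** The slope of [f] at [a] is continuous at [a], so its singularity is
    removable. *)
Lemma divide_zero f a : derivable_on_disc f -> nm a < 1 -> f a = 0 ->
  exists2 g, derivable_on_disc g & forall z, f z = (z - a) * g z.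
Proof.
move=> fd a1 fa; have [d dc] := slope_continuous_at (fd _ (ltW a1)).
have gc := slope_continuous_on_disc (derivable_continuous_on_disc fd) dc.
have god z : nm z <= 1 -> z \notin [:: a] -> derivable (slope f d a) z 1.
  by move=> z1; rewrite inE => za; exact: slope_derivable_off za (fd _ z1).
exists (slope f d a) => [z z1|z]; last by rewrite {1}(slopeE f d a) fa add0r.
have [->|za] := eqVneq z a; first exact: removable_singularity gc god a1.
by apply: god => //; rewrite inE.
Qed.

Lemma cauchy_bound f w (M : R) : derivable_on_disc f -> nm w < 1 ->
  (forall s, nm s = 1 -> nm (f s) <= M) -> nm (f w) <= 2 * M / (1 - nm w).
Proof.
move=> fd w1 fM; have fc := derivable_continuous_on_disc fd.
rewrite -(@cauchy_formula f [::] w fc _ w1) //; last by move=> z z1 _; exact: fd.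
have fsc := continuous_circleM (continuous_disc_circle fc) continuous_circle_id.
rewrite -mulrA; apply: circ_le (continuous_circle_div fsc w1) _ => s s1.
rewrite !nmM nmV s1 mulr1; apply: ler_pM; rewrite ?invr_ge0 ?nm_ge0 ?fM //.
have d : 1 - nm w <= nm (s - w) by rewrite -s1 nm_lerB.
by rewrite lef_pV2 // ?posrE ?subr_gt0 // (lt_le_trans _ d) // subr_gt0.
Qed.

Lemma exprn_small (x e : R) : 0 <= x < 1 -> 0 < e -> exists n, x ^+ n < e.
Proof.
move=> /andP[x0 x1] e0.
have : (fun n => x ^+ n) @ \oo --> (0 : R) by apply: cvg_expr; rewrite ger0_norm.
move=> /cvgrPdist_lt /(_ e e0)[n _ /(_ n (leqnn n))]; rewrite sub0r normrN.
by rewrite ger0_norm ?exprn_ge0 // => ?; exists n.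
Qed.

(** If zeros at the origin could be divided out forever, then [cauchy_bound]
    would give [nm (f w) <= M * nm w ^+ n] for all [n], contradicting
    [f w != 0]. *)
Lemma order_at_zero f w : derivable_on_disc f -> nm w < 1 -> f w != 0 ->
  exists n g, [/\ derivable_on_disc g, g 0 != 0 &
    forall z, f z = z ^+ n * g z].
Proof.
move=> fd w1 fw.
have [//|noord] := pselect (exists n g, [/\ derivable_on_disc g, g 0 != 0 &
    forall z, f z = z ^+ n * g z]).
have divn n : exists2 g, derivable_on_disc g & forall z, f z = z ^+ n * g z.
  elim: n => [|n [g gd gE]].
    by exists f => // z; rewrite expr0 mul1r.
  have g0 : g 0 = 0.
    by apply/eqP; apply: contrapT => /negP g0; apply: noord; exists n, g.
  have [|h hd hE] := @divide_zero g 0 gd _ g0; first by rewrite nm0.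
  by exists h => // z; rewrite gE hE subr0 exprSr mulrA.
have [M hM] := bounded_on_circle
  (continuous_disc_circle (derivable_continuous_on_disc fd)).
exfalso; move: fw; rewrite -nm_gt0 => fw.
have bd n : nm (f w) <= nm w ^+ n * (2 * M / (1 - nm w)).
  have [g gd gE] := divn n; rewrite gE nmM nmX ler_wpM2l ?exprn_ge0 ?nm_ge0 //.
  apply: cauchy_bound => // s s1; have := hM s s1.
  by rewrite gE nmM nmX s1 expr1n mul1r.
have M0 : 0 < 2 * M / (1 - nm w).
  by rewrite (lt_le_trans fw) // (le_trans (bd 0)) // expr0 mul1r.
have [|n hn] := exprn_small (x := nm w) _ (divr_gt0 fw M0).
  by rewrite nm_ge0.
by have := bd n; rewrite leNgt -ltr_pdivlMr // hn.
Qed.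

Lemma isolated_zero f w : derivable_on_disc f -> nm w < 1 -> f w != 0 ->
  exists2 r : R, 0 < r & forall z, 0 < nm z < r -> f z != 0.
Proof.
move=> fd w1 fw; have [n [g [gd g0 gE]]] := order_at_zero fd w1 fw.
have gc : {for 0, continuous g}.
  by apply: derivable_continuousC; apply: gd; rewrite nm0.
have /nbhsC_P[r r0 hr] : \forall z \near (0 : C), g z != 0.
  have g00 : 0 < nm (g 0) by rewrite nm_gt0.
  have /cont_ltP /(_ _ g00) := gc; apply: filterS => z.
  by apply: contraTneq => ->; rewrite subr0 ltxx.
exists r => // z /andP[z0 zr]; rewrite gE mulf_neq0 ?expf_neq0 -?nm_gt0 //.
by rewrite nm_gt0; apply: hr; rewrite subr0.
Qed.

End Cauchy.
Arguments continuous_circle_id {R}.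
Arguments continuous_circle_cst {R} k.

(** * Holomorphy along lines *)

Section LineHolomorphic.
Variable R : realType.
Local Notation C := (R[i]).

(** Continuity and complex differentiability along lines: a notion of
    holomorphy that is stable under restriction to slices and integration in a
    parameter, and only needs one-variable complex analysis. *)
Definition linehol (E : normedModType C) (W : set E) (g : E -> C) :=
  forall x, W x -> {for x, continuous g} /\ forall v, derivable g x v.

Lemma cont_cst_at (T T' : topologicalType) (x : T) (k : T') :
  {for x, continuous (fun=> k : T')}.
Proof. exact: cst_continuous. Qed.

Lemma cont_pair (T T1 T2 : topologicalType) (f : T -> T1) (g : T -> T2) (x : T) :
  {for x, continuous f} -> {for x, continuous g} ->
  {for x, continuous (fun y => (f y, g y))}.
Proof. by move=> fc gc; exact: cvg_pair. Qed.

Lemma cont_line (T : topologicalType) (E : normedModType C) (s : T -> C)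
    (x : T) (v w : E) : {for x, continuous s} ->
  {for x, continuous (fun y => s y *: v + w)}.
Proof.
move=> sc; have sv : {for x, continuous (fun y => s y *: v)} by exact: cvgZr_tmp.
apply: (@continuousD _ _ _ (fun y => s y *: v) (fun=> w)); first exact: sv.
exact: cst_continuous.
Qed.

Lemma eq_le1 (z : C) : nm z = 1 -> nm z <= 1.
Proof. by move=> ->. Qed.

Lemma nm0_le1 : nm (0 : C) <= 1.
Proof. by rewrite nm0. Qed.

Lemma linehol_sub (E : normedModType C) (W W' : set E) g :
  W' `<=` W -> linehol W g -> linehol W' g.
Proof. by move=> W'W gh x /W'W /gh. Qed.

Section Algebra.
Variables (E : normedModType C) (W : set E).
Implicit Types f g : E -> C.

Lemma linehol_cst (k : C) : linehol W (fun=> k).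
Proof. by move=> x _; split=> [|v]; [exact: cont_cst|exact: der_cst]. Qed.

Lemma linehol_add f g : linehol W f -> linehol W g ->
  linehol W (fun x => f x + g x).
Proof.
move=> fh gh x Wx; have [fc fd] := fh _ Wx; have [gc gd] := gh _ Wx.
by split=> [|v]; [exact: contD fc gc|exact: derD (fd v) (gd v)].
Qed.

Lemma linehol_sub_fun f g : linehol W f -> linehol W g ->
  linehol W (fun x => f x - g x).
Proof.
move=> fh gh x Wx; have [fc fd] := fh _ Wx; have [gc gd] := gh _ Wx.
by split=> [|v]; [exact: contB fc gc|exact: derB (fd v) (gd v)].
Qed.

Lemma linehol_mul f g : linehol W f -> linehol W g ->
  linehol W (fun x => f x * g x).
Proof.
move=> fh gh x Wx; have [fc fd] := fh _ Wx; have [gc gd] := gh _ Wx.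
by split=> [|v]; [exact: contM fc gc|exact: derM (fd v) (gd v)].
Qed.

Lemma linehol_inv f : linehol W f -> (forall x, W x -> f x != 0) ->
  linehol W (fun x => (f x)^-1).
Proof.
move=> fh f0 x Wx; have [fc fd] := fh _ Wx.
by split=> [|v]; [exact: contV (f0 _ Wx) fc|exact: derV (f0 _ Wx) (fd v)].
Qed.

Lemma linehol_exp f n : linehol W f -> linehol W (fun x => f x ^+ n).
Proof.
move=> fh x Wx; have [fc fd] := fh _ Wx.
by split=> [|v]; [exact: contX fc|exact: derX (fd v)].
Qed.

Lemma linehol_sum (I : Type) (r : seq I) (P : pred I) (F : I -> E -> C) :
  (forall i, P i -> linehol W (F i)) ->
  linehol W (fun x => \sum_(i <- r | P i) F i x).
Proof.
move=> Fh; elim: r => [|i r IHr].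
  rewrite (_ : (fun x => _) = fun=> 0); first exact: linehol_cst.
  by apply/funext => x; rewrite big_nil.
have [Pi|nPi] := boolP (P i).
  rewrite (_ : (fun x => _) = fun x => F i x + \sum_(j <- r | P j) F j x).
    exact: linehol_add (Fh _ Pi) IHr.
  by apply/funext => x; rewrite big_cons Pi.
rewrite (_ : (fun x => _) = fun x => \sum_(j <- r | P j) F j x); first exact: IHr.
by apply/funext => x; rewrite big_cons (negbTE nPi).
Qed.

Lemma linehol_prod (I : Type) (r : seq I) (P : pred I) (F : I -> E -> C) :
  (forall i, P i -> linehol W (F i)) ->
  linehol W (fun x => \prod_(i <- r | P i) F i x).
Proof.
move=> Fh; elim: r => [|i r IHr].
  rewrite (_ : (fun x => _) = fun=> 1); first exact: linehol_cst.
  by apply/funext => x; rewrite big_nil.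
have [Pi|nPi] := boolP (P i).
  rewrite (_ : (fun x => _) = fun x => F i x * \prod_(j <- r | P j) F j x).
    exact: linehol_mul (Fh _ Pi) IHr.
  by apply/funext => x; rewrite big_cons Pi.
rewrite (_ : (fun x => _) = fun x => \prod_(j <- r | P j) F j x); first exact: IHr.
by apply/funext => x; rewrite big_cons (negbTE nPi).
Qed.

Lemma linehol_det n (M : E -> 'M[C]_n) :
  (forall i j, linehol W (fun x => M x i j)) ->
  linehol W (fun x => \det (M x)).
Proof.
move=> Mh; rewrite /determinant; apply: linehol_sum => s _.
apply: linehol_mul; first exact: linehol_cst.
by apply: linehol_prod => i _; exact: Mh.
Qed.

End Algebra.

Lemma derivable_affine (E E' : normedModType C) (A : E -> E') (g : E' -> C)
    (x v : E) (w : E') : (forall h : C, A (h *: v + x) = h *: w + A x) ->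
  derivable g (A x) w -> derivable (g \o A) x v.
Proof.
move=> Aaff; rewrite /derivable; set q1 := fun h => _; set q2 := fun h => _.
suff -> : q2 = q1 by [].
by apply/funext => h; rewrite /q1 /q2 /= Aaff.
Qed.

Lemma linehol_affine (E E' : normedModType C) (A : E -> E') (L : E -> E')
    (W : set E) (W' : set E') (g : E' -> C) :
  (forall x, {for x, continuous A}) ->
  (forall (h : C) v x, A (h *: v + x) = h *: L v + A x) ->
  (forall x, W x -> W' (A x)) -> linehol W' g -> linehol W (g \o A).
Proof.
move=> Ac Aaff WW' gh x Wx; have [gc gd] := gh _ (WW' _ Wx); split=> [|v].
  exact: continuous_comp (Ac x) gc.
exact: derivable_affine (fun h => Aaff h v x) (gd (L v)).
Qed.

Lemma derivable_scale (E : normedModType C) (g : E -> C) (x v : E) (k : C) :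
  k != 0 -> derivable g x (k *: v) -> derivable g x v.
Proof.
move=> k0 /derivable1P gd; apply/derivable1P.
rewrite (_ : (fun h : C => _) =
  (fun h : C => g (h *: (k *: v) + x)) \o (fun h : C => k^-1 * h)).
  have aff (h : C) : k^-1 * (h *: (1 : C) + 0) = h *: k^-1 + k^-1 * 0.
    by rewrite addr0 mulr0 addr0 [h *: 1]mulr1 mulrC.
  apply: derivable_affine aff _; rewrite mulr0.
  by apply: diff_derivable; exact/derivable1_diffP.
by apply/funext => h /=; rewrite scalerA mulrAC mulVf // mul1r.
Qed.

(** Differentiation under the circle mean: by the Cauchy formula in the
    parameter, the first-order remainder is bounded uniformly on the circle. *)
Lemma derivable_circ (V : set C) (F : C -> C -> C) : open V ->
  (forall s, nm s = 1 -> V s) ->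
  (forall l s, nm l <= 1 -> V s ->
     {for (l, s), continuous (fun p => F p.1 p.2)} /\
     derivable (fun l => F l s) l 1) ->
  derivable (fun l => circ (F l)) 0 1.
Proof.
move=> Vo SV FV.
have Flc l : nm l <= 1 -> forall s, V s -> {for s, continuous (F l)}.
  move=> l1 s Vs; have [Fc _] := FV _ _ l1 Vs.
  apply: (@continuous_comp _ _ _ (fun s => (l, s)) (fun p => F p.1 p.2)) Fc.
  exact: cont_pair (cont_cst_at (k := l)) cont_id.
have Flcirc l : nm l <= 1 -> continuous_at_circle (F l).
  by move=> l1 s s1; exact: Flc l1 _ (SV _ s1).
have Fd s : V s -> derivable_on_disc (fun l => F l s).
  by move=> Vs l l1; have [] := FV _ _ l1 Vs.
have Fsc s (Vs : V s) := continuous_disc_circle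
  (derivable_continuous_on_disc (Fd s Vs)).
have [M hM] : exists M : R, forall l s, nm l = 1 -> nm s = 1 -> nm (F l s) <= M.
  have [|M hM] := @bounded_on_compact R _ _ (fun p : C * C => F p.1 p.2)
    (compact_setX (@compact_circle R) (@compact_circle R)).
    by move=> [l s] [/= l1 s1]; exact: (FV l s (eq_le1 l1) (SV _ s1)).1.
  by exists M => l s l1 s1; apply: (hM (l, s)).
have M0 : 0 <= M by rewrite (le_trans (nm_ge0 _) (hM 1 1 (nm1 R) (nm1 R))).
pose d s := circ (fun l => F l s / l).
have dc : continuous_at_circle d.
  move=> s s1; have Vs := SV _ s1; apply: continuous_circ => [l l1|].
    have [Fc _] := FV l s (eq_le1 l1) Vs.
    have swap : {for (s, l), continuous (fun p : C * C => (p.2, p.1))}.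
      by apply: cont_pair; [exact: cvg_snd|exact: cvg_fst].
    apply: contM.
      exact: (@continuous_comp _ _ _ (fun p : C * C => (p.2, p.1))
        (fun p => F p.1 p.2)) swap Fc.
    by apply: contV; [rewrite -nm_gt0 l1|exact: cvg_snd].
  have : nbhs s V by exact: open_nbhs_nbhs.
  apply: filterS => s' Vs'; apply: continuous_circleM (Fsc _ Vs') _.
  apply: continuous_circleV; first exact: continuous_circle_id.
  by move=> l l1; rewrite -nm_gt0 l1.
have remainder l : nm l <= 1 / 2 -> nm (circ (F l) - circ (F 0) - circ d * l) <=
    8 * M * nm l ^+ 2.
  move=> l2; have l1 : nm l < 1 by lra.
  have F0c := Flcirc 0 nm0_le1; have Flc' := Flcirc l (ltW l1).
  have ldc := continuous_circleM (continuous_circle_cst l) dc.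
  rewrite [circ d * l]mulrC -(circZ _ dc) -(circB Flc' F0c).
  have Fl0 := continuous_circleB Flc' F0c.
  rewrite -(circB Fl0 ldc).
  have -> : 8 * M * nm l ^+ 2 = 2 * (2 * (2 * M * nm l ^+ 2)) by ring.
  apply: circ_le (continuous_circleB Fl0 ldc) _ => s s1; have Vs := SV _ s1.
  have cauchy w : nm w < 1 -> circ (fun l => F l s * l / (l - w)) = F w s.
    move=> w1; apply: (@cauchy_formula R (fun l => F l s) [::]) => //.
      exact: derivable_continuous_on_disc (Fd _ Vs).
    by move=> z z1 _; exact: Fd.
  rewrite -(cauchy l l1) -(cauchy 0); last by rewrite nm0.
  have Fscl := continuous_circleM (Fsc s Vs) continuous_circle_id.
  have c1 := continuous_circle_div Fscl l1.
  have c2 : continuous_at_circle (fun l => F l s * l / (l - 0)).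
    by apply: continuous_circle_div Fscl _; rewrite nm0.
  have c3 : continuous_at_circle (fun l => F l s / l).
    apply: continuous_circleM (Fsc s Vs) _; apply: continuous_circleV.
      exact: continuous_circle_id.
    by move=> z z1; rewrite -nm_gt0 z1.
  have c4 := continuous_circleM (continuous_circle_cst l) c3.
  rewrite /d -(circB c1 c2) -(circZ _ c3) -(circB (continuous_circleB c1 c2) c4).
  apply: circ_le (continuous_circleB (continuous_circleB c1 c2) c4) _ => z z1.
  have z0 : z != 0 by rewrite -nm_gt0 z1.
  have zl := circle_neq z1 l1.
  have -> : F z s * z / (z - l) - F z s * z / (z - 0) - l * (F z s / z) =
      F z s * l ^+ 2 * (z - l)^-1 * z^-1.
    by rewrite subr0; field; rewrite z0 zl.
  rewrite 3!nmM nmX !nmV z1 invr1 mulr1 mulrC.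
  have -> : 2 * M * nm l ^+ 2 = 2 * (M * nm l ^+ 2) by ring.
  apply: ler_pM; rewrite ?invr_ge0 ?mulr_ge0 ?exprn_ge0 ?nm_ge0 //.
    have zl2 : 1 / 2 <= nm (z - l) by apply: le_trans (nm_lerB _ _); lra.
    rewrite -[leRHS]invrK lef_pV2 ?posrE ?nm_gt0 // ?invr_gt0 //; lra.
  by rewrite ler_wpM2r ?exprn_ge0 ?nm_ge0 // hM.
apply/derivableC_P; exists (circ d) => e e0.
have M1 : 0 < 8 * M + 1 by lra.
exists (Num.min (1 / 2) (e / (8 * M + 1))) => [|h].
  by rewrite lt_min !divr_gt0.
rewrite lt_min add0r => /andP[h2 he]; apply: le_trans (remainder _ (ltW h2)) _.
rewrite expr2 mulrA ler_wpM2r ?nm_ge0 //.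
apply: le_trans (_ : (8 * M + 1) * nm h <= e).
  by rewrite ler_wpM2r ?nm_ge0 //; lra.
by rewrite mulrC -ler_pdivlMr // ltW.
Qed.

(** A sufficiently short segment in the direction [v] stays in [U], which reduces
    directional derivability to [derivable_circ]. *)
Lemma linehol_circ (E : normedModType C) (U : set E) (V : set C)
    (F : E * C -> C) : open U -> open V -> (forall s, nm s = 1 -> V s) ->
  linehol (U `*` V) F -> linehol U (fun y => circ (fun s => F (y, s))).
Proof.
move=> Uo Vo SV Fh y Uy.
have Fsc y' s : U y' -> V s -> {for s, continuous (fun s => F (y', s))}.
  move=> Uy' Vs; have [Fc _] := Fh (y', s) (conj Uy' Vs).
  apply: (@continuous_comp _ _ _ (fun s => (y', s)) F) Fc.
  exact: cont_pair (cont_cst_at (k := y')) cont_id.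
split=> [|v].
  apply: (@continuous_circ _ _ (fun y s => F (y, s))) => [s s1|].
    have [Fc _] := Fh (y, s) (conj Uy (SV _ s1)).
    by rewrite (_ : (fun p => _) = F) //; apply/funext => -[].
  have : nbhs y U by exact: open_nbhs_nbhs.
  by apply: filterS => y' Uy' s s1; exact: Fsc Uy' (SV _ s1).
have [k [k0 kU]] : exists k : C, k != 0 /\
    forall l : C, nm l <= 1 -> U (l *: (k *: v) + y).
  have cl : {for 0, continuous (fun l : C => l *: v + y)}.
    exact: cont_line cont_id.
  have Uy0 : nbhs ((0 : C) *: v + y) U.
    by rewrite scale0r add0r; exact: open_nbhs_nbhs.
  have /nbhsC_P[r r0 hr] := cl _ Uy0.
  exists (r / 2)%:C; split; first by rewrite -nm_gt0 nm_real gtr0_norm divr_gt0.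
  move=> l l1; rewrite scalerA; apply: hr; rewrite subr0 nmM nm_real.
  rewrite gtr0_norm ?divr_gt0 //; apply: (@le_lt_trans _ _ (1 * (r / 2))); last by lra.
  by rewrite ler_wpM2r // divr_ge0 // ltW.
apply: derivable_scale k0 _; move: (k *: v) kU => w wU.
apply/derivable1P.
apply: (@derivable_circ V (fun l s => F (l *: w + y, s))) => // l s l1 Vs.
have [Fc Fd] := Fh (l *: w + y, s) (conj (wU _ l1) Vs); split.
  apply: (@continuous_comp _ _ _ (fun p : C * C => (p.1 *: w + y, p.2)) F).
    apply: cont_pair; last exact: cvg_snd.
    by apply: cont_line; exact: cvg_fst.
  exact: Fc.
have aff (h : C) : ((h *: (1 : C) + l) *: w + y, s) =
    h *: ((w, 0) : E * C) + (l *: w + y, s).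
  rewrite -[RHS]/(h *: w + (l *: w + y), h *: 0 + s) scaler0 add0r.
  by rewrite [h *: 1]mulr1 scalerDl addrA.
exact: (@derivable_affine _ _ (fun l : C => (l *: w + y, s)) F l 1 (w, 0) aff (Fd _)).
Qed.

End LineHolomorphic.

(** * Residue pairings and Hankel determinants *)

Section Residues.
Variable R : realType.
Local Notation C := (R[i]).
Implicit Types (a : seq C) (b r : {poly C}) (h u q f g : C -> C) (z w s : C).

Lemma circ_sum n (F : 'I_n -> C -> C) :
  (forall i, continuous_at_circle (F i)) ->
  continuous_at_circle (fun s => \sum_i F i s) /\
  circ (fun s => \sum_i F i s) = \sum_i circ (F i).
Proof.
elim: n F => [|n IHn] F Fc.
  have e s : 0 = \sum_(i < 0) F i s by rewrite big_ord0.
  split; last by rewrite big_ord0 -[RHS](circ_cst (0 : C)); apply: eq_circ => s _.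
  by rewrite (_ : (fun s => _) = fun=> 0); [exact: continuous_circle_cst|apply/funext].
have [Sc SE] := IHn (fun i => F (lift ord0 i)) (fun i => Fc _).
have e : (fun s => \sum_i F i s) =
    fun s => F ord0 s + \sum_(i < n) F (lift ord0 i) s.
  by apply/funext => s; rewrite big_ord_recl.
rewrite e big_ord_recl -SE; split; last exact: circD (Fc ord0) Sc.
by move=> s s1; exact: contD (Fc _ _ s1) (Sc _ s1).
Qed.

Lemma derivable_poly b z : derivable (fun z => b.[z]) z 1.
Proof.
rewrite (_ : (fun z => _) = fun z => \sum_(i < size b) b`_i * z ^+ i).
  apply: der_sum => i _; apply: derM; first exact: der_cst.
  by apply: derX; exact: der_id.
by apply/funext => y; rewrite horner_coef.
Qed.

Lemma derivable_disc_poly b : derivable_on_disc (fun z => b.[z]).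
Proof. by move=> z _; exact: derivable_poly. Qed.
Arguments derivable_disc_poly : clear implicits.

Lemma derivable_discM f g : derivable_on_disc f -> derivable_on_disc g ->
  derivable_on_disc (fun z => f z * g z).
Proof. by move=> fd gd z z1; exact: derM (fd _ z1) (gd _ z1). Qed.

Lemma derivable_discV f : derivable_on_disc f ->
  (forall z, nm z <= 1 -> f z != 0) -> derivable_on_disc (fun z => (f z)^-1).
Proof. by move=> fd f0 z z1; exact: derV (f0 _ z1) (fd _ z1). Qed.

Lemma derivable_disc_cst (k : C) : derivable_on_disc (fun=> k).
Proof. by move=> z z1; exact: der_cst. Qed.
Arguments derivable_disc_cst : clear implicits.

Lemma derivable_disc_exp n : derivable_on_disc (fun z => z ^+ n).
Proof. by move=> z _; exact: derX der_id. Qed.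
Arguments derivable_disc_exp : clear implicits.

Definition rootpoly a : {poly C} := \prod_(w <- a) ('X - w%:P).

Lemma rootpoly_horner a z : (rootpoly a).[z] = \prod_(w <- a) (z - w).
Proof. by rewrite horner_prod; apply: eq_bigr => w _; rewrite hornerXsubC. Qed.

Lemma size_rootpoly a : size (rootpoly a) = (size a).+1.
Proof. exact: size_prod_XsubC. Qed.

Lemma rootpoly_neq0 a : rootpoly a != 0.
Proof. by rewrite -size_poly_eq0 size_rootpoly. Qed.

Definition in_disc a := all (fun w : C => nm w < 1) a.

Lemma rootpoly_circle a s : in_disc a -> nm s = 1 -> (rootpoly a).[s] != 0.
Proof.
move=> /allP a1 s1; rewrite rootpoly_horner prodf_seq_neq0.
by apply/allP => w /a1 w1; apply/implyP => _; exact: circle_neq.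
Qed.

Lemma circ_holomorphic g : derivable_on_disc g -> circ g = g 0.
Proof.
move=> gd; apply: (circ_mean (S := [::])) => [|z z1 _]; last exact: gd.
exact: derivable_continuous_on_disc.
Qed.

(** After multiplication by the power of [s] complementary to the degree of [r],
    only the leading coefficient of [r] survives in the mean, by
    [circ_monic]. *)
Lemma poly_moment r a : in_disc a -> r != 0 -> (size r <= size a)%N ->
  exists2 i : nat, (i < size a)%N &
    circ (fun s => r.[s] / (rootpoly a).[s] * s ^+ i.+1) != 0.
Proof.
move=> a1 r0 ra; have sr0 : (0 < size r)%N by rewrite size_poly_gt0.
pose d := (size r).-1; have rd : size r = d.+1 by rewrite prednK.
rewrite rd in ra.
exists (size a - d.+1)%N; first by rewrite ltn_subrL (leq_ltn_trans _ ra).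
pose F (k : 'I_(size r)) s := r`_k *
  (s ^+ size a / \prod_(w <- a) (s - w) / s ^+ (d - k)).
have kc (k : nat) : continuous_at_circle
    (fun s => s ^+ size a / \prod_(w <- a) (s - w) / s ^+ k).
  apply: continuous_circleM.
    apply: continuous_circleM; first exact: continuous_disc_circle
      (derivable_continuous_on_disc (derivable_disc_exp _)).
    apply: (@continuous_circleV _ (fun s => \prod_(w <- a) (s - w))).
      rewrite (_ : (fun s => _) = fun s => (rootpoly a).[s]).
        exact: continuous_disc_circle
          (derivable_continuous_on_disc (derivable_disc_poly _)).
      by apply/funext => s; rewrite rootpoly_horner.
    by move=> s s1; rewrite -rootpoly_horner; exact: rootpoly_circle.
  apply: (@continuous_circleV _ (fun s => s ^+ k)).
    exact: continuous_disc_circle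
      (derivable_continuous_on_disc (derivable_disc_exp _)).
  by move=> s s1; rewrite expf_neq0 // -nm_gt0 s1.
have Fc k : continuous_at_circle (F k).
  exact: continuous_circleM (continuous_circle_cst r`_k) (kc _).
rewrite (@eq_circ _ _ (fun s => \sum_k F k s)).
  rewrite (circ_sum Fc).2.
  rewrite (eq_bigr (fun k : 'I_(size r) => r`_k * ((d - k)%N == 0%N)%:R)).
    have dr : (d < size r)%N by rewrite rd.
    rewrite (bigD1 (Ordinal dr)) //= subnn mulr1 big1 => [|k kd].
      by rewrite addr0 /d -/(lead_coef r) lead_coef_eq0.
    have : (k < d)%N.
      rewrite ltn_neqAle -(inj_eq val_inj) in kd *; rewrite kd /=.
      by have := ltn_ord k; rewrite {2}rd.
    by rewrite -subn_gt0 => /gtn_eqF; rewrite eq_sym => ->; rewrite mulr0.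
  by move=> k _; rewrite (circZ _ (kc _)) circ_monic.
move=> s s1; have s0 : s != 0 by rewrite -nm_gt0 s1.
rewrite horner_coef -mulrA mulr_suml; apply: eq_bigr => k _.
rewrite /F -mulrA; congr (_ * _); rewrite -rootpoly_horner.
have kd : (k <= d)%N by have := ltn_ord k; rewrite {2}rd.
rewrite [s ^+ size a / _]mulrC [LHS]mulrCA -mulrA; congr (_ * _).
have -> : s ^+ size a = s ^+ k * s ^+ (size a - d.+1).+1 * s ^+ (d - k).
  by rewrite -!exprD addnAC subnKC // addnS -addSn subnKC.
by rewrite mulfK ?expf_neq0.
Qed.

Lemma size_XsubC_mul w r : r != 0 -> size (('X - w%:P) * r) = (size r).+1.
Proof.
by move=> r0; rewrite size_monicM ?monicXsubC // size_XsubC.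
Qed.

(** Newton interpolation: the roots are divided out one at a time, and the values
    subtracted before each division make up the remainder. *)
Lemma newton_division g a : derivable_on_disc g -> in_disc a ->
  exists r q, [/\ derivable_on_disc q, (size r <= size a)%N &
    forall z, g z = r.[z] + (rootpoly a).[z] * q z].
Proof.
elim: a g => [|w a IHa] g gd.
  exists 0, g; split=> //; first by rewrite size_poly0.
  by move=> z; rewrite /rootpoly big_nil !hornerE.
move=> /andP[w1 a1].
have gwd : derivable_on_disc (fun z => g z - g w).
  by move=> z z1; exact: derB (gd _ z1) (der_cst (g w)).
have [||g1 g1d g1E] := @divide_zero R _ w gwd => //; first by rewrite subrr.
have [r [q [qd ra qE]]] := IHa g1 g1d a1.
exists ((g w)%:P + ('X - w%:P) * r), q; split=> //.
  rewrite (leq_trans (size_polyD _ _)) // geq_max.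
  rewrite (leq_trans (size_polyC_leq1 _)) //=.
  have [->|r0] := eqVneq r 0; first by rewrite mulr0 size_poly0.
  by rewrite size_XsubC_mul.
move=> z; rewrite -[LHS](subrK (g w)) g1E qE /rootpoly big_cons !hornerE.
by ring.
Qed.

(** Nondegeneracy of the residue pairing.  Common roots of [b] and [rootpoly a]
    cancel; without them, [h * b / u] is congruent modulo [rootpoly a] to a
    nonzero polynomial, and a holomorphic multiple of [rootpoly a] does not
    contribute to the mean. *)
Lemma moment_neq0 a u h b : in_disc a -> derivable_on_disc u ->
  (forall z, nm z <= 1 -> u z != 0) -> derivable_on_disc h ->
  (forall w, w \in a -> h w != 0) -> b != 0 -> (size b <= size a)%N ->
  exists2 i : nat, (i < size a)%N &
    circ (fun s => h s / ((rootpoly a).[s] * u s) * b.[s] * s ^+ i.+1) != 0.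
Proof.
move: {2}(size a) (leqnn (size a)) => n; elim: n a b => [|n IHn] a b.
  move=> sa a1 ud u0 hd ha b0 ba; exfalso; move: b0.
  by rewrite -size_poly_leq0 (leq_trans ba sa).
move=> sa a1 ud u0 hd ha b0 ba.
have [/hasP[w wa bw]|noroot] := boolP (has (root b) a).
  have [b1 bE] := factor_theorem _ _ bw; rewrite mulrC in bE.
  have {}bE : b = ('X - w%:P) * b1 by [].
  have b10 : b1 != 0 by apply: contraNneq b0 => b1E; rewrite bE b1E mulr0.
  have sr := size_rem wa; have a0 : (0 < size a)%N by case: (a) wa.
  have [||||i ir iE] := IHn (rem w a) b1 _ _ ud u0 hd _ b10.
  - by rewrite sr -ltnS prednK.
  - by apply/allP => v /mem_rem /(allP a1).
  - by move=> v /mem_rem; exact: ha.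
  - by rewrite sr -ltnS prednK // (leq_trans _ ba) // bE size_XsubC_mul.
  exists i; first by rewrite (leq_trans ir) // sr leq_pred.
  rewrite (eq_circ (g := fun s => h s / ((rootpoly (rem w a)).[s] * u s) *
    b1.[s] * s ^+ i.+1)) // => s s1; congr (_ * _).
  have sw := circle_neq s1 (allP a1 _ wa).
  rewrite bE /rootpoly (perm_big _ (perm_to_rem wa)) big_cons !hornerE /=.
  have ra1 : in_disc (rem w a) by apply/allP => v /mem_rem /(allP a1).
  have r0 := rootpoly_circle ra1 s1; rewrite /rootpoly in r0.
  by field; rewrite u0 ?s1 // r0 sw.
pose g z := h z * b.[z] / u z.
have gd : derivable_on_disc g.
  apply: derivable_discM; last exact: derivable_discV.
  exact: derivable_discM hd (derivable_disc_poly b).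
have [r [q [qd ra gE]]] := newton_division gd a1.
have r0 : r != 0.
  have [w wa] : exists w, w \in a.
    case: (a) ba => [|w l]; last by exists w; rewrite mem_head.
    by rewrite leqn0 size_poly_eq0 (negbTE b0).
  apply: contraTneq (ha w wa) => r0; have := gE w.
  rewrite r0 !hornerE rootpoly_horner (big_rem w wa) /= subrr !mul0r /g.
  have uw : u w != 0 by rewrite u0 // ltW // (allP a1).
  move/eqP; rewrite !mulf_eq0 invr_eq0 (negbTE uw) orbF => /orP[->//|bw].
  by case/negP: noroot; apply/hasP; exists w.
have [i ia iE] := poly_moment a1 r0 ra; exists i => //.
have qc := derivable_discM qd (derivable_disc_exp i.+1).
have q0 : circ (fun s => q s * s ^+ i.+1) = 0.
  by rewrite (circ_holomorphic qc) expr0n mulr0.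
have qcc := continuous_disc_circle (derivable_continuous_on_disc qc).
have rc : continuous_at_circle (fun s => r.[s] / (rootpoly a).[s] * s ^+ i.+1).
  have pc := continuous_disc_circle (derivable_continuous_on_disc
    (derivable_disc_poly _)).
  apply: continuous_circleM (continuous_disc_circle (derivable_continuous_on_disc
    (derivable_disc_exp _))).
  apply: continuous_circleM (pc _) _; apply: continuous_circleV (pc _) _ => s.
  exact: rootpoly_circle.
rewrite (eq_circ (g := fun s => r.[s] / (rootpoly a).[s] * s ^+ i.+1 +
   q s * s ^+ i.+1)); first by rewrite (circD rc qcc) q0 addr0.
move=> s s1; rewrite -mulrDl; congr (_ * _).
have rs := rootpoly_circle a1 s1; have us : u s != 0 by rewrite u0 ?s1.
have -> : h s / ((rootpoly a).[s] * u s) * b.[s] = g s / (rootpoly a).[s].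
  by rewrite /g; field; rewrite us rs.
by rewrite gE; field.
Qed.

(** The Gram matrix of the residue pairing [(p, q) -> res (phi p q)] on
    polynomials of degree less than [n]. *)
Definition hankel n (phi : C -> C) : 'M[C]_n :=
  \matrix_(i, j) circ (fun s => phi s * s ^+ (i + j).+1).

Lemma hankel_singular n (phi : C -> C) : continuous_at_circle phi ->
  \det (hankel n phi) = 0 <->
  exists b, [/\ b != 0, (size b <= n)%N & forall i, (i < n)%N ->
    circ (fun s => phi s * b.[s] * s ^+ i.+1) = 0].
Proof.
move=> phic.
have ec (k : nat) := continuous_circleM phic (continuous_disc_circle
  (derivable_continuous_on_disc (derivable_disc_exp k))).
have mulE b (i : 'I_n) : (size b <= n)%N ->
    (poly_rV b *m hankel n phi) 0 i = circ (fun s => phi s * b.[s] * s ^+ i.+1).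
  move=> bn; rewrite mxE.
  rewrite (@eq_circ _ _ (fun s => \sum_(j < n) b`_j * (phi s * s ^+ (j + i).+1))).
    rewrite (circ_sum (fun j => continuous_circleM (continuous_circle_cst b`_j)
      (ec (j + i).+1))).2.
    by apply: eq_bigr => j _; rewrite !mxE (circZ _ (ec _)).
  move=> s _; rewrite (horner_coef_wide _ bn) mulr_sumr mulr_suml.
  by apply: eq_bigr => j _; rewrite -addnS exprD; ring.
split=> [/eqP/det0P[v v0 vH]|[b [b0 bn bE]]].
  exists (rVpoly v); split.
  - by apply: contraNneq v0 => e; rewrite -[v]rVpolyK e linear0.
  - exact: size_poly.
  move=> i ni; rewrite -(mulE _ (Ordinal ni)) ?size_poly // rVpolyK vH.
  by rewrite mxE.
apply/eqP/det0P; exists (poly_rV b).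
  by apply: contraNneq b0 => e; rewrite -(poly_rV_K bn) e linear0.
by apply/rowP => i; rewrite (mulE b i bn) bE // mxE.
Qed.

Section Factored.
Variables (a : seq C) (u f : C -> C).
Hypotheses (a1 : in_disc a) (ud : derivable_on_disc u)
  (u0 : forall z, nm z <= 1 -> u z != 0)
  (fE : forall z, f z = (rootpoly a).[z] * u z).

Lemma continuous_circle_quotient h : derivable_on_disc h ->
  continuous_at_circle (fun s => h s / f s).
Proof.
move=> hd; have fd : derivable_on_disc f.
  rewrite (_ : f = fun z => (rootpoly a).[z] * u z); last exact/funext.
  exact: derivable_discM (derivable_disc_poly _) ud.
apply: continuous_circleM.
  exact: continuous_disc_circle (derivable_continuous_on_disc hd).
apply: continuous_circleV => [|s s1].
  exact: continuous_disc_circle (derivable_continuous_on_disc fd).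
by rewrite fE mulf_neq0 ?rootpoly_circle // u0 ?s1.
Qed.

(** If [h] has a zero [w] among the roots, dividing [rootpoly a] by [z - w] gives
    an element of the kernel of the pairing weighted by [h]; the converse is
    [moment_neq0]. *)
Lemma hankel_common_zero h : derivable_on_disc h ->
  \det (hankel (size a) (fun s => h s / f s)) = 0 <->
  exists2 w, w \in a & h w = 0.
Proof.
move=> hd; have hc := continuous_circle_quotient hd.
rewrite (hankel_singular _ hc); split=> [[b [b0 ba bE]]|[w wa hw]].
  have [/hasP[w wa /eqP hw]|noz] := boolP (has (fun w => h w == 0) a).
    by exists w.
  have ha w : w \in a -> h w != 0.
    by move=> wa; apply: contraNneq noz => hw; apply/hasP; exists w; rewrite ?hw.
  have [i ia /eqP[]] := moment_neq0 a1 ud u0 hd ha b0 ba.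
  by rewrite -[RHS](bE i ia); apply: eq_circ => s _; rewrite fE.
have w1 := allP a1 _ wa; have [h1 h1d h1E] := divide_zero hd w1 hw.
have a0 : (0 < size a)%N by case: (a) wa.
exists (rootpoly (rem w a)); split; first exact: rootpoly_neq0.
  by rewrite size_rootpoly size_rem // prednK.
move=> i ia; pose g s := h1 s / u s * s ^+ i.+1.
have gd : derivable_on_disc g.
  apply: derivable_discM (derivable_disc_exp _).
  exact: derivable_discM h1d (derivable_discV ud u0).
rewrite (eq_circ (g := g)) => [|s s1].
  by rewrite (circ_holomorphic gd) /g expr0n mulr0.
have sw := circle_neq s1 w1; rewrite /g fE h1E; congr (_ * _).
rewrite /rootpoly (perm_big _ (perm_to_rem wa)) big_cons !hornerE /=.
have ra1 : in_disc (rem w a) by apply/allP => v /mem_rem /(allP a1).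
have r0 := rootpoly_circle ra1 s1; rewrite /rootpoly in r0.
by field; rewrite u0 ?s1 // r0 sw.
Qed.

(** The polynomial [rootpoly a] itself is in the kernel of the pairing. *)
Lemma hankel_too_large n : (size a < n)%N ->
  \det (hankel n (fun s => 1 / f s)) = 0.
Proof.
move=> an; have c1 := derivable_disc_cst 1.
apply/(hankel_singular _ (continuous_circle_quotient c1)).
exists (rootpoly a); rewrite rootpoly_neq0 size_rootpoly; split=> // i _.
pose g s := (u s)^-1 * s ^+ i.+1.
have gd : derivable_on_disc g.
  exact: derivable_discM (derivable_discV ud u0) (derivable_disc_exp _).
rewrite (eq_circ (g := g)) => [|s s1].
  by rewrite (circ_holomorphic gd) /g expr0n mulr0.
rewrite /g fE; congr (_ * _); have r0 := rootpoly_circle a1 s1.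
by field; rewrite u0 ?s1 // r0.
Qed.

End Factored.
End Residues.
Arguments derivable_disc_poly {R} b.
Arguments derivable_disc_cst {R} k.
Arguments derivable_disc_exp {R} n.

(** * Elimination of one variable *)

Section Weierstrass.
Variable R : realType.
Local Notation C := (R[i]).
Implicit Types (a : seq C) (g u : C -> C) (z w s : C).

(** Differentiation under the circle mean requires an open neighbourhood of the
    circle, and [disc2] leaves room for it. *)
Definition disc2 : set C := [set s | nm s < 2].
Definition thick_circle : set C := [set s | 1 / 2 < nm s < 3 / 2].

Lemma open_thick_circle : open thick_circle.
Proof.
rewrite openE => z /= /andP[z1 z2]; apply/nbhsC_P.
exists (Num.min (nm z - 1 / 2) (3 / 2 - nm z)).
  by rewrite lt_min !subr_gt0 z1.
move=> w; rewrite lt_min => /andP[h1 h2].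
have := nm_lerB z w; rewrite nm_sub => h3; have := nm_lerB w z => h4.
by apply/andP; split; lra.
Qed.

Lemma circle_thick s : nm s = 1 -> thick_circle s.
Proof. by move=> s1; rewrite /thick_circle /= s1; apply/andP; split; lra. Qed.

Lemma thick_disc2 : thick_circle `<=` disc2.
Proof. by move=> s /andP[_ h]; rewrite /disc2 /=; lra. Qed.

Lemma disc_disc2 s : nm s <= 1 -> disc2 s.
Proof. by move=> s1; rewrite /disc2 /=; lra. Qed.

Lemma compact_annulus (r1 r2 : R) : compact [set z : C | r1 <= nm z <= r2].
Proof.
apply: (subclosed_compact _ (@compact_disc R r2)); last by move=> z /= /andP[].
rewrite (_ : mkset _ = (fun z : C => nm z) @^-1` [set x | r1 <= x] `&`
   (fun z : C => nm z) @^-1` [set x | x <= r2]).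
  apply: closedI; apply: closed_comp; [|exact: closed_ge| |exact: closed_le];
    by move=> z _; apply: continuous_nm; exact: cont_id.
by apply/seteqP; split => z /=; [move=> /andP[]|case=> -> ->].
Qed.

Lemma near_open (T : topologicalType) (x : T) (P : T -> Prop) :
  (\forall y \near x, P y) -> exists U, [/\ open U, U x & forall y, U y -> P y].
Proof.
move=> xP; exists (interior P).
by split; [exact: open_interior|exact: xP|exact: interior_subset].
Qed.

Section Slices.
Variable E : normedModType C.

Lemma linehol_derivable (V : set C) g z : linehol V g -> V z -> derivable g z 1.
Proof. by move=> gh /gh[_]. Qed.

Lemma linehol_slice (W : set (E * C)) (F : E * C -> C) y :
  linehol W F -> linehol [set s | W (y, s)] (fun s => F (y, s)).
Proof.
move=> Fh; apply: (@linehol_affine _ _ _ (fun s : C => (y, s))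
  (fun s : C => (0, s)) _ W F) => //.
  by move=> s; exact: cont_pair (cont_cst_at (k := y)) cont_id.
by move=> h v x; rewrite -[RHS]/(h *: 0 + y, h *: v + x) scaler0 add0r.
Qed.

Lemma linehol_slice_disc (U : set E) (F : E * C -> C) y :
  linehol (U `*` disc2) F -> U y -> derivable_on_disc (fun s => F (y, s)).
Proof.
move=> Fh Uy z z1; apply: linehol_derivable (linehol_slice (y := y) Fh) _.
by split=> //; exact: disc_disc2.
Qed.

Lemma linehol_snd (W : set (E * C)) : linehol W snd.
Proof.
move=> x _; split=> [|v]; first exact: cvg_snd.
apply: (derivable_affine (A := @snd E C) (g := fun s : C => s) (w := v.2)).
  by [].
exact: derivable_id.
Qed.

Lemma linehol_hankel (U : set E) (f h : E * C -> C) n : open U ->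
  (forall y s, U y -> thick_circle s -> f (y, s) != 0) ->
  linehol (U `*` disc2) f -> linehol (U `*` disc2) h ->
  linehol U (fun y => \det (hankel n (fun s => h (y, s) / f (y, s)))).
Proof.
move=> Uo f0 fh hh; apply: linehol_det => i j.
rewrite (_ : (fun y => _) = fun y => circ (fun s =>
    (fun p : E * C => h p / f p * p.2 ^+ (i + j).+1) (y, s))); last first.
  by apply/funext => y; rewrite mxE.
apply: (@linehol_circ R E U thick_circle (fun p : E * C =>
  h p / f p * p.2 ^+ (i + j).+1) Uo open_thick_circle circle_thick).
have sub : U `*` thick_circle `<=` U `*` disc2.
  by move=> p [p1 p2]; split=> //; exact: thick_disc2.
apply: linehol_mul; last exact: linehol_exp (@linehol_snd _).
apply: linehol_mul; first exact: linehol_sub sub hh.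
apply: linehol_inv; first exact: linehol_sub sub fh.
by move=> [y s] [/= Uy Vs]; exact: f0.
Qed.

End Slices.

Lemma nm_rootpoly_le a z (B : R) : (forall w, w \in a -> nm (z - w) <= B) ->
  nm (rootpoly a).[z] <= B ^+ size a.
Proof.
rewrite rootpoly_horner; elim: a => [|w a IHa] aB.
  by rewrite big_nil nm1 expr0.
rewrite big_cons nmM exprS ler_pM ?nm_ge0 ?aB ?mem_head //.
by apply: IHa => v va; apply: aB; rewrite inE va orbT.
Qed.

Lemma nm_rootpoly_ge a z (B : R) : 0 <= B ->
  (forall w, w \in a -> B <= nm (z - w)) -> B ^+ size a <= nm (rootpoly a).[z].
Proof.
move=> B0; rewrite rootpoly_horner; elim: a => [|w a IHa] aB.
  by rewrite big_nil nm1 expr0.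
rewrite big_cons nmM exprS ler_pM ?exprn_ge0 ?aB ?mem_head //.
by apply: IHa => v va; apply: aB; rewrite inE va orbT.
Qed.

Definition factors g a u := [/\ in_disc a, derivable_on_disc u &
  forall z, g z = (rootpoly a).[z] * u z].

Lemma factors_cons g w a u u' : factors g a u -> nm w < 1 ->
  derivable_on_disc u' -> (forall z, u z = (z - w) * u' z) ->
  factors g (w :: a) u'.
Proof.
move=> [a1 ud gE] w1 u'd uE; split=> //; first by rewrite /in_disc /= w1.
move=> z; rewrite gE uE /rootpoly big_cons hornerM hornerXsubC.
by rewrite mulrCA mulrA.
Qed.

(** As long as the cofactor has a zero, it can be divided out; the bound [N] stops
    this process. *)
Lemma full_factorization g N : derivable_on_disc g ->
  (forall z, nm z = 1 -> g z != 0) ->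
  (forall a u, factors g a u -> (size a <= N)%N) ->
  exists a u, [/\ factors g a u, (size a <= N)%N &
    forall z, nm z <= 1 -> u z != 0].
Proof.
move=> gd g1 gN.
have : forall k, exists a u, factors g a u /\
    ((forall z, nm z <= 1 -> u z != 0) \/ size a = k).
  elim=> [|k [a [u [fac [u0|ak]]]]].
  - exists [::], g; split; last by right.
    by split=> // z; rewrite /rootpoly big_nil hornerE mul1r.
  - by exists a, u; split=> //; left.
  have [u0|nz] := pselect (forall z, nm z <= 1 -> u z != 0).
    by exists a, u; split=> //; left.
  have [z [z1 uz]] : exists z, nm z <= 1 /\ u z = 0.
    apply: contrapT => noz; apply: nz => z z1; apply/eqP => uz.
    by apply: noz; exists z.
  have [a1 ud gE] := fac.
  have z1' : nm z < 1.
    rewrite lt_neqAle z1 andbT; apply/eqP => /g1.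
    by rewrite gE uz mulr0 eqxx.
  have [u' u'd u'E] := divide_zero ud z1' uz.
  exists (z :: a), u'; split; first exact: factors_cons fac z1' u'd u'E.
  by right; rewrite /= ak.
move=> /(_ N.+1)[a [u [fac [u0|aN]]]].
  by exists a, u; split=> //; exact: gN fac.
by have := gN _ _ fac; rewrite aN ltnn.
Qed.

(** Zeros within [d] of the origin are limited in number by the growth of the
    function: each contributes a factor at most [2 d] at the point [d]. *)
Lemma factors_bound g a u (M d : R) n : factors g a u -> 0 < d <= 1 / 2 ->
  (forall s, nm s = 1 -> nm (g s) <= M) ->
  (forall w, nm w < 1 -> g w = 0 -> nm w <= d) -> (n <= size a)%N ->
  nm (g d%:C) <= (2 * d) ^+ n * (4 * (M * 2 ^+ n)).
Proof.
move=> [/allP a1 ud gE] /andP[d0 d2] gM gd na.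
have aE : a = take n a ++ drop n a by rewrite cat_take_drop.
have ad w : w \in a -> nm w <= d.
  move=> wa; apply: gd (a1 _ wa) _.
  by rewrite gE rootpoly_horner (big_rem w wa) /= subrr !mul0r.
have sn : size (take n a) = n by rewrite size_takel.
pose v z := (rootpoly (drop n a)).[z] * u z.
have vd : derivable_on_disc v by exact: derivable_discM (derivable_disc_poly _) ud.
have gE' z : g z = (rootpoly (take n a)).[z] * v z.
  by rewrite gE {1}aE /rootpoly big_cat hornerM /v /rootpoly mulrA.
have vM s : nm s = 1 -> nm (v s) <= M * 2 ^+ n.
  move=> s1; have low : (1 / 2) ^+ n <= nm (rootpoly (take n a)).[s].
    rewrite -[X in _ ^+ X]sn; apply: nm_rootpoly_ge => [|w /mem_take wa]; first by lra.
    by have := ad _ wa; have := nm_lerB s w; rewrite s1; lra.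
  have := gM _ s1; rewrite gE' nmM => gM'.
  have p2 : 0 < 2 ^+ n :> R by rewrite exprn_gt0.
  have : (1 / 2) ^+ n * nm (v s) <= M.
    by apply: le_trans gM'; rewrite ler_wpM2r ?nm_ge0.
  by rewrite expr_div_n expr1n mul1r mulrC ler_pdivrMr.
have dC : nm d%:C = d by rewrite nm_real gtr0_norm.
rewrite gE' nmM; apply: ler_pM; rewrite ?nm_ge0 //.
  rewrite -[X in _ <= _ ^+ X]sn; apply: nm_rootpoly_le => w /mem_take wa.
  by have := ad _ wa; have := nmB d%:C w; rewrite dC; lra.
have d1 : nm d%:C < 1 by rewrite dC; lra.
apply: le_trans (cauchy_bound vd d1 vM) _; rewrite dC ler_pdivrMr; last by lra.
have M0 : 0 <= M * 2 ^+ n by apply: le_trans (nm_ge0 _) (vM 1 (nm1 R)).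
have : 0 <= (M * 2 ^+ n) * (1 / 2 - d) by rewrite mulr_ge0 // subr_ge0.
lra.
Qed.

(** Weierstrass preparation without coefficients: near [y0] the number of zeros
    of [f (y, _)] in the unit disc, with multiplicity, is constant.  The growth
    estimate bounds it above, and the nondegeneracy of the residue pairing,
    which is an open condition, bounds it below. *)
Lemma weierstrass_factorization (E : normedModType C) (U0 : set E)
    (f : E * C -> C) (y0 : E) :
  open U0 -> U0 y0 -> linehol (U0 `*` disc2) f ->
  (forall s, 0 < nm s < 2 -> f (y0, s) != 0) ->
  exists U n, [/\ open U, U y0, U `<=` U0 & forall y, U y ->
    (forall s, 1 / 2 <= nm s <= 3 / 2 -> f (y, s) != 0) /\
    exists a u, [/\ factors (fun s => f (y, s)) a u, size a = n &
      forall z, nm z <= 1 -> u z != 0]].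
Proof.
move=> U0o U0y0 fh f0; have fd y := linehol_slice_disc (y := y) fh.
have half : nm ((1 / 2)%:C : C) = 1 / 2 by rewrite nm_real gtr0_norm.
have half1 : nm ((1 / 2)%:C : C) < 1 by rewrite half; lra.
have half2 : 0 < nm ((1 / 2)%:C : C) < 2 by rewrite half; apply/andP; split; lra.
have [n [g [gd g0 gE]]] := order_at_zero (fd _ U0y0) half1 (f0 _ half2).
have gn0 z : nm z <= 1 -> g z != 0.
  have [->//|z0 z1] := eqVneq z 0.
  have : f (y0, z) != 0 by apply: f0; rewrite nm_gt0 z0; lra.
  by rewrite gE mulf_eq0 negb_or => /andP[].
have fcont s : nm s < 2 -> {for (y0, s), continuous f}.
  by move=> s2; have [] := fh (y0, s) (conj U0y0 s2).
have near0 (K : set C) : compact K -> (forall s, K s -> 0 < nm s < 2) ->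
    \forall y \near y0, forall s, K s -> f (y, s) != 0.
  move=> cK K2; apply: (near_compact (P := fun y s => f (y, s) != 0) cK) => s Ks.
  have /andP[s0 s2] := K2 _ Ks.
  have fs : 0 < nm (f (y0, s)) by rewrite nm_gt0 f0 // s0.
  have /cont_ltP /(_ _ fs) := fcont _ s2; apply: filterS => -[y t] /=.
  by apply: contraTneq => ->; rewrite subr0 ltxx.
have nearU0 : \forall y \near y0, U0 y by exact: open_nbhs_nbhs.
have annulus : \forall y \near y0, forall s,
    [set z : C | 1 / 2 <= nm z <= 3 / 2] s -> f (y, s) != 0.
  by apply: near0; [exact: compact_annulus|move=> s /andP[s1 s2]; apply/andP; split; lra].
have upper : \forall y \near y0, forall a u,
    factors (fun s => f (y, s)) a u -> (size a <= n)%N.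
  have fcirc := continuous_disc_circle (derivable_continuous_on_disc (fd _ U0y0)).
  have [M hM] := bounded_on_circle fcirc.
  have M0 : 0 <= M by rewrite (le_trans (nm_ge0 _) (hM 1 (nm1 R))).
  pose c := nm (g 0) / 2; have c0 : 0 < c by rewrite divr_gt0 // nm_gt0.
  have [r r0 hr] : exists2 r : R, 0 < r & forall z, nm z < r -> c < nm (g z).
    have gc : {for 0, continuous g}.
      by apply: derivable_continuousC; apply: gd; rewrite nm0.
    have /cont_ltP /(_ _ c0) /nbhsC_P[r r0 hr] := gc; exists r => // z zr.
    have := hr z; rewrite subr0 => /(_ zr) h; have := nm_lerB (g 0) (g z).
    by move: h; rewrite /c; lra.
  (* The radius [d] is such that the bound of [factors_bound] for [n.+1] zeros is
     smaller than half of [nm (f (y0, d))], which is about [d ^+ n * nm (g 0)]. *)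
  pose K := 2 ^+ n.+1 * (4 * ((M + 1) * 2 ^+ n.+1)).
  have K0 : 0 < K by rewrite !mulr_gt0 ?exprn_gt0 //; lra.
  pose d := Num.min (1 / 2) (Num.min (r / 2) (c / 4 / K)).
  have q0 : 0 < c / 4 / K by apply: divr_gt0 => //; exact: divr_gt0.
  have d0 : 0 < d by rewrite !lt_min q0 !divr_gt0.
  have d2 : d <= 1 / 2 by rewrite !ge_min lexx.
  have dr : d <= r / 2 by rewrite !ge_min lexx !orbT.
  have dK : d <= c / 4 / K by rewrite !ge_min lexx !orbT.
  clearbody d.
  have dC : nm d%:C = d by rewrite nm_real gtr0_norm.
  have n1 : \forall y \near y0, forall s, [set z : C | nm z = 1] s ->
      nm (f (y0, s) - f (y, s)) < 1.
    apply: (near_uniform (F := fun y s => f (y, s)) (@compact_circle R)) => // s s1.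
    rewrite (_ : (fun p => _) = f); last by apply/funext => -[].
    by apply: fcont; rewrite s1; lra.
  have n2 : \forall y \near y0, forall s, [set z : C | d <= nm z <= 3 / 2] s ->
      f (y, s) != 0.
    apply: near0; first exact: compact_annulus.
    by move=> s /andP[s1 s2]; apply/andP; split; lra.
  have n3 : \forall y \near y0, forall s, [set d%:C] s ->
      nm (f (y0, s) - f (y, s)) < d ^+ n * (c / 2).
    apply: (near_uniform (F := fun y s => f (y, s)) (@compact_set1 _ d%:C)).
      move=> s ->; rewrite (_ : (fun p => _) = f); last by apply/funext => -[].
      by apply: fcont; rewrite dC; lra.
    by rewrite mulr_gt0 ?exprn_gt0 // divr_gt0.
  near=> y => a u fac; rewrite leqNgt; apply/negP => na.
  have y1 : forall s, [set z : C | nm z = 1] s -> nm (f (y0, s) - f (y, s)) < 1.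
    by near: y.
  have y2 : forall s, [set z : C | d <= nm z <= 3 / 2] s -> f (y, s) != 0.
    by near: y.
  have y3 : forall s, [set d%:C] s -> nm (f (y0, s) - f (y, s)) < d ^+ n * (c / 2).
    by near: y.
  have yM s : nm s = 1 -> nm (f (y, s)) <= M + 1.
    move=> s1; have := y1 _ s1; have := hM _ s1.
    by have := nm_lerB (f (y, s)) (f (y0, s)); rewrite nm_sub; lra.
  have yd w : nm w < 1 -> f (y, w) = 0 -> nm w <= d.
    move=> w1 fw; rewrite leNgt; apply/negP => dw.
    have dw32 : [set z : C | d <= nm z <= 3 / 2] w by apply/andP; split; lra.
    by have := y2 w dw32; rewrite fw eqxx.
  have := factors_bound fac _ yM yd na; rewrite d0 d2 => /(_ isT).
  have := y3 _ (erefl _); rewrite gE => h3.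
  have gdn : d ^+ n * c < nm (d%:C ^+ n * g d%:C).
    rewrite nmM nmX dC ltr_pM2l ?exprn_gt0 //; apply: hr; rewrite dC; lra.
  have -> : (2 * d) ^+ n.+1 * (4 * ((M + 1) * 2 ^+ n.+1)) = d ^+ n * (d * K).
    by rewrite exprMn /K [d ^+ n.+1]exprS; ring.
  have dKc : d ^+ n * (d * K) <= d ^+ n * (c / 4).
    by rewrite ler_wpM2l ?exprn_ge0 ?(ltW d0) // -ler_pdivlMr.
  have := nm_lerB (d%:C ^+ n * g d%:C) (f (y, d%:C)).
  have dnc : 0 < d ^+ n * c by rewrite mulr_gt0 // exprn_gt0.
  lra.
pose H y := \det (hankel n (fun s => 1 / f (y, s))).
have H0 : H y0 != 0.
  have one := @derivable_disc_cst R 1.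
  have a1 : in_disc (nseq n (0 : C)) by apply/allP => w /nseqP[-> _]; rewrite nm0.
  have fE z : f (y0, z) = (rootpoly (nseq n 0)).[z] * g z.
    by rewrite gE rootpoly_horner big_nseq subr0 iter_mulr_1.
  have := hankel_common_zero a1 gd gn0 fE one; rewrite size_nseq => key.
  by apply/eqP => /key[w _ /eqP]; rewrite oner_eq0.
have [W [Wo Wy0 W0 Wann]] : exists W, [/\ open W, W y0, W `<=` U0 &
    forall y s, W y -> 1 / 2 <= nm s <= 3 / 2 -> f (y, s) != 0].
  have [W [Wo Wy WW]] := near_open (filterI nearU0 annulus).
  by exists W; split=> // [y /WW[]//|y s /WW[_]]; apply.
have Hc : {for y0, continuous H}.
  have one : linehol (W `*` disc2) (fun=> 1 : C) by exact: linehol_cst.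
  have fW : linehol (W `*` disc2) f by apply: linehol_sub fh => p [/W0 ? ?].
  have fWn y s : W y -> thick_circle s -> f (y, s) != 0.
    by move=> Wy /andP[s1 s2]; apply: Wann Wy _; rewrite !ltW.
  by have [] := linehol_hankel n Wo fWn fW one Wy0.
have lower : \forall y \near y0, H y != 0.
  have : 0 < nm (H y0) by rewrite nm_gt0.
  move=> /(((cont_ltP _ _).1 Hc) _); apply: filterS => y.
  by apply: contraTneq => ->; rewrite subr0 ltxx.
have nearW : \forall y \near y0, W y by exact: open_nbhs_nbhs.
have [U [Uo Uy0 UU]] := near_open (filterI nearW (filterI upper lower)).
exists U, n; split=> // [y /UU[/W0]//|y /UU[Wy [yn Hy]]].
split; first by move=> s; exact: Wann.
have yd := fd _ (W0 _ Wy).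
have y1 z : nm z = 1 -> f (y, z) != 0.
  by move=> z1; apply: Wann Wy _; rewrite z1; apply/andP; split; lra.
have [a [u [fac an u0]]] := full_factorization yd y1 yn.
exists a, u; split=> //; apply/eqP; rewrite eqn_leq an leqNgt; apply/negP => na.
have [a1 ud fE] := fac.
by have /eqP := hankel_too_large a1 ud u0 fE na; rewrite (negbTE Hy).
Unshelve. all: by end_near. Qed.

(** Elimination of the last variable.  Since the number [n] of zeros of
    [f (y, _)] in the disc is constant, the Hankel determinant of order [n] of
    [h / f] detects the common zeros of [f (y, _)] and [h (y, _)] for all [y]
    near [y0]. *)
Lemma local_elimination (E : normedModType C) (U0 : set E)
    (f : E * C -> C) (y0 : E) :
  open U0 -> U0 y0 -> linehol (U0 `*` disc2) f ->
  (forall s, 0 < nm s < 2 -> f (y0, s) != 0) ->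
  exists U, [/\ open U, U y0, U `<=` U0,
    forall y, U y -> exists a, forall w, nm w < 1 -> f (y, w) = 0 -> w \in a &
    forall h, linehol (U `*` disc2) h -> exists G, linehol U G /\
      forall y, U y -> G y = 0 <->
        exists w, [/\ nm w < 1, f (y, w) = 0 & h (y, w) = 0]].
Proof.
move=> U0o U0y0 fh f0.
have [U [n [Uo Uy0 UU0 Uf]]] := weierstrass_factorization U0o U0y0 fh f0.
have mem_root y a u w : factors (fun s => f (y, s)) a u ->
    (forall z, nm z <= 1 -> u z != 0) -> nm w < 1 -> f (y, w) = 0 <-> w \in a.
  move=> [a1 ud fE] u0 w1; rewrite fE rootpoly_horner; split=> [/eqP|wa].
    rewrite mulf_eq0 (negbTE (u0 _ (ltW w1))) orbF prodf_seq_eq0.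
    by move=> /hasP[v va /=]; rewrite subr_eq0 => /eqP ->.
  by rewrite (big_rem w wa) /= subrr !mul0r.
exists U; split=> // [y /Uf[_ [a [u [fac _ u0]]]]|h hh].
  by exists a => w w1 /(mem_root _ _ _ _ fac u0 w1).
have fhU : linehol (U `*` disc2) f by apply: linehol_sub fh => p [/UU0 ? ?].
exists (fun y => \det (hankel n (fun s => h (y, s) / f (y, s)))); split.
  apply: (@linehol_hankel _ U f h n Uo _ fhU hh) => y s Uy /andP[s1 s2].
  by apply: (Uf y Uy).1; rewrite !ltW.
move=> y Uy; have [_ [a [u [fac <- u0]]]] := Uf y Uy; have [a1 ud fE] := fac.
have hd := linehol_slice_disc hh Uy.
rewrite (hankel_common_zero a1 ud u0 fE hd); split=> [[w wa hw]|[w [w1 fw hw]]].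
  have w1 := allP a1 _ wa; exists w; split=> //.
  exact/(mem_root _ _ _ _ fac u0 w1).
by exists w => //; exact/(mem_root _ _ _ _ fac u0 w1).
Qed.

End Weierstrass.

(** * Finiteness of compact analytic subsets of affine space *)

Section CompactAnalytic.
Variable R : realType.
Local Notation C := (R[i]).

(** Locally, [X] is an intersection of zero sets of holomorphic functions.  The
    functions are allowed to depend on the point that they separate from [X], so
    that all elements of the ideal of [X] can be used freely. *)
Definition loc_analytic (E : normedModType C) (X : set E) :=
  forall x, X x -> exists U : set E, [/\ open U, U x &
    forall y, U y -> ~ X y -> exists g, [/\ linehol U g,
      (forall z, U z -> X z -> g z = 0) & g y != 0]].

(** A cluster point of the filter of cofinite subsets of [X] is not isolated. *)
Lemma isolated_compact_finite (T : topologicalType) (X : set T) : compact X ->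
  (forall x, X x -> exists U : set T, [/\ open U, U x &
     forall y, U y -> X y -> y = x]) -> finite_set X.
Proof.
move=> Xc iso; apply: contrapT => infX.
pose F : set_system T := [set A | finite_set (X `\` A)].
have FF : ProperFilter F.
  split; first by rewrite /F /= setD0.
  split; rewrite /F /=.
  - by rewrite setDT; exact: finite_set0.
  - by move=> A B /= fA fB; rewrite setDIr finite_setU.
  - by move=> A B AB; apply: sub_finite_set => x [Xx nB]; split=> // /AB.
have FX : F X by rewrite /F /= setDv; exact: finite_set0.
have [x [Xx clx]] := Xc F FF FX; have [U [Uo Ux UX]] := iso _ Xx.
have FX' : F (X `\ x).
  by rewrite /F /= setDD; apply: sub_finite_set (finite_set1 x) => y [].
have [y [[Xy yx] Uy]] := clx _ _ FX' (open_nbhs_nbhs (conj Uo Ux)).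
by apply: yx; exact: UX.
Qed.

Lemma closed_fst (T1 T2 : topologicalType) (A : set T1) :
  closed A -> closed (fst @^-1` A : set (T1 * T2)).
Proof. by move=> Ac; apply: closed_comp Ac => x _; exact: cvg_fst. Qed.

Lemma compact_fiber (E : normedModType C) (X : set (E * C)) y :
  compact X -> compact [set s | X (y, s)].
Proof.
move=> Xc; rewrite (_ : mkset _ = snd @` (X `&` fst @^-1` [set y])).
  apply: continuous_compact.
    by apply: continuous_subspaceT => x; exact: cvg_snd.
  apply: compact_closedI Xc _; apply: closed_fst.
  exact: (accessible_closed_set1 (hausdorff_accessible (@norm_hausdorff _ E))).
by apply/seteqP; split=> [s Xs|_ [[y' s] [/= Xs yy'] <-]];
  [exists (y, s)|rewrite -yy'].
Qed.

Lemma loc_analytic_fiber (E : normedModType C) (X : set (E * C)) y :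
  loc_analytic X -> loc_analytic [set s | X (y, s)].
Proof.
move=> Xa s Xs; have [W [Wo Ws WX]] := Xa _ Xs.
have pc : continuous (fun s : C => (y, s)).
  by move=> t; exact: cont_pair (cont_cst_at (k := y)) cont_id.
exists [set t | W (y, t)]; split=> //.
  by apply: (open_comp _ Wo) => t _; exact: pc.
move=> t Wt Xt; have [g [gh gX gt]] := WX _ Wt Xt.
exists (fun t => g (y, t)); split=> //; first exact: linehol_slice gh.
by move=> t' Wt' Xt'; apply: gX.
Qed.

(** An accumulation point of a locally analytic subset of the plane is interior
    to it by the identity principle. *)
Lemma accumulation_interior (X : set C) (x : C) : loc_analytic X -> X x ->
  (forall e : R, 0 < e -> exists y, [/\ X y, y != x & nm (y - x) < e]) ->
  exists2 r : R, 0 < r & forall y, nm (y - x) < r -> X y.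
Proof.
move=> Xa Xx acc; have [U [Uo Ux UX]] := Xa _ Xx.
have /nbhsC_P[r r0 rU] : nbhs x U by exact: open_nbhs_nbhs.
pose p := r / 2; have p0 : 0 < p by rewrite divr_gt0.
have pC0 : p%:C != 0 by rewrite -nm_gt0 nm_real gtr0_norm.
exists p => // y yp; apply: contrapT => nXy.
have Uy : U y by apply: rU; rewrite (lt_trans yp) // /p; lra.
have [g [gh gX gy]] := UX _ Uy nXy.
pose f z := g (p%:C * z + x).
have fd : derivable_on_disc f.
  move=> z z1; have Uz : U (p%:C * z + x).
    apply: rU; rewrite addrK nmM nm_real gtr0_norm //.
    apply: (@le_lt_trans _ _ (p * 1)); first by rewrite ler_wpM2l // ltW.
    by rewrite /p; lra.
  have [_ gd] := gh _ Uz.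
  apply: (derivable_affine (A := fun z : C => p%:C * z + x) (w := p%:C)) (gd _).
  by move=> h; rewrite /= mulrDr [h *: 1]mulr1 [h *: _]mulrC addrA.
have e z : f ((z - x) / p%:C) = g z by rewrite /f mulrC divfK // subrK.
have [||q q0 fq] := @isolated_zero R f ((y - x) / p%:C) fd.
- by rewrite nmM nmV nm_real gtr0_norm // ltr_pdivrMr // mul1r.
- by rewrite e.
have qp0 : 0 < Num.min p (q * p) by rewrite lt_min p0 mulr_gt0.
have [z [Xz zx]] := acc _ qp0; rewrite lt_min => /andP[zp zq].
have Uz : U z by apply: rU; rewrite (lt_trans zp) // /p; lra.
have /eqP[] : f ((z - x) / p%:C) != 0.
  apply: fq; rewrite nmM nmV nm_real gtr0_norm //.
  by rewrite ltr_pdivrMr // zq divr_gt0 // nm_gt0 subr_eq0.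
by rewrite e gX.
Qed.

(** The accumulation points form an open and compact set, so the one with the
    largest real part cannot exist. *)
Lemma compact_analytic_plane (X : set C) :
  compact X -> loc_analytic X -> finite_set X.
Proof.
move=> Xc Xa.
pose acc (x : C) := forall e : R, 0 < e ->
  exists y, [/\ X y, y != x & nm (y - x) < e].
pose L := [set x | X x /\ acc x].
have [[x0 Lx0]|noL] := pselect (exists x, L x); last first.
  apply: isolated_compact_finite Xc _ => x Xx.
  have [e [e0 eX]] : exists e : R, 0 < e /\
      forall y, X y -> nm (y - x) < e -> y = x.
    apply: contrapT => noe; apply: noL; exists x; split=> // e e0.
    apply: contrapT => noy; apply: noe; exists e; split=> // y Xy yx.
    by apply/eqP; apply: contrapT => /negP nyx; apply: noy; exists y.
  have [|U [Uo Ux Ue]] := @near_open C x (fun y => nm (y - x) < e).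
    by apply/nbhsC_P; exists e.
  by exists U; split=> // y Uy Xy; apply: eX => //; exact: Ue.
exfalso.
have Xcl : closed X by apply: compact_closed Xc; exact: norm_hausdorff.
have Lcl : closed L.
  move=> x clx; have accx : acc x.
    move=> e e0; have e2 : 0 < e / 2 by rewrite divr_gt0.
    have [|y [[Xy accy] yx]] := clx (fun y => nm (y - x) < e / 2).
      by apply/nbhsC_P; exists (e / 2).
    have [yE|/eqP yneq] := pselect (y = x).
      by rewrite yE in accy; exact: accy.
    by exists y; split=> //; lra.
  split=> //; rewrite (closure_id X).1 //.
  by apply: closure_subset clx => y [].
have Lc : compact L by apply: subclosed_compact Lcl Xc _ => x [].
have [x xL xmax] : exists2 x : C, x \in L & forall t : C, t \in L -> Re t <= Re x.
  apply: compact_EVT_max => //; first by exists x0.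
  by apply: continuous_subspaceT => z; exact: (@cvg_ReC R C (nbhs z) _ (fun w : C => w) z cvg_id).
have [Xx accx] : L x by exact/set_mem.
have [r r0 rX] := accumulation_interior Xa Xx accx.
pose y := x + (r / 2)%:C.
have yx : nm (y - x) = r / 2 by rewrite addrC addKr nm_real gtr0_norm // divr_gt0.
have Ly : L y.
  split; first by apply: rX; rewrite yx; lra.
  move=> e e0; pose d := Num.min e r / 2.
  have d0 : 0 < d by rewrite divr_gt0 // lt_min e0.
  have dC : nm d%:C = d by rewrite nm_real gtr0_norm.
  exists (y - d%:C); split.
  - apply: rX; have -> : y - d%:C - x = (r / 2 - d)%:C.
      by rewrite /y rmorphB; ring.
    rewrite nm_real ltr_norml; have : d <= r / 2.
      by rewrite ler_wpM2r // ge_min lexx orbT.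
    by move=> dr; apply/andP; split; lra.
  - by rewrite -subr_eq0 addrC addKr oppr_eq0 -nm_eq0 dC gt_eqF.
  - rewrite addrC addKr nmN dC; have : d <= e / 2.
      by rewrite ler_wpM2r // ge_min lexx.
    lra.
have := xmax y (mem_set Ly); rewrite /y raddfD /= gerDl leNgt divr_gt0 //.
Qed.

Lemma linehol_rescale (E : normedModType C) (V W : set (E * C)) g (t k : C) :
  (forall y z, V (y, z) -> W (y, t + k * z)) -> linehol W g ->
  linehol V (fun p => g (p.1, t + k * p.2)).
Proof.
move=> VW; pose A (p : E * C) := (p.1, t + k * p.2).
apply: (@linehol_affine _ _ _ A (fun p : E * C => (p.1, k * p.2)) V W g).
- move=> p; apply: cont_pair; first exact: cvg_fst.
  by apply: contD (cont_cst t) _; apply: contM (cont_cst k) _; exact: cvg_snd.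
- move=> h v x; rewrite /A -[RHS]/(h *: v.1 + x.1, h *: (k * v.2) + (t + k * x.2)).
  rewrite -[LHS]/(h *: v.1 + x.1, t + k * (h * v.2 + x.2)).
  rewrite -[h *: (k * v.2)]/(h * (k * v.2)); congr (_, _); ring.
- by move=> [y z]; exact: VW.
Qed.

(** Near a point of a finite fibre, the projection of [X] is cut out by the
    functions obtained by elimination.  To separate [y] from the projection,
    the functions separating the finitely many zeros of [f (y, _)] from [X] are
    interpolated into one element of the ideal of [X]. *)
Lemma local_projection (E : normedModType C) (X : set (E * C)) y0 t :
  loc_analytic X -> finite_set [set s | X (y0, s)] -> X (y0, t) ->
  exists U D, [/\ open U, open D, U y0, D t & forall y, U y ->
    (forall s, D s -> ~ X (y, s)) -> exists G, [/\ linehol U G,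
      (forall y' s, U y' -> D s -> X (y', s) -> G y' = 0) & G y != 0]].
Proof.
move=> Xa /finite_seqP[ts tsE] Xt.
have [W [Wo Wt WX]] := Xa _ Xt.
have : nbhs (y0, t) W by exact: open_nbhs_nbhs.
move=> [[A B] /= [Ay0 Bt] ABW].
have [U0 [U0o U0y0 U0A]] := near_open Ay0.
have /nbhsC_P[q q0 qB] := Bt.
have inW y s : U0 y -> nm (s - t) < q -> W (y, s).
  by move=> /U0A Ay /qB Bs; apply: (ABW (y, s)).
pose p := q / 2; have p0 : 0 < p by rewrite divr_gt0.
have [|s1 s1ts s1t] := nbhs_notin ts (P := fun s => nm (s - t) < p) (w := t).
  by apply/nbhsC_P; exists p.
have nXs1 : ~ X (y0, s1).
  move=> Xs1; have : [set s | X (y0, s)] s1 by [].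
  by rewrite tsE /= (negbTE s1ts).
have [|g [gh gX gs1]] := WX (y0, s1) _ nXs1.
  by apply: inW => //; rewrite (lt_trans s1t) // /p; lra.
have sc_lt (k : R) z (B' : R) : 0 < k -> nm z < B' -> nm (k%:C * z) < k * B'.
  by move=> k0 zB; rewrite nmM nm_real gtr0_norm // ltr_pM2l.
have fh (k : R) : 0 < k -> k <= p ->
    linehol (U0 `*` @disc2 R) (fun P => g (P.1, t + k%:C * P.2)).
  move=> k0 kp; apply: linehol_rescale gh => y z [/= Uy z2]; apply: inW => //.
  by rewrite addrC addKr (lt_le_trans (sc_lt _ _ _ k0 z2)) //; move: kp; rewrite /p; lra.
have f0d := linehol_slice_disc (fh p p0 (lexx _)) U0y0.
have pC0 : p%:C != 0 by rewrite -nm_gt0 nm_real gtr0_norm.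
have [||r r0 fr] := isolated_zero (w := (s1 - t) / p%:C) f0d.
- by rewrite nmM nmV nm_real gtr0_norm // ltr_pdivrMr // mul1r.
- by rewrite /= mulrC divfK // subrKC.
(* In the disc of radius [2 k] around [t] the only zero of [g (y0, _)] is [t]. *)
pose k := p * Num.min r 1 / 2.
have m0 : 0 < Num.min r 1 by rewrite lt_min r0 ltr01.
have k0 : 0 < k by rewrite divr_gt0 // mulr_gt0.
have kp : k <= p.
  have m1 : Num.min r 1 <= 1 by rewrite ge_min lexx orbT.
  by rewrite /k -mulrA ler_piMr ?(ltW p0) //; lra.
have kC0 : k%:C != 0 by rewrite -nm_gt0 nm_real gtr0_norm.
pose f (P : E * C) := g (P.1, t + k%:C * P.2).
have ff0 z : 0 < nm z < 2 -> f (y0, z) != 0.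
  move=> /andP[z0 z2]; have -> : f (y0, z) = g (y0, t + p%:C * (k%:C / p%:C * z)).
    by rewrite /f /= mulrA mulrCA mulfV // mulr1.
  have kz : nm (k%:C / p%:C * z) = k / p * nm z.
    by rewrite nmM nmM nmV !nm_real !gtr0_norm.
  have kp0 : 0 < k / p by rewrite divr_gt0.
  apply: fr; rewrite kz; apply/andP; split; first by rewrite mulr_gt0.
  apply: (@lt_le_trans _ _ (k / p * 2)); first by rewrite ltr_pM2l.
  have -> : k / p * 2 = Num.min r 1 by rewrite /k; field; rewrite gt_eqF.
  by rewrite ge_min lexx.
have [U [Uo Uy0 UU0 Uroots Uelim]] := local_elimination U0o U0y0 (fh k k0 kp) ff0.
have inWk y z : U y -> nm z < 2 -> W (y, t + k%:C * z).
  move=> /UU0 Uy z2; apply: inW => //; rewrite addrC addKr.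
  by rewrite (lt_le_trans (sc_lt _ _ _ k0 z2)) //; move: kp; rewrite /p; lra.
pose D := [set s : C | nm (s - t) < k].
have inD z : nm z < 1 -> D (t + k%:C * z).
  by move=> z1; rewrite /D /= addrC addKr; have := sc_lt _ _ _ k0 z1; rewrite mulr1.
have ofD s : D s -> exists2 z, nm z < 1 & s = t + k%:C * z.
  move=> Ds; exists ((s - t) / k%:C); last by rewrite mulrC divfK // subrKC.
  by rewrite nmM nmV nm_real gtr0_norm // ltr_pdivrMr // mul1r.
exists U, D; split=> //.
- rewrite openE => s Ds; apply/nbhsC_P; exists (k - nm (s - t)).
    by rewrite subr_gt0.
  move=> w hw; rewrite /D /=; have -> : w - t = (w - s) + (s - t) by ring.
  by apply: le_lt_trans (nmD _ _) _; rewrite -ltrBrDr.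
- by rewrite /D /= subrr nm0.
move=> y Uy yD; have [a aP] := Uroots y Uy.
have sepw (w : C) : exists h : E * C -> C, [/\ linehol W h,
    forall P, W P -> X P -> h P = 0 & nm w < 1 -> h (y, t + k%:C * w) != 0].
  have [w1|w1] := boolP (nm w < 1); last first.
    by exists (fun=> 0); split; [exact: linehol_cst| |].
  have w2 : nm w < 2 by lra.
  have [h [hh hX hn0]] := WX _ (inWk _ _ Uy w2) (yD _ (inD _ w1)).
  by exists h; split; [exact: hh|exact: hX|move=> _; exact: hn0].
have [hw hwP] := choice sepw.
(* Lagrange interpolation: at the zero [w] only the term of [hw w] survives. *)
pose h (P : E * C) := \sum_(w <- undup a)
  hw w (P.1, t + k%:C * P.2) * \prod_(v <- undup a | v != w) (P.2 - v).
have hh : linehol (U `*` @disc2 R) h.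
  apply: linehol_sum => w _; apply: linehol_mul.
    have [hl _ _] := hwP w; apply: linehol_rescale hl => y' z [/= Uy' z2].
    exact: inWk.
  apply: linehol_prod => v _; apply: linehol_sub_fun; first exact: linehol_snd.
  exact: linehol_cst.
have [G [Gh GP]] := Uelim h hh; exists G; split=> //.
  move=> y' s Uy' Ds Xs; have [z z1 sE] := ofD _ Ds.
  have z2 : nm z < 2 by lra.
  have XP : X (y', t + k%:C * z) by rewrite -sE.
  apply/(GP y' Uy'); exists z; split=> //.
    by apply: gX => //; exact: inWk.
  rewrite /h big1 // => w _; have [_ wX _] := hwP w.
  by rewrite /= wX ?mul0r //; exact: inWk.
apply/eqP => /(GP y Uy)[w [w1 fw]]; apply/eqP.
have wa := aP _ w1 fw; rewrite /h (bigD1_seq w) /= ?mem_undup ?undup_uniq //.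
rewrite [X in _ + X]big1 ?addr0; last first.
  move=> v vw; rewrite (big_rem w) ?mem_undup //= eq_sym vw subrr mul0r mulr0.
  by [].
rewrite mulf_neq0 //; first by have [_ _ ->] := hwP w.
by rewrite prodf_seq_neq0; apply/allP => v _; apply/implyP; rewrite subr_eq0 eq_sym.
Qed.

Lemma projection_loc_analytic (E : normedModType C) (X : set (E * C)) :
  compact X -> loc_analytic X -> loc_analytic (fst @` X).
Proof.
move=> Xc Xa y0 [[y0' t0] Xt0 /= y0E]; rewrite {}y0E in Xt0 *.
have fin := compact_analytic_plane (compact_fiber (y := y0) Xc)
  (loc_analytic_fiber (y := y0) Xa).
have /finite_seqP[ts tsE] := fin.
have tsX t : t \in ts -> X (y0, t).
  by move=> tts; have : [set` ts] t by []; rewrite -tsE.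
have [U1 [D [U1o Do U1y0 tsD U1D]]] : exists U D, [/\ open U, open D, U y0,
    (forall t, t \in ts -> D t) & forall y, U y ->
    (forall s, D s -> ~ X (y, s)) -> exists G, [/\ linehol U G,
      (forall y' s, U y' -> D s -> X (y', s) -> G y' = 0) & G y != 0]].
  elim: (ts) tsX => [|t l IHl] lX.
    exists setT, set0; split; [exact: openT|exact: open0|by []|by []|].
    move=> y _ _; exists (fun=> 1); split; first exact: linehol_cst.
      by move=> y' s _ [].
    exact: oner_neq0.
  have [|U [D [Uo Do Uy0 lD UD]]] := IHl.
    by move=> s sl; apply: lX; rewrite inE sl orbT.
  have [U' [D' [U'o D'o U'y0 tD' UD']]] :=
    local_projection Xa fin (lX t (mem_head _ _)).
  exists (U `&` U'), (D `|` D'); split=> //.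
  - exact: openI.
  - exact: openU.
  - by move=> s; rewrite inE => /orP[/eqP ->|/lD]; [right|left].
  move=> y [Uy U'y] yD.
  have [G [Gh GX Gy]] := UD y Uy (fun s Ds => yD s (or_introl Ds)).
  have [G' [Gh' GX' Gy']] := UD' y U'y (fun s Ds => yD s (or_intror Ds)).
  exists (fun x => G x * G' x); split; last exact: mulf_neq0.
    apply: linehol_mul; first by apply: linehol_sub Gh => x [].
    by apply: linehol_sub Gh' => x [].
  move=> y' s [Uy' U'y'] [Ds|Ds] Xs.
    by rewrite (GX y' s) // mul0r.
  by rewrite (GX' y' s) // mulr0.
have Kc : compact (X `&` ~` (snd @^-1` D)).
  apply: compact_closedI Xc _; apply: open_closedC.
  by apply: open_comp Do => x _; exact: cvg_snd.
have sep : \forall y \near y0, forall P, (X `&` ~` (snd @^-1` D)) P -> P.1 <> y.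
  apply: (near_compact (P := fun y (P : E * C) => P.1 <> y) Kc) => -[y s] [/= Xs nD].
  have yy0 : y != y0.
    apply/eqP => yE; apply: nD; apply: tsD.
    have : [set s | X (y0, s)] s by rewrite /= -yE.
    by rewrite tsE.
  have := @norm_hausdorff _ E; rewrite open_hausdorff => /(_ _ _ yy0).
  move=> [[A B] /= [/set_mem Ay /set_mem By0] [Ao Bo AB]].
  exists (B, fst @^-1` A) => /=.
    split; first exact: open_nbhs_nbhs.
    by apply: open_nbhs_nbhs; split=> //; apply: open_comp Ao => x _; exact: cvg_fst.
  move=> [y' [y1 s1]] [/= By' Ay1] yE; rewrite yE in Ay1.
  by have : (A `&` B) y' by []; rewrite (eqP AB).
have [U2 [U2o U2y0 U2K]] := near_open sep.
exists (U1 `&` U2); split=> //; first exact: openI.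
move=> y [U1y U2y] nXy.
have [|G [Gh GX Gy]] := U1D y U1y.
  by move=> s Ds Xs; apply: nXy; exists (y, s).
exists G; split=> //; first by apply: linehol_sub Gh => x [].
move=> y' [U1y' U2y'] [[y1 s] Xs /= y1E]; rewrite {}y1E in Xs.
apply: (GX y' s) => //; apply: contrapT => nD.
by apply: (U2K y' U2y' (y', s)).
Qed.

(** [C^(n+1)], as an iterated product so that projections are directly
    available. *)
Fixpoint affine_space (n : nat) : normedModType C :=
  if n is m.+1 then (affine_space m * C)%type else C.

(** Projections are finite onto locally analytic images of lower dimension, so
    induction on the dimension reduces to the plane. *)
Theorem compact_analytic_finite n (X : set (affine_space n)) :
  compact X -> loc_analytic X -> finite_set X.
Proof.
elim: n X => [|n IHn] /= X Xc Xa; first exact: compact_analytic_plane.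
have pc : compact (fst @` X).
  by apply: continuous_compact Xc; apply: continuous_subspaceT => x; exact: cvg_fst.
have fp := IHn _ pc (projection_loc_analytic Xc Xa).
have fib y : finite_set [set s | X (y, s)].
  by apply: compact_analytic_plane (compact_fiber Xc) (loc_analytic_fiber Xa).
have -> : X = \bigcup_(y in fst @` X) ((fun s => (y, s)) @` [set s | X (y, s)]).
  apply/seteqP; split=> [[y s] Xs|_ [y _ [s Xs <-]] //].
  by exists y; [exists (y, s)|exists s].
by apply: bigcup_finite => // y _; exact: finite_image.
Qed.

End CompactAnalytic.

(** * Regular quadruples and words in their matrices *)

Section Regularity.
Variables (R : realType).
Local Notation C := (R[i]).

(** The product of the matrices spelled by a word, read from right to left so
    that extending a word is a multiplication on the right. *)
Definition word_mx (I : Type) c (X : I -> 'M[C]_c) (w : seq I) : 'M[C]_c :=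
  foldr (fun x M => M *m X x) 1%:M w.

Lemma word_mx_cat (I : Type) c (X : I -> 'M[C]_c) v w :
  word_mx X (v ++ w) = word_mx X w *m word_mx X v.
Proof. by elim: v => [|x v IHv] /=; rewrite ?mulmx1 // IHv mulmxA. Qed.

Lemma word_mx_map (I I' : Type) c (f : I' -> I) (X : I -> 'M[C]_c) w :
  word_mx X (map f w) = word_mx (X \o f) w.
Proof. by elim: w => //= x w ->. Qed.

Lemma word_mx_tr (I : Type) c (X : I -> 'M[C]_c) w :
  (word_mx (fun x => (X x)^T) w)^T = word_mx X (rev w).
Proof.
elim: w => [|x w IHw] /=; first by rewrite trmx1.
by rewrite trmx_mul trmxK IHw rev_cons -cats1 word_mx_cat /= mul1mx.
Qed.

Lemma word_mx_conj (I : Type) c (X Y : I -> 'M[C]_c) (g : 'M[C]_c) w :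
  g \in unitmx -> (forall x, Y x = g *m X x *m invmx g) ->
  word_mx Y w = g *m word_mx X w *m invmx g.
Proof.
move=> gU YX; elim: w => [|x w IHw] /=; first by rewrite mulmx1 mulmxV.
by rewrite IHw YX !mulmxA mulmxKV.
Qed.

(** The row spaces spanned by words of bounded length increase with the bound,
    hence stabilise after at most [c] steps; the stable one is invariant. *)
Lemma krylov r c (X : bool -> 'M[C]_c) (N : 'M[C]_(r, c)) :
  exists m (G : 'M[C]_(m, c)), [/\
    forall i, exists p : seq bool * 'I_r, (size p.1 <= c)%N /\
      row i G = row p.2 (N *m word_mx X p.1),
    (N <= G)%MS & forall b, (G *m X b <= G)%MS].
Proof.
pose isG k m (G : 'M[C]_(m, c)) := (forall i, exists p : seq bool * 'I_r,
  (size p.1 <= k)%N /\ row i G = row p.2 (N *m word_mx X p.1)) /\ (N <= G)%MS.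
have wid k k' m (G : 'M[C]_(m, c)) : (k <= k')%N -> isG k m G -> isG k' m G.
  move=> kk' [GW NG]; split=> // i; have [p [pk pE]] := GW i; exists p; split=> //.
  exact: leq_trans kk'.
have step k : (exists m (G : 'M[C]_(m, c)),
    [/\ isG k m G & forall b, (G *m X b <= G)%MS]) \/
  (exists m (G : 'M[C]_(m, c)), isG k m G /\ (k <= \rank G)%N).
  elim: k => [|k [[m [G [GW GX]]]|[m [G [GW Gk]]]]].
  - right; exists r, N; split=> //; split=> // i; exists ([::], i).
    by rewrite /= mulmx1.
  - by left; exists m, G; split=> //; apply: wid GW.
  pose G' := col_mx G (col_mx (G *m X false) (G *m X true)).
  have GG' : (G <= G')%MS by rewrite -addsmxE addsmxSl.
  have isG' : isG k.+1 _ G'.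
    split; last by apply: submx_trans GG'; case: GW.
    have ext i b : exists p : seq bool * 'I_r, (size p.1 <= k.+1)%N /\
        row i (G *m X b) = row p.2 (N *m word_mx X p.1).
      have [[w a] [/= wk wE]] := GW.1 i; exists (b :: w, a); split=> //=.
      by rewrite mulmxA row_mul wE -row_mul.
    move=> i; rewrite /G'; case: (split_ordP i) => i' ->.
      by rewrite rowKu; apply: (wid k k.+1 m G _ GW).1.
    by rewrite rowKd; case: (split_ordP i') => i'' ->; rewrite ?rowKu ?rowKd.
  have [G'G|nG'G] := boolP (G' <= G)%MS.
    left; exists m, G; split; first exact: wid GW.
    move=> b; apply: submx_trans G'G; rewrite -addsmxE.
    apply: submx_trans (addsmxSr _ _); rewrite -addsmxE.
    by case: b; rewrite ?addsmxSr ?addsmxSl.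
  right; exists _, G'; split=> //; apply: leq_ltn_trans Gk _.
  by rewrite ltn_neqAle mxrankS // andbT mxrank_leqif_sup.
have [[m [G [[GW NG] GX]]]|[m [G [[GW NG] Gk]]]] := step c.
  by exists m, G.
exists m, G; split=> // b; apply: submx_full.
by rewrite /row_full eqn_leq rank_leq_col.
Qed.

Lemma select_rows m c (G : 'M[C]_(m, c)) : row_full G ->
  exists f : 'I_c -> 'I_m, rowsub f G \in unitmx.
Proof. by move=> Gf; exists (fullrankfun Gf); exact: fullrowsub_unit. Qed.

Section Quadruple.
Variables r c : nat.
Implicit Types q : quadruple R r c.

Definition letter q (b : bool) : 'M[C]_c := if b then q.1.1.2 else q.1.1.1.

(** Square blocks of the observability and controllability matrices of [q], in the
    terminology of linear systems: the rows [j W] and the columns [W i] for words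
    [W] in the endomorphisms. *)
Definition obs_mx q (S : 'I_c -> seq bool * 'I_r) : 'M[C]_c :=
  \matrix_(s, t) (q.2 *m word_mx (letter q) (S s).1) (S s).2 t.

Definition ctr_mx q (T : 'I_c -> seq bool * 'I_r) : 'M[C]_c :=
  \matrix_(s, t) (word_mx (letter q) (T t).1 *m q.1.2) s (T t).2.

Lemma obs_mxE q S s t :
  obs_mx q S s t = (q.2 *m word_mx (letter q) (S s).1) (S s).2 t.
Proof. by rewrite mxE. Qed.

Lemma ctr_mxE q T s t :
  ctr_mx q T s t = (word_mx (letter q) (T t).1 *m q.1.2) s (T t).2.
Proof. by rewrite mxE. Qed.

Definition short (S : 'I_c -> seq bool * 'I_r) := forall s, (size (S s).1 <= c)%N.

Lemma invariant_word q (S : {vspace 'cV[C]_c}) w v :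
  invariant_subspace q.1.1.1 q.1.1.2 S -> v \in S ->
  word_mx (letter q) w *m v \in S.
Proof.
move=> Sinv; elim: w v => [|b w IHw] v vS /=; first by rewrite mul1mx.
by rewrite -mulmxA; apply: IHw; have [] := Sinv v vS; case: b.
Qed.

Definition controllable q := ~ exists S : {vspace 'cV[C]_c},
  [/\ S <> fullv, invariant_subspace q.1.1.1 q.1.1.2 S &
      forall w : 'cV[C]_r, q.1.2 *m w \in S].

Definition observable q := ~ exists S : {vspace 'cV[C]_c},
  [/\ S <> 0%VS, invariant_subspace q.1.1.1 q.1.1.2 S &
      forall v, v \in S -> q.2 *m v = 0].

Lemma regular_quadrupleE q :
  regular_quadruple q <-> controllable q /\ observable q.
Proof. by case: q => [[[A B] i] j]. Qed.

Lemma mem_lker_mulmx m (G : 'M[C]_(m, c)) (v : 'cV[C]_c) :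
  (v \in lker (linfun (mulmx G : 'cV[C]_c -> 'cV[C]_m))) = (G *m v == 0).
Proof. by rewrite memv_ker lfunE. Qed.

(** The columns [W i] span the smallest invariant subspace containing the image of
    [i]; by [krylov] for the transposed matrices, words of length at most [c]
    suffice. *)
Lemma controllableP q :
  controllable q <-> exists2 T, short T & ctr_mx q T \in unitmx.
Proof.
split=> [qc|[T _ KU] [S [nS Sinv iS]]]; last first.
  apply: nS; apply/vspaceP => v; rewrite memvf.
  have -> : v = \sum_t (invmx (ctr_mx q T) *m v) t 0 *:
      (word_mx (letter q) (T t).1 *m (q.1.2 *m delta_mx (T t).2 0)).
    apply/colP => s; rewrite -{1}[v](mulKVmx KU) mxE summxE.
    apply: eq_bigr => t _; rewrite ctr_mxE mulmxA -colE mulrC.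
    by rewrite [RHS]mxE; congr (_ * _); rewrite [RHS]mxE.
  apply: memv_suml => t _; apply: memvZ; exact: invariant_word.
have [m [G [GW iG GX]]] := krylov (fun b => (letter q b)^T) (q.1.2)^T.
have Gf : row_full G.
  apply: contrapT => /negP nGf; apply: qc.
  exists (lker (linfun (mulmx (cokermx G)^T : 'cV[C]_c -> 'cV[C]_c))).
  have memS v : (v \in lker (linfun (mulmx (cokermx G)^T : 'cV[C]_c -> 'cV[C]_c)))
      = (v^T <= G)%MS.
    by rewrite mem_lker_mulmx submxE -(inj_eq trmx_inj) trmx_mul trmxK trmx0.
  split.
  - move=> SE; move/negP: nGf; apply; rewrite -sub1mx; apply/row_subP => s.
    have := memS (row s 1%:M)^T; rewrite SE memvf trmxK => <-.
    by [].
  - have inv b v : (v^T <= G)%MS -> ((letter q b *m v)^T <= G)%MS.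
      by move=> vG; rewrite trmx_mul (submx_trans (submxMr _ vG)) ?GX.
    by move=> v; rewrite !memS => vG; split; [exact: (inv _ false)|exact: (inv _ true)].
  - by move=> w; rewrite memS trmx_mul (submx_trans (submxMl _ _)).
have [f fU] := select_rows Gf; have [p pP] := choice GW.
exists (fun t => (rev (p (f t)).1, (p (f t)).2)).
  by move=> t; rewrite size_rev; case: (pP (f t)).
suff -> : ctr_mx q (fun t => (rev (p (f t)).1, (p (f t)).2)) = (rowsub f G)^T.
  by rewrite unitmx_tr.
apply/matrixP => s t; rewrite ctr_mxE /= [RHS]mxE [RHS]mxE.
have [_ /rowP/(_ s)] := pP (f t); rewrite mxE => ->.
by rewrite -word_mx_tr -[q.1.2 in LHS]trmxK -trmx_mul mxE [RHS]mxE.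
Qed.

(** The common kernel of the rows [j W] is the largest invariant subspace in the
    kernel of [j]. *)
Lemma observableP q :
  observable q <-> exists2 S, short S & obs_mx q S \in unitmx.
Proof.
split=> [qo|[T _ LU] [S [nS Sinv jS]]]; last first.
  apply: nS; apply/vspaceP => v; rewrite memv0; apply/idP/eqP => [vS|->]; last first.
    exact: mem0v.
  have L0 : obs_mx q T *m v = 0.
    apply/colP => s; rewrite [RHS]mxE.
    transitivity ((q.2 *m (word_mx (letter q) (T s).1 *m v)) (T s).2 0); last first.
      by rewrite jS ?mxE //; exact: invariant_word.
    rewrite mulmxA [LHS]mxE [RHS]mxE; apply: eq_bigr => t _.
    by rewrite obs_mxE.
  by rewrite -[v](mulKmx LU) L0 mulmx0.
have [m [G [GW jG GX]]] := krylov (letter q) q.2.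
have Gf : row_full G.
  apply: contrapT => /negP nGf; apply: qo.
  exists (lker (linfun (mulmx G : 'cV[C]_c -> 'cV[C]_m))); split.
  - move=> SE; have kG : kermx G^T != 0.
      by rewrite kermx_eq0 /row_free mxrank_tr.
    have /rowV0Pn[v /sub_kermxP vG v0] := kG.
    move/eqP: v0; apply; apply: trmx_inj; apply/eqP.
    rewrite trmx0 -memv0 -SE mem_lker_mulmx -(inj_eq trmx_inj) trmx_mul trmxK vG.
    by rewrite trmx0.
  - have inv b v : G *m v = 0 -> G *m (letter q b *m v) = 0.
      move=> Gv; have /submxP[D DE] := GX b.
      by rewrite mulmxA DE -mulmxA Gv mulmx0.
    move=> v; rewrite !mem_lker_mulmx => /eqP Gv; split; apply/eqP.
      exact: (inv _ false).
    exact: (inv _ true).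
  - move=> v; rewrite mem_lker_mulmx => /eqP Gv; have /submxP[D ->] := jG.
    by rewrite -mulmxA Gv mulmx0.
have [f fU] := select_rows Gf; have [p pP] := choice GW.
exists (p \o f); first by move=> t; case: (pP (f t)).
suff -> : obs_mx q (p \o f) = rowsub f G by [].
apply/matrixP => s t; rewrite !mxE; have [_ /rowP/(_ t)] := pP (f s).
by rewrite mxE => ->; rewrite !mxE.
Qed.

(** Regularity is the nonvanishing of minors of the controllability and
    observability matrices built from words of length at most [c]. *)
Lemma regularP q : regular_quadruple q <->
  (exists2 T, short T & ctr_mx q T \in unitmx) /\
  (exists2 S, short S & obs_mx q S \in unitmx).
Proof.
rewrite regular_quadrupleE; split=> -[h1 h2].
  by split; [apply/controllableP|apply/observableP].
by split; [apply/controllableP|apply/observableP].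
Qed.

Variable g : 'M[C]_c.
Hypothesis gU : g \in unitmx.

Lemma letter_act q b : letter (act g q) b = g *m letter q b *m invmx g.
Proof. by case: q b => [[[A B] i] j] []. Qed.

Lemma word_act q w :
  word_mx (letter (act g q)) w = g *m word_mx (letter q) w *m invmx g.
Proof. by apply: word_mx_conj => // b; exact: letter_act. Qed.

Lemma ctr_act q T : ctr_mx (act g q) T = g *m ctr_mx q T.
Proof.
apply/matrixP => s t; rewrite ctr_mxE [RHS]mxE.
have -> : (act g q).1.2 = g *m q.1.2 by case: q => [[[A B] i] j].
rewrite word_act -mulmxA mulKmx // -mulmxA [LHS]mxE.
by apply: eq_bigr => k _; rewrite ctr_mxE.
Qed.

Lemma obs_act q S : obs_mx (act g q) S = obs_mx q S *m invmx g.
Proof.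
apply/matrixP => s t; rewrite obs_mxE [RHS]mxE.
have -> : (act g q).2 = q.2 *m invmx g by case: q => [[[A B] i] j].
rewrite word_act !mulmxA mulmxKV // [LHS]mxE.
by apply: eq_bigr => k _; rewrite obs_mxE.
Qed.

Lemma regular_act q : regular_quadruple q -> regular_quadruple (act g q).
Proof.
move=> /regularP[[T Ts TU] [S Ss SU]]; apply/regularP; split.
  by exists T => //; rewrite ctr_act unitmx_mul gU.
by exists S => //; rewrite obs_act unitmx_mul SU unitmx_inv.
Qed.

Lemma adhm_act q : adhm_map (act g q) = g *m adhm_map q *m invmx g.
Proof.
case: q => [[[A B] i] j] /=; rewrite mulmxDr mulmxBr mulmxDl mulmxBl.
by rewrite !mulmxA !mulmxKV.
Qed.

Lemma act_linear (x y : C) q q' :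
  act g (x *: q + y *: q') = x *: act g q + y *: act g q'.
Proof.
case: q q' => [[[A B] i] j] [[[A' B'] i'] j'] /=.
by rewrite !mulmxDr !mulmxDl -!scalemxAr -!scalemxAl.
Qed.

Definition act_datum (D : datum R r c) : datum R r c := (act g D.1, act g D.2).

Lemma datum_at_act (D : datum R r c) z0 z1 :
  datum_at (act_datum D) z0 z1 = act g (datum_at D z0 z1).
Proof. by rewrite /datum_at act_linear. Qed.

Lemma solution_act (D : datum R r c) :
  adhm_solutions D -> adhm_solutions (act_datum D).
Proof.
move=> [D0 Dr]; split=> [z0 z1|z0 z1 z]; rewrite datum_at_act.
  by rewrite adhm_act D0 mulmx0 mul0mx.
by apply: regular_act; exact: Dr.
Qed.

End Quadruple.

(** Scaling all four matrices changes neither the invariant subspaces nor the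
    image of [i] and the kernel of [j]. *)
Lemma regular_scale r c (q : quadruple R r c) (z : C) : z != 0 ->
  regular_quadruple q -> regular_quadruple (z *: q).
Proof.
move=> z0 /regular_quadrupleE[qc qo]; apply/regular_quadrupleE.
have inv S : invariant_subspace (z *: q).1.1.1 (z *: q).1.1.2 S ->
    invariant_subspace q.1.1.1 q.1.1.2 S.
  have unz v : z *: v \in S -> v \in S.
    by move=> /(memvZ z^-1); rewrite scalerA mulVf // scale1r.
  move=> Sinv v vS; have [Av Bv] := Sinv v vS.
  have zl (X : 'M[C]_c) : (z *: X) *m v \in S -> X *m v \in S.
    by rewrite -scalemxAl => /unz.
  by split; [exact: (zl _ Av)|exact: (zl _ Bv)].
split=> -[S [nS Sinv SS]].
  apply: qc; exists S; split; [exact: nS|exact: inv|].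
  by move=> w; have := memvZ z^-1 (SS w); rewrite /= -scalemxAl scalerA mulVf // scale1r.
apply: qo; exists S; split; [exact: nS|exact: inv|].
move=> v /SS /=; rewrite -scalemxAl => /eqP; rewrite scaler_eq0 (negbTE z0) /=.
by move/eqP.
Qed.

End Regularity.

(** * Holomorphic matrix-valued functions *)

Section Holomorphy.
Variables (R : realType).
Local Notation C := (R[i]).

Lemma differentiable_linehol (E : normedModType C) (U : set E) (f : E -> C) :
  holomorphic_on U f -> linehol U f.
Proof.
move=> fh x /fh fd; split; first exact: differentiable_continuous fd.
by move=> v; exact: diff_derivable fd.
Qed.

Lemma diff_linear (E E' : normedModType C) (f : E -> E') x :
  linear f -> continuous f -> differentiable f x.
Proof.
move=> flin fc; pose fM := GRing.isLinear.Build _ _ _ _ _ flin.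
pose fL : {linear E -> E'} := HB.pack f fM.
exact: (@linear_differentiable _ _ _ fL x fc).
Qed.

Lemma diff_fst (E E' : normedModType C) (x : E * E') : differentiable fst x.
Proof. by apply: diff_linear => // y; exact: cvg_fst. Qed.

Lemma diff_snd (E E' : normedModType C) (x : E * E') : differentiable snd x.
Proof. by apply: diff_linear => // y; exact: cvg_snd. Qed.

Section Closure.
Variables (E : normedModType C) (x : E).

Lemma diff_k (k : C) : differentiable (fun _ : E => k) x.
Proof. exact: (@differentiable_cst _ E C k x). Qed.

Lemma diff_add (f g : E -> C) : differentiable f x -> differentiable g x ->
  differentiable (fun y => f y + g y) x.
Proof. by move=> fd gd; exact: (differentiableD fd gd). Qed.

Lemma diff_sub (f g : E -> C) : differentiable f x -> differentiable g x ->
  differentiable (fun y => f y - g y) x.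
Proof. by move=> fd gd; exact: (differentiableB fd gd). Qed.

Lemma diff_mul (f g : E -> C) : differentiable f x -> differentiable g x ->
  differentiable (fun y => f y * g y) x.
Proof. by move=> fd gd; exact: (differentiableM fd gd). Qed.

Lemma diff_inv (f : E -> C) : differentiable f x -> f x != 0 ->
  differentiable (fun y => (f y)^-1) x.
Proof. by move=> fd f0; exact: (differentiableV fd f0). Qed.

Lemma diff_big_sum (I : Type) (s : seq I) (P : pred I) (F : I -> E -> C) :
  (forall i, differentiable (F i) x) ->
  differentiable (fun y => \sum_(i <- s | P i) F i y) x.
Proof.
move=> Fd; elim: s => [|i s IHs].
  rewrite (_ : (fun y => _) = fun=> 0); first exact: diff_k.
  by apply/funext => y; rewrite big_nil.
rewrite (_ : (fun y => _) = if P i then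
  (fun y => F i y + \sum_(j <- s | P j) F j y) else
  (fun y => \sum_(j <- s | P j) F j y)); last first.
  by apply/funext => y; rewrite big_cons; case: (P i).
by case: (P i); [exact: diff_add (Fd i) IHs|exact: IHs].
Qed.

Lemma diff_big_prod (I : Type) (s : seq I) (P : pred I) (F : I -> E -> C) :
  (forall i, differentiable (F i) x) ->
  differentiable (fun y => \prod_(i <- s | P i) F i y) x.
Proof.
move=> Fd; elim: s => [|i s IHs].
  rewrite (_ : (fun y => _) = fun=> 1); first exact: diff_k.
  by apply/funext => y; rewrite big_nil.
rewrite (_ : (fun y => _) = if P i then
  (fun y => F i y * \prod_(j <- s | P j) F j y) else
  (fun y => \prod_(j <- s | P j) F j y)); last first.
  by apply/funext => y; rewrite big_cons; case: (P i).
by case: (P i); [exact: diff_mul (Fd i) IHs|exact: IHs].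
Qed.

(** Differentiability of the entries; it is this form that is stable under
    products and adjugates without topology on spaces of matrices. *)
Definition mx_diff m n (M : E -> 'M[C]_(m, n)) :=
  forall i j, differentiable (fun y => M y i j) x.

Lemma mx_diff_cst m n (M : 'M[C]_(m, n)) : mx_diff (fun=> M).
Proof. by move=> i j; exact: diff_k. Qed.

Lemma mx_diff_add m n (M N : E -> 'M[C]_(m, n)) : mx_diff M -> mx_diff N ->
  mx_diff (fun y => M y + N y).
Proof.
move=> Md Nd i j; rewrite (_ : (fun y => _) = (fun y => M y i j + N y i j)).
  exact: diff_add (Md i j) (Nd i j).
by apply/funext => y; rewrite mxE.
Qed.

Lemma mx_diff_sub m n (M N : E -> 'M[C]_(m, n)) : mx_diff M -> mx_diff N ->
  mx_diff (fun y => M y - N y).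
Proof.
move=> Md Nd i j; rewrite (_ : (fun y => _) = (fun y => M y i j - N y i j)).
  exact: diff_sub (Md i j) (Nd i j).
by apply/funext => y; rewrite !mxE.
Qed.

Lemma mx_diff_scale m n (f : E -> C) (M : E -> 'M[C]_(m, n)) :
  differentiable f x -> mx_diff M -> mx_diff (fun y => f y *: M y).
Proof.
move=> fd Md i j; rewrite (_ : (fun y => _) = (fun y => f y * M y i j)).
  exact: diff_mul fd (Md i j).
by apply/funext => y; rewrite mxE.
Qed.

Lemma mx_diff_mul m n p (M : E -> 'M[C]_(m, n)) (N : E -> 'M[C]_(n, p)) :
  mx_diff M -> mx_diff N -> mx_diff (fun y => M y *m N y).
Proof.
move=> Md Nd i j; rewrite (_ : (fun y => _) = (fun y => \sum_k M y i k * N y k j)).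
  by apply: diff_big_sum => k; exact: diff_mul (Md i k) (Nd k j).
by apply/funext => y; rewrite mxE.
Qed.

Lemma diff_det n (M : E -> 'M[C]_n) : mx_diff M ->
  differentiable (fun y => \det (M y)) x.
Proof.
move=> Md; apply: diff_big_sum => s; apply: diff_mul; first exact: diff_k.
by apply: diff_big_prod => k; exact: Md.
Qed.

Lemma mx_diff_inv n (M : E -> 'M[C]_n) : mx_diff M -> \det (M x) != 0 ->
  mx_diff (fun y => (\det (M y))^-1 *: \adj (M y)).
Proof.
move=> Md M0; apply: mx_diff_scale; first exact: diff_inv (diff_det Md) M0.
move=> i j; rewrite (_ : (fun y => _) = (fun y => cofactor (M y) j i)); last first.
  by apply/funext => y; rewrite mxE.
apply: diff_mul; first exact: diff_k.
apply: diff_det => a b; rewrite (_ : (fun y => _) =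
  (fun y => M y (lift j a) (lift i b))); first exact: Md.
by apply/funext => y; rewrite !mxE.
Qed.

Lemma mx_diff_word (I : Type) c (X : E -> I -> 'M[C]_c) w :
  (forall a, mx_diff (fun y => X y a)) -> mx_diff (fun y => word_mx (X y) w).
Proof.
move=> Xd; elim: w => [|a w IHw] /=; first exact: mx_diff_cst.
exact: mx_diff_mul IHw (Xd a).
Qed.

Lemma mx_diffP m n (M : E -> 'M[C]_(m, n)) : mx_diff M -> differentiable M x.
Proof.
move=> Md; have colD (i : 'I_m) : differentiable
    (\sum_(j < n) (fun y => M y i j *: (delta_mx i j : 'M[C]_(m, n)))) x.
  by apply: differentiable_sum => j; exact: differentiableZl (Md i j).
have := differentiable_sum colD; congr (differentiable _ _); apply/funext => y.
rewrite [RHS]matrix_sum_delta fct_sumE; apply: eq_bigr => i _.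
by rewrite fct_sumE.
Qed.

End Closure.

Lemma mx_diff_coord (E : normedModType C) m n (f : E -> 'M[C]_(m, n)) x :
  differentiable f x -> mx_diff x f.
Proof.
by move=> fd i j; exact: (differentiable_comp fd (differentiable_coord (f x) i j)).
Qed.

End Holomorphy.

(** * Moments of a datum and its realization from them *)

Section Coordinates.
Variables (R : realType).
Local Notation C := (R[i]).

Fixpoint affine_point n (f : nat -> C) : affine_space R n :=
  if n is m.+1 return affine_space R n then (affine_point m f, f m.+1) else f 0%N.

Fixpoint affine_coord n : affine_space R n -> nat -> C :=
  if n is m.+1 return affine_space R n -> nat -> C
  then fun h k => if k == m.+1 then h.2 else affine_coord h.1 k
  else fun h _ => h.

Lemma affine_coord_point n f k : (k <= n)%N -> affine_coord (affine_point n f) k = f k.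
Proof.
elim: n => [|n IHn] /=; first by rewrite leqn0 => /eqP ->.
by rewrite leq_eqVlt; case: eqP => [-> //|_] /= /IHn.
Qed.

Lemma affine_coord_inj n (h h' : affine_space R n) :
  (forall k, (k <= n)%N -> affine_coord h k = affine_coord h' k) -> h = h'.
Proof.
elim: n h h' => [|n IHn] h h' /= hh'; first exact: (hh' 0%N).
rewrite [h]surjective_pairing [h']surjective_pairing.
have := hh' n.+1 (leqnn _); rewrite eqxx => ->; congr (_, _).
apply: IHn => k kn; have := hh' k (leqW kn).
by rewrite ltn_eqF.
Qed.

Lemma diff_affine_coord n k (x : affine_space R n) : differentiable (fun h => affine_coord h k) x.
Proof.
elim: n x => [|n IHn] x /=; first exact: (@diff_linear R C C id x (fun _ _ _ => erefl) (fun _ => cvg_id)).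
case: (k == n.+1); first exact: (@diff_snd R (affine_space R n) C x).
exact: (@differentiable_comp _ _ _ _ _ _ x
  (@diff_fst R (affine_space R n) C x) (IHn x.1)).
Qed.

Lemma continuous_affine_point (T : topologicalType) (f : T -> nat -> C) n x :
  (forall k, {for x, continuous (fun t => f t k)}) ->
  {for x, continuous (fun t => affine_point n (f t))}.
Proof.
move=> fc; elim: n => [|n IHn] /=; first exact: fc.
exact: cont_pair IHn (fc n.+1).
Qed.

End Coordinates.

Section Moments.
Variables (R : realType) (r c : nat).
Local Notation C := (R[i]).
Implicit Types D : datum R r c.

Definition coef D (k : bool) : quadruple R r c := if k then D.2 else D.1.

Definition datum_letter D (a : bool * bool) : 'M[C]_c := letter (coef D a.2) a.1.

(** In these products the conjugating matrices cancel, see [moment_act]. *)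
Definition moment D (k l : bool) (w : seq (bool * bool)) : 'M[C]_r :=
  (coef D k).2 *m word_mx (datum_letter D) w *m (coef D l).1.2.

Lemma coef_act g D k : coef (act_datum g D) k = act g (coef D k).
Proof. by case: k. Qed.

Lemma moment_act g D k l w : g \in unitmx ->
  moment (act_datum g D) k l w = moment D k l w.
Proof.
move=> gU; rewrite /moment !coef_act.
have -> : (act g (coef D k)).2 = (coef D k).2 *m invmx g.
  by case: (coef D k) => [[[A B] i] j].
have -> : (act g (coef D l)).1.2 = g *m (coef D l).1.2.
  by case: (coef D l) => [[[A B] i] j].
rewrite (@word_mx_conj _ _ _ (datum_letter D) _ g w gU) => [|a].
  by rewrite !mulmxA !mulmxKV.
by rewrite /datum_letter coef_act letter_act.
Qed.

Definition moment_table := bool -> bool -> seq (bool * bool) -> 'M[C]_r.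

Variables S T : 'I_c -> seq bool * 'I_r.

(** The letters [(b, k)] of a datum are indexed by the kind [b] of endomorphism and
    the homogeneous coordinate [k]; regularity at a single point of the projective
    line suffices, and [k = false] is the one chosen. *)
Definition lift_word (w : seq bool) := [seq (b, false) | b <- w].

Lemma lift_wordE D w : word_mx (datum_letter D) (lift_word w) = word_mx (letter D.1) w.
Proof. exact: word_mx_map. Qed.

(** Candidates for [L *m W *m K], [L *m i] and [j *m K] expressed by moments, where
    [L] and [K] are the blocks [obs_mx] and [ctr_mx] chosen by [S] and [T], see
    [hankel_moment]. *)
Definition hankel_mx (M : moment_table) (u : seq (bool * bool)) : 'M[C]_c :=
  \matrix_(s, t) M false false (lift_word (T t).1 ++ u ++ lift_word (S s).1)
    (S s).2 (T t).2.

Definition hankel_in (M : moment_table) l : 'M[C]_(c, r) :=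
  \matrix_(s, b) M false l (lift_word (S s).1) (S s).2 b.

Definition hankel_out (M : moment_table) k : 'M[C]_(r, c) :=
  \matrix_(a, t) M k false (lift_word (T t).1) a (T t).2.

(** Unlike [invmx], a rational expression in the entries. *)
Definition adj_inv (H : 'M[C]_c) := (\det H)^-1 *: \adj H.

(** The quadruples of a datum with moments [M] in the basis given by the columns of
    [ctr_mx]. *)
Definition realization_coef (M : moment_table) (k : bool) : quadruple R r c :=
  let H := adj_inv (hankel_mx M [::]) in
  (H *m hankel_mx M [:: (false, k)], H *m hankel_mx M [:: (true, k)],
   H *m hankel_in M k, hankel_out M k).

Definition realization M : datum R r c :=
  (realization_coef M false, realization_coef M true).

Lemma mulmx_entry m n p m' p' (A : 'M[C]_(m, n)) (A' : 'M[C]_(m', n))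
    (B : 'M[C]_(n, p)) (B' : 'M[C]_(n, p')) s a t b :
  (forall k, A s k = A' a k) -> (forall k, B k t = B' k b) ->
  (A *m B) s t = (A' *m B') a b.
Proof. by move=> AA BB; rewrite !mxE; apply: eq_bigr => k _; rewrite AA BB. Qed.

Lemma hankel_moment D u : hankel_mx (moment D) u =
  obs_mx D.1 S *m word_mx (datum_letter D) u *m ctr_mx D.1 T.
Proof.
apply/matrixP => s t; rewrite [LHS]mxE /moment /= !word_mx_cat !lift_wordE.
rewrite -!mulmxA mulmxA (mulmxA (_ *m _)) [in RHS]mulmxA.
apply/esym; apply: mulmx_entry => k; last exact: ctr_mxE.
by apply: mulmx_entry => // k'; exact: obs_mxE.
Qed.

Lemma hankel_in_moment D l :
  hankel_in (moment D) l = obs_mx D.1 S *m (coef D l).1.2.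
Proof.
apply/matrixP => s b; rewrite [LHS]mxE /moment /= lift_wordE.
by apply/esym; apply: mulmx_entry => // k; exact: obs_mxE.
Qed.

Lemma hankel_out_moment D k :
  hankel_out (moment D) k = (coef D k).2 *m ctr_mx D.1 T.
Proof.
apply/matrixP => a t; rewrite [LHS]mxE /moment /= lift_wordE -mulmxA.
by apply/esym; apply: mulmx_entry => // k'; exact: ctr_mxE.
Qed.

Lemma det_hankel D : \det (hankel_mx (moment D) [::]) =
  \det (obs_mx D.1 S) * \det (ctr_mx D.1 T).
Proof. by rewrite hankel_moment /= mulmx1 det_mulmx. Qed.

Lemma adj_invE (H : 'M[C]_c) : \det H != 0 -> adj_inv H = invmx H.
Proof. by move=> H0; rewrite /invmx unitmxE unitfE H0. Qed.

(** With [L] and [K] the observability and controllability blocks, the Hankel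
    matrices are [L *m K] and [L *m X *m K], so [K^-1 *m X *m K] is recovered
    from the moments. *)
Lemma realization_moment D :
  obs_mx D.1 S \in unitmx -> ctr_mx D.1 T \in unitmx ->
  realization (moment D) = act_datum (invmx (ctr_mx D.1 T)) D.
Proof.
move=> LU KU.
have H0 : \det (hankel_mx (moment D) [::]) != 0.
  by rewrite det_hankel mulf_neq0 // -unitfE -unitmxE.
have HE m (Y : 'M[C]_(c, m)) : adj_inv (hankel_mx (moment D) [::]) *m
    (obs_mx D.1 S *m Y) = invmx (ctr_mx D.1 T) *m Y.
  rewrite adj_invE // hankel_moment /= mulmx1.
  have LKU : obs_mx D.1 S *m ctr_mx D.1 T \in unitmx by rewrite unitmx_mul LU.
  by rewrite -{1}[Y](mulKVmx KU) (mulmxA (obs_mx D.1 S)) mulKmx.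
have rE k : realization_coef (moment D) k = act (invmx (ctr_mx D.1 T)) (coef D k).
  have lE b : adj_inv (hankel_mx (moment D) [::]) *m
      hankel_mx (moment D) [:: (b, k)] =
      invmx (ctr_mx D.1 T) *m letter (coef D k) b *m ctr_mx D.1 T.
    by rewrite (hankel_moment D [:: (b, k)]) /= mul1mx -mulmxA HE mulmxA.
  rewrite /realization_coef !lE hankel_in_moment hankel_out_moment HE.
  by case: (coef D k) => [[[A B] i] j] /=; rewrite invmxK.
by rewrite /realization /act_datum !rE.
Qed.

Lemma realization_local (M M' : moment_table) : short S -> short T ->
  (forall k l w, (size w <= c.*2.+1)%N -> M k l w = M' k l w) ->
  realization M = realization M'.
Proof.
move=> Ss Ts MM.
have sz w w' u : (size w <= c)%N -> (size w' <= c)%N -> (size u <= 1)%N ->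
    (size (lift_word w ++ u ++ lift_word w') <= c.*2.+1)%N.
  move=> wc w'c u1; rewrite !size_cat !size_map -addnn.
  by rewrite addnCA -add1n leq_add // leq_add.
have sz1 w : (size w <= c)%N -> (size (lift_word w) <= c.*2.+1)%N.
  by move=> wc; rewrite size_map (leq_trans wc) // -addnn -addnS leq_addr.
have hE u : (size u <= 1)%N -> hankel_mx M u = hankel_mx M' u.
  by move=> u1; apply/matrixP => s t; rewrite !mxE MM ?sz.
have iE l : hankel_in M l = hankel_in M' l.
  by apply/matrixP => s b; rewrite !mxE MM ?sz1.
have oE l : hankel_out M l = hankel_out M' l.
  by apply/matrixP => a t; rewrite !mxE MM ?sz1.
by rewrite /realization /realization_coef !hE // !iE !oE.
Qed.

End Moments.

Section MomentSpace.
Variables (R : realType) (r c : nat).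
Local Notation C := (R[i]).
Implicit Types D : datum R r c.

Definition moment_index : finType :=
  (bool * bool * {bseq c.*2.+1 of bool * bool} * 'I_r * 'I_r)%type.

Definition moment_space := affine_space R #|moment_index|.

(** The last coordinate of [moment_space] is set to 0: an affine space has
    at least one coordinate, while there may be no moment. *)
Definition moment_coord D (n : nat) : C :=
  if insub n is Some i then
    let x : moment_index := enum_val (i : 'I_#|moment_index|) in
    moment D x.1.1.1.1 x.1.1.1.2 x.1.1.2 x.1.2 x.2
  else 0.

Definition moments D : moment_space := affine_point #|moment_index| (moment_coord D).

Definition table_of (h : moment_space) : moment_table R r := fun k l w =>
  if insub w is Some w' then
    \matrix_(a, b) affine_coord h (enum_rank ((k, l, w', a, b) : moment_index))
  else 0.

Lemma table_of_moments D k l w : (size w <= c.*2.+1)%N ->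
  table_of (moments D) k l w = moment D k l w.
Proof.
move=> ws; rewrite /table_of insubT; apply/matrixP => a b; rewrite mxE.
rewrite affine_coord_point; last exact: ltnW (ltn_ord _).
rewrite /moment_coord insubT // => lt; rewrite /= -[X in enum_val X](_ : enum_rank
  ((k, l, Sub w ws, a, b) : moment_index) = _) ?enum_rankK //.
exact/val_inj.
Qed.

Lemma moments_inj_coord D (h : moment_space) :
  (forall n, (n <= #|moment_index|)%N -> moment_coord D n = affine_coord h n) -> moments D = h.
Proof. by move=> Dh; apply: affine_coord_inj => k kn; rewrite affine_coord_point // Dh. Qed.

Lemma moments_act g D : g \in unitmx -> moments (act_datum g D) = moments D.
Proof.
move=> gU; congr affine_point; apply/funext => n; rewrite /moment_coord.
by case: insub => // i; rewrite moment_act.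
Qed.

Lemma mx_diff_parts (E : normedModType C) (q : E -> quadruple R r c) x :
  differentiable q x -> [/\ mx_diff x (fun y => (q y).1.1.1),
  mx_diff x (fun y => (q y).1.1.2), mx_diff x (fun y => (q y).1.2)
  & mx_diff x (fun y => (q y).2)].
Proof.
move=> qd; have q1 := differentiable_comp qd (diff_fst _).
have q11 := differentiable_comp q1 (diff_fst _).
split; apply: mx_diff_coord.
- exact: differentiable_comp q11 (diff_fst _).
- exact: differentiable_comp q11 (diff_snd _).
- exact: differentiable_comp q1 (diff_snd _).
- exact: differentiable_comp qd (diff_snd _).
Qed.

Lemma diff_coef D k : differentiable (fun D' => coef D' k) D.
Proof. by case: k; [exact: diff_snd|exact: diff_fst]. Qed.

Lemma diff_moment_coord D n : differentiable (fun D' => moment_coord D' n) D.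
Proof.
rewrite /moment_coord; case: insub => [i|]; last exact: diff_k.
apply: mx_diff_mul; first apply: mx_diff_mul.
- by have [] := mx_diff_parts (diff_coef D (enum_val i).1.1.1.1).
- apply: mx_diff_word => -[b k]; have [dA dB _ _] := mx_diff_parts (diff_coef D k).
  by case: b.
- by have [] := mx_diff_parts (diff_coef D (enum_val i).1.1.1.2).
Qed.

Lemma continuous_moments D : {for D, continuous moments}.
Proof.
by apply: continuous_affine_point => k; exact: differentiable_continuous (diff_moment_coord D k).
Qed.

Lemma diff_datum_at D z0 z1 : differentiable (fun D' => datum_at D' z0 z1) D.
Proof.
exact: differentiableD (differentiableZ z0 (diff_fst D)) (differentiableZ z1 (diff_snd D)).
Qed.

Lemma mx_diff_adhm D z0 z1 : mx_diff D (fun D' => adhm_map (datum_at D' z0 z1)).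
Proof.
have [A B i j] := mx_diff_parts (diff_datum_at D z0 z1).
rewrite (_ : (fun D' => _) = (fun D' => let q := datum_at D' z0 z1 in
  q.1.1.1 *m q.1.1.2 - q.1.1.2 *m q.1.1.1 + q.1.2 *m q.2)).
  apply: mx_diff_add; last exact: mx_diff_mul i j.
  by apply: mx_diff_sub; [exact: mx_diff_mul A B|exact: mx_diff_mul B A].
by apply/funext => D'; case: (datum_at D' z0 z1) => [[[? ?] ?] ?].
Qed.

Variables S T : 'I_c -> seq bool * 'I_r.

Lemma mx_diff_table (h : moment_space) k l w :
  mx_diff h (fun h' => table_of h' k l w).
Proof.
rewrite /table_of; case: insub => [w'|]; last exact: mx_diff_cst.
move=> a b; rewrite (_ : (fun y => _) =
  (fun y => affine_coord y (enum_rank ((k, l, w', a, b) : moment_index)))).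
  exact: diff_affine_coord.
by apply/funext => y; rewrite mxE.
Qed.

Lemma mx_diff_hankel (h : moment_space) u :
  mx_diff h (fun h' => hankel_mx S T (table_of h') u).
Proof.
move=> s t; rewrite (_ : (fun y => _) = (fun y => table_of y false false
  (lift_word (T t).1 ++ u ++ lift_word (S s).1) (S s).2 (T t).2)).
  exact: mx_diff_table.
by apply/funext => y; rewrite mxE.
Qed.

Definition section_dom : set moment_space :=
  [set h | \det (hankel_mx S T (table_of h) [::]) != 0].

Definition sect (h : moment_space) : datum R r c := realization S T (table_of h).

Lemma open_section_dom : open section_dom.
Proof.
rewrite openE => h h0; rewrite /interior.
have := diff_det (mx_diff_hankel h [::]).
by move=> /differentiable_continuous /cvgr_neq0; apply.
Qed.

Lemma differentiable_sect h : section_dom h -> differentiable sect h.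
Proof.
move=> h0; have Hd := mx_diff_inv (mx_diff_hankel h [::]) h0.
have qd k : differentiable (fun h' => realization_coef S T (table_of h') k) h.
  apply: differentiable_pair; first apply: differentiable_pair;
    first apply: differentiable_pair; apply: mx_diffP.
  - exact: mx_diff_mul Hd (mx_diff_hankel h _).
  - exact: mx_diff_mul Hd (mx_diff_hankel h _).
  - apply: mx_diff_mul Hd _ => s b.
    rewrite (_ : (fun y => _) = (fun y => table_of y false k
      (lift_word (S s).1) (S s).2 b)); first exact: mx_diff_table.
    by apply/funext => y; rewrite mxE.
  - move=> a t; rewrite (_ : (fun y => _) = (fun y => table_of y k false
      (lift_word (T t).1) a (T t).2)); first exact: mx_diff_table.
    by apply/funext => y; rewrite mxE.
exact: differentiable_pair (qd false) (qd true).
Qed.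

Lemma sect_moments D : short S -> short T ->
  obs_mx D.1 S \in unitmx -> ctr_mx D.1 T \in unitmx ->
  section_dom (moments D) /\
  sect (moments D) = act_datum (invmx (ctr_mx D.1 T)) D.
Proof.
move=> Ss Ts LU KU; have tE := @table_of_moments D.
split; last first.
  by rewrite -(realization_moment LU KU); exact: realization_local tE.
rewrite /section_dom /=.
have -> : hankel_mx S T (table_of (moments D)) [::] = hankel_mx S T (moment D) [::].
  apply/matrixP => s t; rewrite [LHS]mxE [RHS]mxE tE //.
  by rewrite size_cat !size_map leqW // -addnn leq_add.
by rewrite det_hankel mulf_neq0 // -unitfE -unitmxE.
Qed.

End MomentSpace.

(** * Openness of global regularity *)

Section GlobalRegularity.
Variables (R : realType) (r c : nat).
Local Notation C := (R[i]).

Lemma continuous_neq0 (T : topologicalType) (f : T -> C) x :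
  {for x, continuous f} -> f x != 0 -> \forall y \near x, f y != 0.
Proof. by move=> fc; exact: cvgr_neq0 fc. Qed.

(** The minors of [regularP] remain nonzero. *)
Lemma regular_near (q : quadruple R r c) : regular_quadruple q ->
  \forall q' \near q, regular_quadruple q'.
Proof.
have [dA dB di dj] := mx_diff_parts (x := q) (q := id) (diff_linear q
  (fun _ _ _ => erefl) (fun _ => cvg_id)).
have dw w : mx_diff q (fun q' => word_mx (letter q') w).
  by apply: mx_diff_word => -[].
move=> /regularP[[T Ts KU] [S Ss LU]].
have dK : differentiable (fun q' => \det (ctr_mx q' T)) q.
  apply: diff_det => s t; rewrite (_ : (fun q' => _) = (fun q' : quadruple R r c =>
    (word_mx (letter q') (T t).1 *m q'.1.2) s (T t).2)).
    exact: mx_diff_mul (dw _) di _ _.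
  by apply/funext => q'; rewrite ctr_mxE.
have dL : differentiable (fun q' => \det (obs_mx q' S)) q.
  apply: diff_det => s t; rewrite (_ : (fun q' => _) = (fun q' : quadruple R r c =>
    (q'.2 *m word_mx (letter q') (S s).1) (S s).2 t)).
    exact: mx_diff_mul dj (dw _) _ _.
  by apply/funext => q'; rewrite obs_mxE.
have K0 : \det (ctr_mx q T) != 0 by rewrite -unitfE -unitmxE.
have L0 : \det (obs_mx q S) != 0 by rewrite -unitfE -unitmxE.
have nK := continuous_neq0 (differentiable_continuous dK) K0.
have nL := continuous_neq0 (differentiable_continuous dL) L0.
apply: filterS (filterI nK nL) => q' [Kq Lq]; apply/regularP; split.
  by exists T => //; rewrite unitmxE unitfE.
by exists S => //; rewrite unitmxE unitfE.
Qed.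

Lemma continuous_datum_at (p : datum R r c * (C * C)) :
  {for p, continuous (fun p => datum_at p.1 p.2.1 p.2.2)}.
Proof.
have c1 : fst @ p --> p.1 by exact: cvg_fst.
have c2 : snd @ p --> p.2 by exact: cvg_snd.
have c11 : (fst \o fst) @ p --> p.1.1 by apply: cvg_comp c1 _; exact: cvg_fst.
have c12 : (snd \o fst) @ p --> p.1.2 by apply: cvg_comp c1 _; exact: cvg_snd.
have c21 : (fst \o snd) @ p --> p.2.1 by apply: cvg_comp c2 _; exact: cvg_fst.
have c22 : (snd \o snd) @ p --> p.2.2 by apply: cvg_comp c2 _; exact: cvg_snd.
exact: cvgD (cvgZ c21 c11) (cvgZ c22 c12).
Qed.

Lemma scale_chart (V : lmodType C) (x y : V) (z0 z1 : C) : z0 != 0 ->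
  z0 *: x + z1 *: y = z0 *: (1 *: x + (z1 / z0) *: y).
Proof.
by move=> z00; rewrite scale1r scalerDr scalerA mulrCA mulfV // mulr1.
Qed.

(** It suffices to test regularity over the two closed unit discs covering the
    projective line, and these are compact. *)
Lemma globally_regular_near (D : datum R r c) : globally_regular D ->
  \forall D' \near D, globally_regular D'.
Proof.
move=> Dr; pose disc := [set z : C | nm z <= 1].
pose K : set (C * C) := ([set 1] `*` disc) `|` (disc `*` [set 1]).
have Kc : compact K.
  apply: compactU; apply: compact_setX; [exact: compact_set1|exact: compact_disc|
    exact: compact_disc|exact: compact_set1].
have K0 z : K z -> z <> (0, 0).
  move=> [[/= z1 _]|[/= _ z1]] zE; move: z1; rewrite zE /= => /eqP.
    by rewrite eq_sym oner_eq0.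
  by rewrite eq_sym oner_eq0.
have near : \forall D' \near D, forall z, K z -> regular_quadruple (datum_at D' z.1 z.2).
  apply: (near_compact (P := fun D' (z : C * C) =>
    regular_quadruple (datum_at D' z.1 z.2)) Kc) => -[z0 z1] /K0 z.
  have rD := regular_near (Dr z0 z1 z).
  exact: (continuous_datum_at (p := (D, (z0, z1))) rD).
apply: filterS near => D' D'K z0 z1 z.
have [z10|/ltW z01] := leP (nm z1) (nm z0).
  have z00 : z0 != 0.
    apply/eqP => z0E; apply: z; move: z10; rewrite z0E nm0 => z10; congr (_, _).
    by apply/eqP; apply: contraLR z10; rewrite -nm_gt0 -ltNge.
  have -> : datum_at D' z0 z1 = z0 *: datum_at D' 1 (z1 / z0).
    exact: scale_chart.
  apply: (regular_scale z00 (D'K (1, z1 / z0) _)); left; split=> //=.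
  by rewrite /disc /= nmM nmV ler_pdivrMr ?mul1r // nm_gt0.
have z10 : z1 != 0.
  apply/eqP => z1E; apply: z; move: z01; rewrite z1E nm0 => z01; congr (_, _).
  by apply/eqP; apply: contraLR z01; rewrite -nm_gt0 -ltNge.
have -> : datum_at D' z0 z1 = z1 *: datum_at D' (z0 / z1) 1.
  by rewrite /datum_at addrC [in RHS]addrC; exact: scale_chart.
apply: (regular_scale z10 (D'K (z0 / z1, 1) _)); right; split=> //=.
by rewrite /disc /= nmM nmV ler_pdivrMr ?mul1r // nm_gt0.
Qed.

Lemma globally_regular1 (D : datum R r c) : globally_regular D -> regular_quadruple D.1.
Proof.
move=> /(_ 1 0); rewrite /datum_at scale1r scale0r addr0; apply=> -[/eqP].
by rewrite oner_eq0.
Qed.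

End GlobalRegularity.

(** * The embedding of the moduli space by moments *)

Section ModuliSpace.
Variables (R : realType) (r c : nat).
Local Notation C := (R[i]).
Local Notation sol := (@adhm_solutions R r c).
Local Notation Mod := (M1 R r c).

Definition orbit_of (D : datum R r c) (DS : sol D) : Mod :=
  (\pi_(quotient_topology (orbit_space R r c)) (SigSub (mem_set DS)))%qT.

Definition rep (x : Mod) : datum R r c := set_val (repr x).

Lemma rep_solution x : sol (rep x).
Proof. exact: set_valP. Qed.

Lemma act_datum1 (D : datum R r c) : act_datum 1%:M D = D.
Proof. by case: D => q q'; rewrite /act_datum !act1. Qed.

Lemma orbit_eq (D D' : datum R r c) (DS : sol D) (DS' : sol D') g :
  g \in unitmx -> D' = act_datum g D -> orbit_of DS = orbit_of DS'.
Proof.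
move=> gU D'E; apply/(@eqmodP _ (same_orbit_equiv R r c)); apply/asboolP.
by exists g.
Qed.

Lemma orbit_rep x : orbit_of (rep_solution x) = x.
Proof.
rewrite -[RHS]reprK /orbit_of; congr (\pi_(_) _)%qT.
by apply/val_inj.
Qed.

Lemma rep_orbit (D : datum R r c) (DS : sol D) :
  exists2 g : 'M[C]_c, g \in unitmx & rep (orbit_of DS) = act_datum g D.
Proof.
have /(@eqmodP _ (same_orbit_equiv R r c)) /asboolP [g gU gE] :
    orbit_of DS = orbit_of (rep_solution (orbit_of DS)) by rewrite orbit_rep.
by exists g.
Qed.

(** By [moments_act] any representative can be used. *)
Definition moment_map (x : Mod) : moment_space R r c := moments (rep x).

Lemma moment_map_orbit D (DS : sol D) : moment_map (orbit_of DS) = moments D.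
Proof.
by rewrite /moment_map; have [g gU ->] := rep_orbit DS; exact: moments_act.
Qed.

Lemma continuous_moment_map : continuous moment_map.
Proof.
apply/quotient_continuous => D.
have c1 : {for D, continuous (fun D' : solution_space R r c => moments (set_val D'))}.
  apply: (@continuous_comp _ _ _ set_val (@moments R r c)); last exact: continuous_moments.
  exact: initial_continuous.
rewrite (_ : moment_map \o _ = fun D' : solution_space R r c => moments (set_val D')).
  exact: c1.
apply/funext => D' /=; rewrite -(moment_map_orbit (set_valP D')).
by congr moment_map; rewrite /orbit_of; congr (\pi_(_) _)%qT; apply/val_inj.
Qed.

Lemma section_domP S T (D : datum R r c) : short S -> short T ->
  section_dom S T (moments D) ->
  obs_mx D.1 S \in unitmx /\ ctr_mx D.1 T \in unitmx.
Proof.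
move=> Ss Ts; rewrite /section_dom /=.
have -> : hankel_mx S T (table_of (moments D)) [::] = hankel_mx S T (moment D) [::].
  apply/matrixP => s t; rewrite [LHS]mxE [RHS]mxE table_of_moments //.
  by rewrite size_cat !size_map leqW // -addnn leq_add.
by rewrite det_hankel mulf_eq0 negb_or -!unitfE -!unitmxE => /andP[].
Qed.

Lemma sect_solution S T D (DS : sol D) : short S -> short T ->
  section_dom S T (moments D) -> moments (sect S T (moments D)) = moments D /\
  exists DS' : sol (sect S T (moments D)), orbit_of DS' = orbit_of DS.
Proof.
move=> Ss Ts /(section_domP Ss Ts)[LU KU].
have [_ sE] := sect_moments Ss Ts LU KU.
have gU : invmx (ctr_mx D.1 T) \in unitmx by rewrite unitmx_inv.
split; first by rewrite sE moments_act.
have DS' : sol (sect S T (moments D)) by rewrite sE; exact: solution_act.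
by exists DS'; apply/esym; apply: orbit_eq gU sE.
Qed.

Lemma solution_words D : sol D -> exists S T : 'I_c -> seq bool * 'I_r,
  [/\ short S, short T & section_dom S T (moments D)].
Proof.
move=> [_ /globally_regular1 /regularP [[T Ts KU] [S Ss LU]]].
by exists S, T; split=> //; have [] := sect_moments Ss Ts LU KU.
Qed.

(** The moments determine a solution up to conjugation, since [sect] recovers a
    point of the orbit from them. *)
Lemma moment_map_inj : injective moment_map.
Proof.
move=> x y xy; have [S [T [Ss Ts hx]]] := solution_words (rep_solution x).
have [_ [DS DSx]] := sect_solution (rep_solution x) Ss Ts hx.
have hy : section_dom S T (moments (rep y)) by rewrite -[moments _]xy.
have [_ [DS' DSy]] := sect_solution (rep_solution y) Ss Ts hy.
rewrite -(orbit_rep x) -(orbit_rep y) -DSx -DSy.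
have e : sect S T (moments (rep x)) = sect S T (moments (rep y)).
  by congr sect; exact: xy.
apply: (@orbit_eq _ _ DS DS' 1%:M); first exact: unitmx1.
exact: etrans (esym e) (esym (act_datum1 _)).
Qed.

Lemma mx_neq0 m n (M : 'M[C]_(m, n)) : M != 0 -> exists a b, M a b != 0.
Proof.
move=> /eqP M0; apply: contrapT => H; apply: M0; apply/matrixP => a b.
by rewrite mxE; apply/eqP; apply: contrapT => /negP ab; apply: H; exists a, b.
Qed.

Lemma linehol_comp_sect S T (U : set (moment_space R r c)) (W : set (datum R r c))
    (g : datum R r c -> C) : holomorphic_on W g ->
  (forall h, U h -> section_dom S T h /\ W (sect S T h)) ->
  linehol U (fun h => g (sect S T h)).
Proof.
move=> gh UW; apply: differentiable_linehol => h Uh; have [hd Wh] := UW h Uh.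
exact: differentiable_comp (differentiable_sect hd) (gh _ Wh).
Qed.

(** Near the moments of a solution [D], a point [h] lies in the image of [Z]
    exactly if the datum [sect h] satisfies the equations of [sol], has [h] as
    moments and its orbit satisfies the equations of [Z]; each of these is
    holomorphic in [h]. *)
Lemma moment_image_analytic (Z : set Mod) :
  complex_subvariety (@M1_sheaf R r c) Z -> loc_analytic (moment_map @` Z).
Proof.
move=> Zan h0 [x0 Zx0 <-].
have [S [T [Ss Ts hx0]]] := solution_words (rep_solution x0).
set h := moment_map x0 in hx0 *; pose s := @sect R r c S T.
have [_ [DS DSx]] := sect_solution (rep_solution x0) Ss Ts hx0.
rewrite -/h -/s orbit_rep in DS DSx *.
have [UZ [n [f [UZo UZx fhol UZZ]]]] := Zan x0.
have [B Bo BE] := (UZo : open (\pi_(quotient_topology (orbit_space R r c)) @^-1` UZ)%qT).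
have inUZ D (D_S : sol D) : UZ (orbit_of D_S) <-> B D.
  by rewrite -[B D]/((set_val @^-1` B) (SigSub (mem_set D_S))) BE.
have ex_g i : exists Wg : set (datum R r c) * (datum R r c -> C),
    [/\ open Wg.1, Wg.1 (s h), holomorphic_on Wg.1 Wg.2 &
      forall D (D_S : sol D), UZ (orbit_of D_S) -> Wg.1 D ->
      f i (orbit_of D_S) = Wg.2 D].
  have UZs : UZ (orbit_of DS) by rewrite DSx.
  have [W [g [Wo Wx gh gE]]] := fhol i (SigSub (mem_set DS)) UZs.
  by exists (W, g); split=> // D D_S; exact: (gE (SigSub (mem_set D_S))).
have [Wg WgP] := choice ex_g.
have Bs : B (s h) by apply/(inUZ _ DS); rewrite DSx.
have nearB : \forall D \near s h, [/\ B D, globally_regular D & forall i, (Wg i).1 D].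
  have n1 : \forall D \near s h, B D by exact: open_nbhs_nbhs.
  have n2 : \forall D \near s h, forall i, (Wg i).1 D.
    apply: (@filter_forall _ _ (fun i => (Wg i).1) (nbhs (s h))) => i.
    by have [Wo Ws _ _] := WgP i; exact: open_nbhs_nbhs.
  have n3 := globally_regular_near (proj2 DS).
  by apply: filterS (filterI n1 (filterI n3 n2)) => D [? []].
have nearU : \forall h' \near h, section_dom S T h' /\
    [/\ B (s h'), globally_regular (s h') & forall i, (Wg i).1 (s h')].
  apply: filterI.
    by apply: open_nbhs_nbhs; split=> //; exact: open_section_dom.
  exact: (differentiable_continuous (differentiable_sect hx0) nearB).
have [U [Uo Uh UP]] := near_open nearU.
have onX h' x : U h' -> moment_map x = h' -> moments (s h') = h' /\
    exists D_S : sol (s h'), orbit_of D_S = x.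
  move=> Uh' xh'; rewrite -{}xh' in Uh' *; have [hd _] := UP _ Uh'.
  by have := sect_solution (rep_solution x) Ss Ts hd; rewrite orbit_rep.
exists U; split=> // y Uy nXy.
have [yd [By yreg Wy]] := UP y Uy.
have Uhol W g : holomorphic_on W g -> (forall h', U h' -> W (s h')) ->
    linehol U (fun h' => g (s h')).
  move=> gh WU; apply: linehol_comp_sect gh _ => h' Uh'.
  by split; [have [] := UP h' Uh'|exact: WU].
(* First case: the ADHM equations fail for [s y]. *)
have [adhm0|] := pselect (forall z0 z1, adhm_map (datum_at (s y) z0 z1) = 0); last first.
  move=> /existsNP[z0 /existsNP[z1 /eqP nz]].
  have [a [b ab]] := mx_neq0 nz.
  exists (fun h' => adhm_map (datum_at (s h') z0 z1) a b); split=> //.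
    apply: (@Uhol setT (fun D => adhm_map (datum_at D z0 z1) a b)) => // D _.
    exact: mx_diff_adhm.
  move=> h' Uh' [x Zx xh']; have [_ [[D0 _] _]] := onX h' x Uh' xh'.
  by rewrite D0 mxE.
have yS : sol (s y) by split.
(* Second case: [s y] is a solution whose moments differ from [y]. *)
have [my|nmy] := pselect (moments (s y) = y); last first.
  have [k [kn ky]] : exists k, (k <= #|moment_index r c|)%N /\
      moment_coord (s y) k - affine_coord y k != 0.
    apply: contrapT => H; apply: nmy; apply: moments_inj_coord => k kn.
    apply/eqP; rewrite -subr_eq0; apply: contrapT => /negP H'.
    by apply: H; exists k.
  exists (fun h' => moment_coord (s h') k - affine_coord h' k); split=> //.
    apply: linehol_sub_fun.
      apply: (@Uhol setT (fun D => moment_coord D k)) => // D _.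
      exact: diff_moment_coord.
    by apply: differentiable_linehol => h' _; exact: diff_affine_coord.
  move=> h' Uh' [x Zx xh']; have [e _] := onX h' x Uh' xh'.
  by apply/eqP; rewrite subr_eq0 -{2}e /moments affine_coord_point.
(* Third case: [y] is the image of an orbit near [x0] outside of [Z]. *)
have UZy : UZ (orbit_of yS) by apply/inUZ.
have nZy : ~ Z (orbit_of yS).
  by move=> Zy; apply: nXy; exists (orbit_of yS) => //; rewrite moment_map_orbit.
have [i fi] : exists i, f i (orbit_of yS) != 0.
  apply: contrapT => H; apply: nZy; apply/(UZZ _ UZy) => i.
  by apply/eqP; apply: contrapT => /negP H'; apply: H; exists i.
have [_ _ gh gE] := WgP i.
exists (fun h' => (Wg i).2 (s h')); split.
- by apply: Uhol gh _ => h' /UP[_ [_ _]].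
- move=> h' Uh' [x Zx xh']; have [_ [D_S DSx']] := onX h' x Uh' xh'.
  have [_ [Bh' _ Wh']] := UP h' Uh'.
  have UZh : UZ (orbit_of D_S) by apply/inUZ.
  by rewrite -(gE _ D_S) //; apply: (UZZ _ UZh).1; rewrite DSx'.
by rewrite -(gE _ yS).
Qed.

(** An open set contains a disc in a coordinate direction. *)
Lemma open_row_infinite d (V : set 'rV[C]_d) v : (0 < d)%N -> open V -> V v ->
  ~ finite_set V.
Proof.
case: d V v => // d V v _ Vo Vv Vfin.
pose e : 'rV[C]_d.+1 := delta_mx 0 ord0; pose line (t : C) := t *: e + v.
have linec : {for 0, continuous line}.
  exact: (@cont_line R C 'rV[C]_d.+1 id 0 e v cont_id).
have nV : \forall t \near (0 : C), V (line t).
  apply: linec; rewrite /line scale0r add0r; exact: open_nbhs_nbhs.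
have fin : finite_set (line @^-1` V).
  apply: finite_preimage Vfin => t t' _ _ /addIr /rowP/(_ ord0).
  by rewrite !mxE !eqxx !mulr1.
have /finite_seqP[ts tsE] := fin.
have [t tts Vt] := nbhs_notin ts nV.
have : [set` ts] t by rewrite -tsE.
by move/negP: tts.
Qed.

End ModuliSpace.

Theorem corollary10 (R : realType) (r c : nat) (hr : (0 < r)%N) (hc : (0 < c)%N)
    (Z : set (M1 R r c)) :
  complex_subvariety (@M1_sheaf R r c) Z -> compact Z ->
  ~ (0 < subvariety_dim (@M1_sheaf R r c) Z)%E.
Proof.
move=> Zan Zc /ereal_sup_gt[_ [d [x [Zx [U [V [phi [psi P]]]]]] <-]].
rewrite lte_fin ltr0n => d0; have [[Uo Ux] Vo [_ phiZ] psiZ _] := P.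
have Xfin : finite_set (@moment_map R r c @` Z).
  apply: compact_analytic_finite; last exact: moment_image_analytic.
  by apply: continuous_compact Zc; apply: continuous_subspaceT; exact: continuous_moment_map.
have Zfin : finite_set Z.
  apply: sub_finite_set (finite_preimage (f := @moment_map R r c) _ Xfin).
    by move=> y Zy; exists y.
  by move=> y y' _ _; exact: moment_map_inj.
apply: (open_row_infinite d0 Vo (phiZ x (conj Zx Ux)).1).
apply: sub_finite_set (finite_image phi Zfin) => v Vv.
by have [[Zv _] pv] := psiZ v Vv; exists (psi v).
Qed.
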